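(* Let $n>1$, $L=\prod_{i=1}^nSL_2$, and let $\sigma\in\Sigma$ be an order type. Then: (1) There is an isomorphism of $\Lambda_{\mathcal{B}}(\sigma)$-graded $SL_2$-algebras $\phi_\sigma:\mathcal{B}_\sigma\to\mathcal{A}_\sigma$, and it is unique up to scalars: if $\widetilde\phi_\sigma:\mathcal{B}_\sigma\to\mathcal{A}_\sigma$ is another such isomorphism, then for every $p=(\mu,\lambda)\in\Lambda_{\mathcal{B}}(\sigma)$ there is $c_p\in\mathbb{C}^\times$ with $\phi_\sigma|_{W^{\lambda/\mu}}=c_p\,\widetilde\phi_\sigma|_{W^{\lambda/\mu}}$. (2) The representation $(\Phi_\sigma,\mathcal{B}_\sigma)$ of $L$ defined by transferring the action $\theta_\sigma$ of $L$ on $\mathcal{A}_\sigma$, namely $\Phi_\sigma(g)=\phi_\sigma^{-1}\circ\theta_\sigma(g)\circ\phi_\sigma$ for $g\in L$, is canonical, i.e. independent of the choice of isomorphism $\phi_\sigma$ in (1).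
   Context: All groups are over $\mathbb{C}$. $\Lambda_k$ is the semigroup of weakly decreasing sequences of $k$ non-negative integers; $\Lambda_{n-1,n}=\Lambda_{n-1}\times\Lambda_n$; for $\lambda\in\Lambda_n$, $\lambda^+\in\Lambda_{n+1}$ is $\lambda$ with a zero appended. Let $s_n$ be the $n\times n$ antidiagonal matrix of ones, $J_n=\begin{bmatrix}0&s_n\\-s_n&0\end{bmatrix}$, $Sp_{2n}=\{g\in GL_{2n}: g^tJ_ng=J_n\}$, with standard basis of $\mathbb{C}^{2n}$ labelled $e_{\pm1},\dots,e_{\pm n}$, $e_{-i}=e_{2n+1-i}$. Let $T_{C_n},U_{C_n},\overline{U}_{C_n}$ be the intersections of $Sp_{2n}$ with the diagonal, upper-triangular unipotent and lower-triangular unipotent matrices. $Sp_{2n-2}\subset Sp_{2n}$ is the subgroup fixing $e_{\pm n}$; $T_{C_{n-1}}=T_{C_n}\cap Sp_{2n-2}$, $U_{C_{n-1}}=U_{C_n}\cap Sp_{2n-2}$. The branching algebra is $$\mathcal{B}=\{f\in\mathcal{O}(Sp_{2n}): f(\overline{u}gu)=f(g)\ \forall\,\overline{u}\in\overline{U}_{C_n},\,u\in U_{C_{n-1}}\}=\bigoplus_{(\mu,\lambda)\in\Lambda_{n-1,n}}W^{\lambda/\mu},$$ where $W^{\lambda/\mu}=\{f\in\mathcal{B}: f(tgs)=t^\lambda s^\mu f(g)\ \forall\, t\in T_{C_n},\,s\in T_{C_{n-1}}\}$ (with $t^\lambda=\prod_{i\le n}t_i^{\lambda_i}$ for $t=\mathrm{diag}(t_1,\dots,t_n,t_n^{-1},\dots,t_1^{-1})$,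 similarly $s^\mu$). $SL_2=\{g\in Sp_{2n}: ge_{\pm i}=e_{\pm i},\ i=1,\dots,n-1\}$ acts on $\mathcal{B}$ by right translation, preserving each $W^{\lambda/\mu}$. Set $\Lambda_{\mathcal{B}}=\{(\mu,\lambda)\in\Lambda_{n-1,n}: W^{\lambda/\mu}\neq\{0\}\}$, a semigroup under entrywise addition (classically, $(\mu,\lambda)\in\Lambda_{\mathcal{B}}$ iff $\lambda^+_i\ge\mu_i\ge\lambda^+_{i+2}$ for $i=1,\dots,n-1$). An order type $\sigma=(\sigma_1\cdots\sigma_{n-1})$ is a word of length $n-1$ in the alphabet $\{\ge,\le\}$; $\Sigma$ is the set of order types. $(\mu,\lambda)\in\Lambda_{\mathcal{B}}$ is of order type $\sigma$ if for each $i=1,\dots,n-1$: $\mu_i\ge\lambda_{i+1}$ when $\sigma_i$ is $\ge$, and $\mu_i\le\lambda_{i+1}$ when $\sigma_i$ is $\le$. $\Lambda_{\mathcal{B}}(\sigma)$ is the sub-semigroup of elements of order type $\sigma$, and $\mathcal{B}_\sigma=\bigoplus_{(\mu,\lambda)\in\Lambda_{\mathcal{B}}(\sigma)}W^{\lambda/\mu}$, an $SL_2$-invariant subalgebra of $\mathcal{B}$. For $(\mu,\lambda)\in\Lambda_{n-1,n}$ let $(x_1\ge y_1\ge\cdots\ge x_n\ge y_n)$ be the non-increasing rearrangement of $(\mu_1,\dots,\mu_{n-1},\lambda_1,\dots,\lambda_n,0)$ and $r_i(\mu,\lambda^+)=x_i-y_i$. $F^k=\mathcal{O}^k(\mathbb{C}^2)$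 is the $(k+1)$-dimensional irreducible $SL_2$-module of homogeneous polynomials of degree $k$. $A^{\lambda/\mu}=\bigotimes_{i=1}^nF^{r_i(\mu,\lambda^+)}$, an irreducible $L$-module (the $i$-th factor of $L$ acts on the $i$-th tensor factor). $\mathcal{A}_\sigma=\bigoplus_{(\mu,\lambda)\in\Lambda_{\mathcal{B}}(\sigma)}A^{\lambda/\mu}$, with $L$-action $\theta_\sigma$, is a graded algebra with product $A^{\lambda/\mu}\otimes A^{\lambda'/\mu'}\to A^{\lambda+\lambda'/\mu+\mu'}$ given by factorwise multiplication of polynomials $F^k\otimes F^{k'}\to F^{k+k'}$ (the $r_i$ are additive on $\Lambda_{\mathcal{B}}(\sigma)$). $SL_2$ acts on $\mathcal{A}_\sigma$ via the diagonal embedding $SL_2\subset L$. A graded $SL_2$-algebra isomorphism is an $SL_2$-equivariant algebra isomorphism mapping $W^{\lambda/\mu}$ onto $A^{\lambda/\mu}$ for each $(\mu,\lambda)\in\Lambda_{\mathcal{B}}(\sigma)$. *)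

(* Defs.v *)
From HB Require Import structures.
From mathcomp Require Import all_boot all_order all_algebra.
From mathcomp Require Import boolp classical_sets functions reals.
From mathcomp.real_closed Require Import complex.
From mathcomp Require Import mpoly ring zify.

Set Implicit Arguments.
Unset Strict Implicit.
Unset Printing Implicit Defensive.

Import Order.TTheory GRing.Theory Num.Theory.
Local Open Scope ring_scope.
Local Open Scope classical_set_scope.

(* The basis of C^(2n) is e_1, ..., e_n, e_{-n}, ..., e_{-1}, in this order:
   the 0-based index i < n stands for e_(i+1), and rev_ord of it for
   e_{-(i+1)}; in particular e_n and e_{-n} have the indices n.-1 and n. *)

Definition anti_mx (C : fieldType) (n : nat) : 'M[C]_n :=
  \matrix_(i, j) (i == rev_ord j)%:R.

Definition J_mx (C : fieldType) (n : nat) : 'M[C]_(n + n) :=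
  block_mx 0 (anti_mx C n) (- anti_mx C n) 0.

Lemma anti_mxK (C : fieldType) (n : nat) : anti_mx C n *m anti_mx C n = 1%:M.
Proof.
apply/matrixP => i j; rewrite !mxE (bigD1 (rev_ord j)) //= !mxE rev_ordK eqxx.
rewrite mulr1 big1 ?addr0 // => k kj; rewrite !mxE.
by rewrite (negPf kj) mulr0.
Qed.

Lemma J_mxK (C : fieldType) (n : nat) : J_mx C n *m J_mx C n = - 1%:M.
Proof.
rewrite /J_mx mulmx_block !mul0mx !mulmx0 !mulmxN !mulNmx anti_mxK.
by rewrite !addr0 !add0r scalar_mx_block opp_block_mx !oppr0.
Qed.

Definition is_symplectic (C : fieldType) (n : nat) (g : 'M[C]_(n + n)) : bool :=
  g^T *m J_mx C n *m g == J_mx C n.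

Record Sp (C : fieldType) (n : nat) : Type := MkSp {
  sp_mx :> 'M[C]_(n + n);
  sp_mxP : is_symplectic sp_mx
}.
HB.instance Definition _ (C : fieldType) (n : nat) := [isSub for @sp_mx C n].
HB.instance Definition _ (C : fieldType) (n : nat) := [Choice of Sp C n by <:].

Section SpGroup.
Variables (C : fieldType) (n : nat).
Implicit Types g h : Sp C n.

Lemma sp_one_subproof : is_symplectic (1%:M : 'M[C]_(n + n)).
Proof. by rewrite /is_symplectic trmx1 mul1mx mulmx1. Qed.

Lemma sp_mul_subproof g h : is_symplectic (sp_mx g *m sp_mx h).
Proof.
have /eqP Pg := sp_mxP g; have /eqP Ph := sp_mxP h.
apply/eqP; rewrite trmx_mul -!mulmxA (mulmxA (sp_mx g)^T) (mulmxA _ _ (sp_mx h)).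
by rewrite Pg mulmxA Ph.
Qed.

Lemma sp_linv g : - (J_mx C n *m (sp_mx g)^T *m J_mx C n) *m sp_mx g = 1%:M.
Proof.
have /eqP Pg := sp_mxP g.
by rewrite mulNmx -!mulmxA (mulmxA _ _ (sp_mx g)) Pg J_mxK opprK.
Qed.

Lemma sp_unitmx g : sp_mx g \in unitmx.
Proof. by have [] := mulmx1_unit (sp_linv g). Qed.

Lemma sp_inv_subproof g : is_symplectic (invmx (sp_mx g)).
Proof.
have /eqP Pg := sp_mxP g; apply/eqP.
rewrite -{1}Pg !mulmxA -trmx_mul mulmxV ?sp_unitmx // trmx1 mul1mx.
by rewrite -mulmxA mulmxV ?sp_unitmx // mulmx1.
Qed.

Definition sp_one : Sp C n := MkSp sp_one_subproof.
Definition sp_mul g h : Sp C n := MkSp (sp_mul_subproof g h).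
Definition sp_inv g : Sp C n := MkSp (sp_inv_subproof g).

Lemma sp_mulA : associative sp_mul.
Proof. by move=> x y z; apply: val_inj; rewrite /= mulmxA. Qed.
Lemma sp_mul1 : left_id sp_one sp_mul.
Proof. by move=> x; apply: val_inj; rewrite /= mul1mx. Qed.
Lemma sp_1mul : right_id sp_one sp_mul.
Proof. by move=> x; apply: val_inj; rewrite /= mulmx1. Qed.
Lemma sp_mulV : left_inverse sp_one sp_inv sp_mul.
Proof. by move=> x; apply: val_inj; rewrite /= mulVmx ?sp_unitmx. Qed.
Lemma sp_Vmul : right_inverse sp_one sp_inv sp_mul.
Proof. by move=> x; apply: val_inj; rewrite /= mulmxV ?sp_unitmx. Qed.

HB.instance Definition _ :=
  isGroup.Build (Sp C n) sp_mulA sp_mul1 sp_1mul sp_mulV sp_Vmul.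
End SpGroup.

Record SL2 (C : fieldType) : Type := MkSL2 {
  sl2_mx :> 'M[C]_2;
  sl2_mxP : \det sl2_mx == 1
}.
HB.instance Definition _ (C : fieldType) := [isSub for @sl2_mx C].
HB.instance Definition _ (C : fieldType) := [Choice of SL2 C by <:].

Section SL2Group.
Variable C : fieldType.
Implicit Types g h : SL2 C.

Lemma sl2_one_subproof : \det (1%:M : 'M[C]_2) == 1.
Proof. by rewrite det1. Qed.

Lemma sl2_mul_subproof g h : \det (sl2_mx g *m sl2_mx h) == 1.
Proof. by rewrite det_mulmx (eqP (sl2_mxP g)) (eqP (sl2_mxP h)) mulr1. Qed.

Lemma sl2_inv_subproof g : \det (invmx (sl2_mx g)) == 1.
Proof. by rewrite det_inv (eqP (sl2_mxP g)) invr1. Qed.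

Lemma sl2_unitmx g : sl2_mx g \in unitmx.
Proof. by rewrite unitmxE (eqP (sl2_mxP g)) unitr1. Qed.

Definition sl2_one : SL2 C := MkSL2 sl2_one_subproof.
Definition sl2_mul g h : SL2 C := MkSL2 (sl2_mul_subproof g h).
Definition sl2_inv g : SL2 C := MkSL2 (sl2_inv_subproof g).

Lemma sl2_mulA : associative sl2_mul.
Proof. by move=> x y z; apply: val_inj; rewrite /= mulmxA. Qed.
Lemma sl2_mul1 : left_id sl2_one sl2_mul.
Proof. by move=> x; apply: val_inj; rewrite /= mul1mx. Qed.
Lemma sl2_1mul : right_id sl2_one sl2_mul.
Proof. by move=> x; apply: val_inj; rewrite /= mulmx1. Qed.
Lemma sl2_mulV : left_inverse sl2_one sl2_inv sl2_mul.
Proof. by move=> x; apply: val_inj; rewrite /= mulVmx ?sl2_unitmx. Qed.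
Lemma sl2_Vmul : right_inverse sl2_one sl2_inv sl2_mul.
Proof. by move=> x; apply: val_inj; rewrite /= mulmxV ?sl2_unitmx. Qed.

HB.instance Definition _ :=
  isGroup.Build (SL2 C) sl2_mulA sl2_mul1 sl2_1mul sl2_mulV sl2_Vmul.
End SL2Group.

(* A group for the componentwise operations, like every {ffun I -> G}. *)
Definition Lgrp (C : fieldType) (n : nat) : Type := {ffun 'I_n -> SL2 C}.

Definition L_diag (C : fieldType) (n : nat) (h : SL2 C) : Lgrp C n :=
  [ffun=> h].

Section Subgroups.
Variables (C : fieldType) (n : nat).
Implicit Types g : Sp C n.

Definition e_pos (i : 'I_n) : 'cV[C]_(n + n) := delta_mx (lshift n i) 0.
Definition e_neg (i : 'I_n) : 'cV[C]_(n + n) := delta_mx (rev_ord (lshift n i)) 0.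

Definition in_T g : Prop := is_diag_mx (sp_mx g).

Definition in_U g : Prop :=
  (forall i, g i i = 1) /\ (forall i j : 'I_(n + n), (j < i)%N -> g i j = 0).

Definition in_Ubar g : Prop :=
  (forall i, g i i = 1) /\ (forall i j : 'I_(n + n), (i < j)%N -> g i j = 0).

Definition in_Sp_pred g : Prop :=
  forall i : 'I_n, i.+1 = n -> g *m e_pos i = e_pos i /\ g *m e_neg i = e_neg i.

Definition in_SL2 g : Prop :=
  forall i : 'I_n, (i.+1 < n)%N ->
    g *m e_pos i = e_pos i /\ g *m e_neg i = e_neg i.

(* The columns are e_n and e_{-n}. *)
Definition last_mx : 'M[C]_(n + n, 2) :=
  \matrix_(i, j) (i == (n.-1 + j)%N :> nat)%:R.

(* The matrix h acts on the span of e_n, e_{-n}; the other basis vectors are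
   fixed. *)
Definition sl2_emb_mx (h : 'M[C]_2) : 'M[C]_(n + n) :=
  1%:M + last_mx *m (h - 1%:M) *m last_mx^T.

End Subgroups.

Section SL2Embedding.
Variable C : fieldType.

Lemma last_mxE (m : nat) : last_mx C m.+1 =
  block_mx (delta_mx ord_max 0) 0 0 (delta_mx ord0 0) :> 'M_(m.+1 + m.+1, 1 + 1).
Proof.
apply/matrixP => i j; rewrite !mxE /=; case: splitP => i' ei; rewrite mxE;
  case: splitP => j' ej; rewrite !mxE ei ej ?ord1 /= ?addn0 ?addn1.
- by rewrite andbT -val_eqE.
- by rewrite (ltn_eqF (ltn_ord _)).
- by rewrite gtn_eqF // ltn_addr.
- by rewrite andbT -val_eqE /= -[X in _ == X]addn0 eqn_add2l.
Qed.

Lemma anti_mx1 : anti_mx C 1 = 1%:M.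
Proof. by apply/matrixP => i j; rewrite !mxE !ord1. Qed.

Lemma anti_mx_delta (n : nat) (k : 'I_n) :
  anti_mx C n *m delta_mx k (0 : 'I_1) = delta_mx (rev_ord k) 0.
Proof.
apply/matrixP => i j; rewrite !mxE !ord1 (bigD1 k) //= !mxE !eqxx mulr1 andbT.
by rewrite big1 ?addr0 // => l lk; rewrite !mxE (negPf lk) mulr0.
Qed.

Lemma J_last (m : nat) :
  J_mx C m.+1 *m last_mx C m.+1 = last_mx C m.+1 *m (J_mx C 1 : 'M_2).
Proof.
rewrite last_mxE.
rewrite -[LHS]/(@mulmx _ _ _ (1 + 1) _ _) -[RHS]/(@mulmx _ _ (1 + 1) (1 + 1) _ _).
rewrite /J_mx !mulmx_block !mul0mx !mulmx0 !add0r !addr0 anti_mx1.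
rewrite mulmxN !mulmx1 mulNmx !anti_mx_delta.
have -> : rev_ord ord0 = ord_max :> 'I_m.+1 by apply: val_inj; rewrite /= subn1.
by have -> : rev_ord ord_max = ord0 :> 'I_m.+1 by apply: val_inj; rewrite /= subnn.
Qed.

Lemma J_tr (n : nat) : (J_mx C n)^T = - J_mx C n.
Proof.
have s_tr : (anti_mx C n)^T = anti_mx C n.
  by apply/matrixP => i j; rewrite !mxE -(inj_eq rev_ord_inj) rev_ordK eq_sym.
by rewrite /J_mx tr_block_mx linearN /= !trmx0 s_tr opp_block_mx !oppr0 opprK.
Qed.

Lemma last_tr_last (m : nat) : (last_mx C m.+1)^T *m last_mx C m.+1 = 1%:M.
Proof.
rewrite last_mxE.
rewrite -[LHS]/(@mulmx _ (1 + 1) _ (1 + 1) (block_mx _ _ _ _)^T _).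
rewrite tr_block_mx !trmx0 !trmx_delta mulmx_block.
rewrite !mul0mx !mulmx0 !addr0 !add0r !mul_delta_mx.
have e11 (k : 'I_1) : delta_mx k k = 1%:M :> 'M[C]_1.
  by apply/matrixP => i j; rewrite !mxE !ord1.
by rewrite !e11 -scalar_mx_block.
Qed.

Lemma tr_last_J (m : nat) :
  (last_mx C m.+1)^T *m J_mx C m.+1 = (J_mx C 1 : 'M_2) *m (last_mx C m.+1)^T.
Proof.
have jT : (J_mx C 1 : 'M_2)^T = - (J_mx C 1 : 'M_2) := J_tr 1.
apply: trmx_inj; rewrite !trmx_mul !trmxK J_tr mulNmx J_last -mulmxN.
by congr (_ *m _); rewrite -jT.
Qed.

Lemma J_mx2 (h : 'M[C]_2) :
  h^T *m (J_mx C 1 : 'M_2) *m h = \det h *: (J_mx C 1 : 'M_2).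
Proof.
have JE (i j : 'I_2) :
    (J_mx C 1 : 'M_2) i j = (i < j)%N%:R - (j < i)%N%:R.
  rewrite /J_mx anti_mx1 !mxE; case: splitP => i' ->; rewrite mxE;
    by case: splitP => j' ->; rewrite !mxE !ord1 ?subr0 ?sub0r ?subrr.
have detE : \det h = h 0 0 * h 1 1 - h 0 1 * h 1 0.
  rewrite (expand_det_row _ 0) !big_ord_recl big_ord0 addr0 /cofactor !det_mx11.
  rewrite !mxE /= expr0 expr1 mul1r mulN1r mulrN.
  by congr (_ * h _ _ - h _ _ * h _ _); apply: val_inj.
move: (J_mx C 1 : 'M_2) JE => jm JE.
apply/matrixP => i j; rewrite !mxE detE !big_ord_recl !big_ord0 !mxE.
rewrite !big_ord_recl !big_ord0 !mxE !JE.
have -> : lift ord0 ord0 = 1 :> 'I_2 by apply: val_inj.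
rewrite /= !addr0 !subr0 !sub0r.
have /orP[/eqP->|/eqP->] : (i == 0) || (i == 1) by case: i => [[|[|]]].
  have /orP[/eqP->|/eqP->] : (j == 0) || (j == 1) by case: j => [[|[|]]].
    by rewrite /=; ring.
  by rewrite /=; ring.
have /orP[/eqP->|/eqP->] : (j == 0) || (j == 1) by case: j => [[|[|]]].
  by rewrite /=; ring.
by rewrite /=; ring.
Qed.

Lemma sl2_emb_subproof (n : nat) (h : SL2 C) :
  is_symplectic (sl2_emb_mx n (sl2_mx h)).
Proof.
case: n => [|m]; first by apply/eqP/matrixP => -[].
set E := last_mx C m.+1; set u := sl2_mx h - 1%:M; set j := J_mx C 1 : 'M_2.
have uE : u^T *m j + j *m u + u^T *m j *m u = 0.
  have := J_mx2 (sl2_mx h); rewrite (eqP (sl2_mxP h)) scale1r.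
  have : sl2_mx h = u + 1%:M by rewrite /u addrNK.
  rewrite -/j; move: u => u ->.
  rewrite [(u + 1%:M)^T]raddfD /= trmx1 !mulmxDl !mulmxDr !mul1mx !mulmx1.
  rewrite addrA => /(congr1 (+%R^~ (- j))); rewrite subrr addrK => <-.
  by rewrite -[RHS]addrA [RHS]addrC.
rewrite /is_symplectic /sl2_emb_mx -/E -/u; clearbody u; apply/eqP.
have -> : (1%:M + E *m u *m E^T)^T = 1%:M + E *m u^T *m E^T.
  by rewrite raddfD /= trmx1 !trmx_mul trmxK mulmxA.
rewrite !mulmxDl !mulmxDr !mul1mx !mulmx1.
have -> : E *m u^T *m E^T *m J_mx C m.+1 = E *m (u^T *m j) *m E^T.
  by rewrite -!mulmxA tr_last_J.
have -> : J_mx C m.+1 *m (E *m u *m E^T) = E *m (j *m u) *m E^T.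
  by rewrite !mulmxA J_last.
have -> : E *m (u^T *m j) *m E^T *m (E *m u *m E^T) =
    E *m (u^T *m j *m u) *m E^T.
  by rewrite -!mulmxA (mulmxA E^T) last_tr_last mul1mx.
rewrite -!addrA -[RHS]addr0; congr (_ + _).
by rewrite -!mulmxDl -!mulmxDr addrCA addrA uE mulmx0 mul0mx.
Qed.

Definition sl2_emb (n : nat) (h : SL2 C) : Sp C n :=
  MkSp (sl2_emb_subproof n h).

End SL2Embedding.

Lemma sl2_emb_image (C : fieldType) (m : nat) (g : Sp C m.+1) :
  in_SL2 g <-> exists h : SL2 C, g = sl2_emb m.+1 h.
Proof.
set E := last_mx C m.+1; set J := J_mx C m.+1; set j := J_mx C 1 : 'M_2.
pose P : 'M[C]_(m.+1 + m.+1) := 1%:M - E *m E^T.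
have EE : E^T *m E = 1%:M := last_tr_last C m.
have fixE (k : 'I_(m.+1 + m.+1)) : (forall l : 'I_2, k != (m + l)%N :> nat) ->
    forall A : 'M_2, (1%:M + E *m A *m E^T) *m (delta_mx k 0 : 'cV_ _) = delta_mx k 0.
  move=> Ek A; rewrite mulmxDl mul1mx -mulmxA [E^T *m _](_ : _ = 0).
    by rewrite mulmx0 addr0.
  apply/matrixP => l c; rewrite !mxE big1 // => i _; rewrite !mxE.
  case: (i =P k) => [->|_]; last by rewrite mulr0.
  by rewrite (negPf (Ek l)) mul0r.
have gP : in_SL2 g -> g *m P = P.
  move=> g_fix; suff gPk k : g *m (P *m delta_mx k (0 : 'I_1)) = P *m delta_mx k 0.
    apply/matrixP => i k; have := congr1 (fun v : 'cV_ _ => v i 0) (gPk k).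
    by rewrite mulmxA -!colE !mxE.
  have PE : P = 1%:M + E *m (- 1%:M) *m E^T by rewrite mulmxN mulmx1 mulNmx.
  have [/existsP[l /eqP kl]|/existsPn kE] := boolP [exists l : 'I_2, k == (m + l)%N :> nat].
    have -> : delta_mx k 0 = E *m delta_mx l (0 : 'I_1).
      rewrite -colE; apply/matrixP => i c.
      by rewrite !mxE !ord1 eqxx andbT -val_eqE /= kl.
    by rewrite [P *m _]mulmxA mulmxBl mul1mx -(mulmxA E) EE mulmx1 subrr mul0mx mulmx0.
  rewrite PE fixE //; have [lt_km|le_mk] := ltnP k m.+1.
    have [//|+ _] := g_fix (Ordinal lt_km).
      by have := kE 0; rewrite addn0 /= => nkm; rewrite ltnS ltn_neqAle nkm.
    by rewrite /e_pos [lshift _ _](_ : _ = k) //; apply: val_inj.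
  have ltk : (rev_ord k < m.+1)%N.
    by have := ltn_ord k; rewrite /=; lia.
  have [|_] := g_fix (Ordinal ltk).
    by have := ltn_ord k; have := kE 1; rewrite /= => /eqP; lia.
  rewrite /e_neg [lshift _ _](_ : _ = rev_ord k) ?rev_ordK //.
  exact: val_inj.
split=> [/gP {}gP|[h ->] i lt_in]; last first.
  by split; apply: fixE => l; apply/eqP; have := ltn_ord l; rewrite /=; lia.
have EtJ : E^T *m J = j *m E^T := tr_last_J C m.
have JE : J *m E = E *m j := J_last C m.
have PT : P^T = P by rewrite raddfB /= trmx1 trmx_mul trmxK.
have /eqP Pg := sp_mxP g.
have JP : J *m P = P *m J.
  by rewrite mulmxBr mulmxBl mul1mx mulmx1 -mulmxA EtJ !mulmxA JE.
have PE : P *m E = 0 by rewrite mulmxBl mul1mx -mulmxA EE mulmx1 subrr.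
have PgE : P *m (g *m E) = 0.
  have : J *m (P *m (g *m E)) = 0.
    rewrite mulmxA JP -{1}PT -{1}gP trmx_mul PT.
    rewrite mulmxA -[P *m _ *m J]mulmxA -[P *m _ *m g]mulmxA Pg.
    by rewrite -JP -mulmxA PE mulmx0.
  by move/(congr1 (mulmx (- J))); rewrite mulmx0 mulmxA mulNmx J_mxK opprK mul1mx.
have EEgE : E *m (E^T *m (g *m E)) = g *m E.
  by move: PgE; rewrite mulmxBl mul1mx -mulmxA => /eqP; rewrite subr_eq0 => /eqP.
pose h := E^T *m (g *m E).
have gE : sp_mx g = 1%:M + E *m (h - 1%:M) *m E^T.
  rewrite mulmxBr mulmx1 mulmxBl EEgE addrCA -[1%:M - _]/P -{1}gP mulmxBr mulmx1.
  by rewrite mulmxA addrCA subrr addr0.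
have deth : \det h == 1.
  have : h^T *m j *m h = j.
    have -> : h^T = (g *m E)^T *m E by rewrite trmx_mul trmxK.
    rewrite -(mulmxA _ E j) -JE mulmxA -mulmxA EEgE trmx_mul.
    rewrite mulmxA -(mulmxA _ _ J) -(mulmxA E^T) Pg.
    by rewrite EtJ -mulmxA EE mulmx1.
  rewrite J_mx2 => /(congr1 (mulmx^~ (j : 'M_(1 + 1)))).
  rewrite -scalemxAl [j *m _](J_mxK C 1) => /matrixP/(_ 0 0).
  by rewrite !mxE eqxx mulr1n mulrN1 => /oppr_inj ->.
exists (MkSL2 deth); apply: val_inj; exact: gE.
Qed.

Section BranchingAlgebra.
Variables (C : fieldType) (n : nat).
Implicit Types (f : Sp C n -> C) (g t s : Sp C n).

Definition regular : set (Sp C n -> C) :=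
  [set f | exists P : {mpoly C[(n + n) * (n + n)]},
     forall g, f g = P.@[fun k => mxvec (sp_mx g) 0 k]].

Definition rtrans (h : Sp C n) f : Sp C n -> C := fun g => f (g * h)%g.

Definition branching_algebra : set (Sp C n -> C) :=
  [set f | regular f /\
     forall ubar u g, in_Ubar ubar -> in_U u -> in_Sp_pred u ->
       f (ubar * g * u)%g = f g].

(* A bidegree is a pair (mu, lambda) in N^(n-1) x N^n, stored as a single
   exponent vector: the sum of bidegrees is the sum of multinomials, and
   bidegrees index the monomials of a polynomial ring. *)
Definition bidegree : Type := 'X_{1..n.-1 + n}.
Implicit Types p : bidegree.

Definition mu p : seq nat := [seq p (lshift n i) | i <- enum 'I_n.-1].
Definition lam p : seq nat := [seq p (rshift n.-1 i) | i <- enum 'I_n].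

Definition dominant p : bool := sorted geq (mu p) && sorted geq (lam p).

Definition torus_char_lam p t : C :=
  \prod_(i < n) t (lshift n i) (lshift n i) ^+ nth 0%N (lam p) i.

Definition torus_char_mu p s : C :=
  \prod_(i < n | (i < n.-1)%N) s (lshift n i) (lshift n i) ^+ nth 0%N (mu p) i.

Definition W p : set (Sp C n -> C) :=
  [set f | branching_algebra f /\
     forall t s g, in_T t -> in_T s -> in_Sp_pred s ->
       f (t * g * s)%g = torus_char_lam p t * torus_char_mu p s * f g].

Definition Lambda_B : set bidegree :=
  [set p | dominant p /\ exists2 f, W p f & f <> (fun=> 0)].

Variant order_letter := ge_letter | le_letter.

Definition order_type : Type := n.-1.-tuple order_letter.

(* With 0-based indices, nth 0 (mu p) i is mu_(i+1), to be compared with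
   lambda_(i+2) = nth 0 (lam p) i.+1. *)
Definition of_order_type (sigma : order_type) p : Prop :=
  forall i : 'I_n.-1,
    match tnth sigma i with
    | ge_letter => (nth 0 (mu p) i >= nth 0 (lam p) i.+1)%N
    | le_letter => (nth 0 (mu p) i <= nth 0 (lam p) i.+1)%N
    end.

Definition Lambda_sigma (sigma : order_type) : set bidegree :=
  [set p | Lambda_B p /\ of_order_type sigma p].

(* The sum of the W p; it is direct, the W p being weight spaces for
   distinct characters. *)
Definition B_sigma (sigma : order_type) : set (Sp C n -> C) :=
  [set f | exists (ps : seq bidegree) (F : bidegree -> Sp C n -> C),
     (forall p, p \in ps -> Lambda_sigma sigma p /\ W p (F p)) /\
     f = \sum_(p <- ps) F p].

Definition rearrangement p : seq nat := sort geq (mu p ++ lam p ++ [:: 0%N]).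

(* x_(i+1) - y_(i+1) for the 0-based index i. *)
Definition r p (i : 'I_n) : nat :=
  (nth 0 (rearrangement p) i.*2 - nth 0 (rearrangement p) i.*2.+1)%N.

End BranchingAlgebra.

Section TensorAlgebra.
Variables (C : fieldType) (n : nat).
Implicit Types (h : SL2 C) (g : Lgrp C n) (p : bidegree n).

(* F^k is the set of k-homogeneous elements of C[x, y], with the SL_2-action
   (h . f)(v) = f(h^-1 v); sl2_coord h k is the k-th coordinate of h^-1 v. *)
Definition F (k : nat) : set {mpoly C[2]} := [set f | f \is k.-homog].

Definition sl2_coord h (k : 'I_2) : {mpoly C[2]} :=
  \sum_(l < 2) sl2_mx (h^-1)%g k l *: 'X_l.

Definition sl2_act h (f : {mpoly C[2]}) : {mpoly C[2]} :=
  f \mPo [tuple sl2_coord h k | k < 2].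

(* The n-th tensor power of C[x, y] is realized as the ring of polynomials in
   x_i = 'X_(lshift n i) and y_i = 'X_(rshift n i); a pure tensor
   u_1 (x) ... (x) u_n is the product of the u_i(x_i, y_i). *)
Definition place (i : 'I_n) (f : {mpoly C[2]}) : {mpoly C[n + n]} :=
  f \mPo [tuple 'X_(lshift n i); 'X_(rshift n i)].

Definition pure_tensor (u : 'I_n -> {mpoly C[2]}) : {mpoly C[n + n]} :=
  \prod_(i < n) place i (u i).

Definition A_comp p : set {mpoly C[n + n]} :=
  [set a | exists us : seq {ffun 'I_n -> {mpoly C[2]}},
     (forall u, u \in us -> forall i, F (r p i) (u i)) /\
     a = \sum_(u <- us) pure_tensor u].

Definition tensor_act g (a : {mpoly C[n + n]}) : {mpoly C[n + n]} :=
  a \mPo [tuple match fintype.split k with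
                | inl i => place i (sl2_coord (g i) 0)
                | inr i => place i (sl2_coord (g i) 1)
                end | k < n + n].

Lemma comp_mpoly_comp (k1 k2 k3 : nat) (f : {mpoly C[k1]})
    (v : k1.-tuple {mpoly C[k2]}) (w : k2.-tuple {mpoly C[k3]}) :
  (f \mPo v) \mPo w = f \mPo [tuple tnth v i \mPo w | i < k1].
Proof.
rewrite !(comp_mpolyEX f) raddf_sum /=.
apply: eq_bigr => m _; rewrite comp_mpolyZ; congr (_ *: _).
rewrite !comp_mpolyX rmorph_prod.
by apply: eq_bigr => i _; rewrite rmorphXn /= tnth_mktuple.
Qed.

Lemma tensor_act_pure g (u : 'I_n -> {mpoly C[2]}) :
  tensor_act g (pure_tensor u) = pure_tensor (fun i => sl2_act (g i) (u i)).
Proof.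
rewrite /tensor_act rmorph_prod /=; apply: eq_bigr => i _.
rewrite /place /sl2_act !comp_mpoly_comp; congr (comp_mpoly _ _).
apply: eq_from_tnth => k; rewrite !tnth_mktuple.
have /orP[/eqP->|/eqP->] : (k == 0) || (k == 1) by case: k => [[|[|]]].
  rewrite [tnth _ 0]/= /tnth /= comp_mpolyXU -tnth_nth tnth_mktuple.
  by rewrite -[lshift n i]/(unsplit (inl i)) unsplitK.
rewrite /tnth /= comp_mpolyXU -tnth_nth tnth_mktuple.
by rewrite -[rshift n i]/(unsplit (inr i)) unsplitK.
Qed.

(* The external direct sum of the A_comp p over all bidegrees p lies in the
   ring of polynomials in formal variables with exponents p and coefficients
   in the n-th tensor power of C[x, y]: the coefficient a@_p is the component
   of degree p, and the product is graded and multiplies the coefficients. *)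
Definition graded_ring : Type := {mpoly {mpoly C[n + n]}[n.-1 + n]}.

Definition A_graded_comp p : set graded_ring :=
  [set a *: 'X_[p] | a in A_comp p].

Definition A_sigma (sigma : order_type n) : set graded_ring :=
  [set a | forall p : bidegree n, p \in msupp a ->
     Lambda_sigma C sigma p /\ A_comp p a@_p].

Definition theta g (a : graded_ring) : graded_ring := map_mpoly (tensor_act g) a.

End TensorAlgebra.

Section Isomorphisms.
Variables (C : fieldType) (n : nat) (sigma : order_type n).
Implicit Types phi : (Sp C n -> C) -> graded_ring C n.

(* Only the restriction of phi to B_sigma is meaningful. *)
Record graded_SL2_iso phi : Prop := {
  iso_bij : set_bij (B_sigma sigma) (A_sigma sigma) phi;
  iso_linear : forall (c : C) (f f' : Sp C n -> C),
    B_sigma sigma f -> B_sigma sigma f' ->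
    phi (fun g => c * f g + f' g) = c%:MP *: phi f + phi f';
  iso_one : phi 1 = 1;
  iso_mul : forall f f' : Sp C n -> C,
    B_sigma sigma f -> B_sigma sigma f' -> phi (f * f') = phi f * phi f';
  iso_equivariant : forall (h : SL2 C) (f : Sp C n -> C),
    B_sigma sigma f ->
    phi (rtrans (sl2_emb n h) f) = theta (L_diag n h) (phi f);
  iso_graded : forall p : bidegree n, Lambda_sigma C sigma p ->
    phi @` W p = A_graded_comp p
}.

Definition Phi phi (g : Lgrp C n) (f : Sp C n -> C) : Sp C n -> C :=
  'pinv_(fun=> 0) (B_sigma sigma) phi (theta g (phi f)).

End Isomorphisms.

Record is_representation (C : fieldType) (G : groupType) (T : Type)
    (V : set (T -> C)) (rho : G -> (T -> C) -> (T -> C)) : Prop := {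
  rep_stable : forall g f, V f -> V (rho g f);
  rep_linear : forall g (c : C) (f f' : T -> C), V f -> V f' ->
    rho g (fun x => c * f x + f' x) = (fun x => c * rho g f x + rho g f' x);
  rep_one : forall f, V f -> rho 1%g f = f;
  rep_mul : forall g g' f, V f -> rho (g * g')%g f = rho g (rho g' f)
}.

(* Main.v *)
From mathcomp Require Import all_boot all_order all_algebra.
From mathcomp Require Import boolp classical_sets functions reals.
From mathcomp.real_closed Require Import complex.
From mathcomp Require Import mpoly ring zify.
Require Import Defs.

(** The algebra attached to an order type is a polynomial ring, and so is its
    tensor model; the two rings are matched generator by generator.

    Write n = m + 1 and count from 0. Four families of minors of the top rows
    are invariant under the two unipotent groups: u_k and v_k (k < n) use the
    columns of e_1, ..., e_k together with that of e_n, respectively e_(-n);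
    Delta_i (i < m) uses those of e_1, ..., e_(i+1); Gamma_i uses those of
    e_1, ..., e_i, e_n, e_(-n). They are weight vectors. SL_2 fixes Delta_i and
    Gamma_i and turns the span of u_k and v_k into its standard representation.
    They satisfy the Pluecker relations
      u_i v_(i+1) = u_(i+1) v_i + (-1)^(i+1) Delta_i Gamma_i.
    For an order type sigma let z_i be Delta_i or Gamma_i according to the i-th
    letter, and let P be the polynomial ring in all U_k, V_k, Z_i.

    Evaluation of P on the group is injective ([ev_inj]): the coordinates of a
    point can be solved for prescribed values of u_k, v_k, z_i with all u_k and z_i
    nonzero, the relations giving the other half of the Delta_i, Gamma_i
    ([realize_u]).

    Evaluation reaches every weight vector of order type sigma ([W_inEv]). On
    the dense open set where the u_k do not vanish a matrix is, modulo the two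
    unipotent groups, the product of a torus element and a point of an explicit
    affine section ([chart_decomposition]), whose coordinates are quotients of
    the four families of minors by the u_k. Hence f times a power of the product
    of the u_k is a polynomial in the minors ([W_localized]). In a monomial of
    weight (mu, lambda) the exponents of Delta_i and Gamma_i differ by
    mu_i - lambda_(i+1), whose sign is the i-th letter; so their product may be
    eliminated by the Pluecker relation and only z_i survives ([mono_inEv]).
    The denominators are removed one factor at a time: a polynomial whose value
    is divisible by u_k vanishes at U_k = 0, since SL_2 carries the description
    of the points with u_k nonzero to the points with v_k nonzero, where u_k
    may vanish ([ev_div]). Density is used throughout in this form: a regular
    function that vanishes wherever some minor does not is zero, because the rank
    of a submatrix can be raised by transvections ([density_minor]).

    The tensor model is the same ring. Reading off mu, lambda and 0 in
    decreasing order shows that r_i of the weight of a monomial is the sum of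
    the exponents of U_i and V_i ([r_degm]); so sending V_i and U_i to x_i and
    - y_i, Z_i to 1, and recording the weight, identifies the part of P of
    weight p with the tensor product of the F^(r_i) ([tensor_val_part_eq0],
    [A_lift]), compatibly with SL_2.

    An isomorphism is unique up to scalars because it is multiplicative and, by
    Schur's lemma in the degrees of u_i and of z_j, scalar on the generators
    ([phi_uv], [phi_z]). The scalar of a monomial depends on its weight alone,
    because the weight determines the exponents of the Z_j and the sums of the
    exponents of U_i and V_i ([phi_scalar]). The action of L on the model
    preserves the graded pieces, so these scalars cancel in the transferred
    action, which is therefore canonical ([Phi_canonical_W]). *)

Set Implicit Arguments.
Unset Strict Implicit.
Unset Printing Implicit Defensive.

Import Order.TTheory GRing.Theory Num.Theory.
Local Open Scope ring_scope.
Local Open Scope classical_set_scope.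

(** * Independence of weights and regular functions *)

Section Weights.
Variable C : numFieldType.

Lemma expr2_inj (a b : nat) : 2%:R ^+ a = 2%:R ^+ b :> C -> a = b.
Proof.
by move/eqP; rewrite -!natrX eqr_nat => /eqP; apply: expnI.
Qed.

(** The twist by [T i] multiplies the term of index [p] by 2 to the power [p i];
    a combination of the relation and its twist kills one term, as in the proof
    of the independence of characters. *)
Lemma weight_indep (k : nat) (X : Type) (T : 'I_k -> X -> X)
    (ps : seq 'X_{1..k}) (F : 'X_{1..k} -> X -> C) :
  uniq ps ->
  (forall p, p \in ps -> forall i x, F p (T i x) = 2%:R ^+ p i * F p x) ->
  (forall x, \sum_(p <- ps) F p x = 0) ->
  forall p, p \in ps -> forall x, F p x = 0.
Proof.
elim: ps F => [//|q ps IH] F /= /andP[qps ups] HT HS.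
have Fps p : p \in ps -> forall x, F p x = 0.
  move=> pps.
  have /existsP[i ipq] : [exists i, p i != q i].
    apply/existsPn => H; move: qps; suff <- : p = q by rewrite pps.
    by apply/mnmP => i; apply/eqP; have := H i; rewrite negbK.
  (* the twisted relation minus a multiple of the relation: the term of [q] drops out *)
  pose F' (r : 'X_{1..k}) x : C := (2%:R ^+ r i - 2%:R ^+ q i) * F r x.
  have F'0 : forall x, F' p x = 0.
    apply: (IH F') => // [r rps j x | x].
      by rewrite /F' HT ?inE ?rps ?orbT // mulrCA.
    have := HS (T i x); rewrite big_cons HT ?mem_head // => E1.
    have := HS x; rewrite big_cons => /(congr1 ( *%R (2%:R ^+ q i))).
    rewrite mulr0 mulrDr -[RHS]E1 => /addrI E2.
    apply/eqP; rewrite (eq_bigr (fun r : 'X_{1..k} =>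
      2%:R ^+ r i * F r x - 2%:R ^+ q i * F r x)); last first.
      by move=> r _; rewrite /F' mulrBl.
    rewrite sumrB -mulr_sumr E2 subr_eq0; apply/eqP.
    rewrite [LHS]big_seq [RHS]big_seq; apply: eq_bigr => r rps.
    by rewrite HT ?inE ?rps ?orbT.
  move=> x; have /eqP := F'0 x; rewrite /F' mulf_eq0 subr_eq0 => /orP[|/eqP//].
  by move=> /eqP/expr2_inj/eqP; rewrite (negPf ipq).
move=> p; rewrite inE => /orP[/eqP->|/Fps//] x.
have := HS x; rewrite big_cons big_seq big1 ?addr0 //.
by move=> r /Fps ->.
Qed.

(** The monomials are weight vectors for the scalings of one variable by 2, so
    the coefficients are separated by independence of weights. *)
Lemma meval_eq0 (k : nat) (P : {mpoly C[k]}) :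
  (forall v, P.@[v] = 0) -> P = 0.
Proof.
move=> P0; apply/mpolyP => q; rewrite mcoeff0.
have [qP|/memN_msupp_eq0//] := boolP (q \in msupp P).
pose F (p : 'X_{1..k}) (v : 'I_k -> C) : C := P@_p * \prod_i v i ^+ p i.
pose T (i : 'I_k) (v : 'I_k -> C) := fun j => if j == i then 2%:R * v j else v j.
have := @weight_indep k _ T (msupp P) F (msupp_uniq P) _ _ q qP (fun=> 1).
rewrite /F big1 ?mulr1; last by move=> i _; rewrite expr1n.
apply.
  move=> p _ i v; rewrite mulrCA; congr (_ * _).
  rewrite (bigD1 i) //= [in RHS](bigD1 i) //= /T eqxx exprMn -mulrA.
  by congr (_ * (_ * _)); apply: eq_bigr => j /negPf ->.
by move=> v; rewrite -mevalE.
Qed.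

(** The open set where [D] does not vanish is dense since there are no zero
    divisors. *)
Lemma meval_eq0_on (k : nat) (P D : {mpoly C[k]}) : D != 0 ->
  (forall v, D.@[v] != 0 -> P.@[v] = 0) -> P = 0.
Proof.
move=> D0 PD; have /eqP : P * D = 0.
  apply: meval_eq0 => v; rewrite mevalM.
  by have [->|/PD ->] := eqVneq D.@[v] 0; rewrite ?mulr0 ?mul0r.
by rewrite mulf_eq0 (negPf D0) orbF => /eqP.
Qed.

End Weights.

Section Regular.
Variables (C : numFieldType) (n : nat).
Implicit Types f : Sp C n -> C.

(** Regular functions along a family [gam] of points inherit any property that
    is closed under sums and products and holds for the matrix entries; the
    properties used are polynomiality in a parameter and membership in a
    localized ring. *)
Lemma regular_ind (X : Type) (gam : X -> Sp C n) (K : (X -> C) -> Prop) f :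
  (forall c, K (fun=> c)) ->
  (forall a b, K a -> K b -> K (fun x => a x + b x)) ->
  (forall a b, K a -> K b -> K (fun x => a x * b x)) ->
  (forall i j, K (fun x => sp_mx (gam x) i j)) ->
  regular f -> K (fun x => f (gam x)).
Proof.
move=> Kc KD KM Ke [P fP].
have -> : (fun x => f (gam x)) = fun x => P.@[fun k => mxvec (sp_mx (gam x)) 0 k].
  by apply: funext => x; rewrite fP.
have KX (k : 'I_((n + n) * (n + n))) (e : nat) :
    K (fun x => mxvec (sp_mx (gam x)) 0 k ^+ e).
  elim: e => [|e IH].
    by under [X in K X]funext do rewrite expr0; apply: Kc.
  under [X in K X]funext do rewrite exprS.
  apply: KM => //; case: (mxvec_indexP k) => i j.
  by under [X in K X]funext do rewrite mxvecE.
elim/mpolyind: P {fP} => [|c m P _ _ IH].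
  by under [X in K X]funext do rewrite meval0; apply: Kc.
under [X in K X]funext do rewrite mevalD mevalZ mevalX.
apply: (KD) => //; apply: (KM) => //.
elim: (index_enum _) => [|i s IHs].
  by under [X in K X]funext do rewrite big_nil; apply: Kc.
by under [X in K X]funext do rewrite big_cons; apply: KM.
Qed.

Lemma regular_cst (c : C) : regular (fun _ : Sp C n => c).
Proof. by exists c%:MP => g; rewrite mevalC. Qed.

Lemma regularD f f' : regular f -> regular f' -> regular (fun g => f g + f' g).
Proof. by move=> [P fP] [Q fQ]; exists (P + Q) => g; rewrite mevalD fP fQ. Qed.

Lemma regularM f f' : regular f -> regular f' -> regular (fun g => f g * f' g).
Proof. by move=> [P fP] [Q fQ]; exists (P * Q) => g; rewrite mevalM fP fQ. Qed.

Lemma regular_entry i j : regular (fun g : Sp C n => sp_mx g i j).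
Proof. by exists 'X_(mxvec_index i j) => g; rewrite mevalXU mxvecE. Qed.

Lemma regular_sum (I : Type) (s : seq I) (F : I -> Sp C n -> C) :
  (forall i, regular (F i)) -> regular (fun g => \sum_(i <- s) F i g).
Proof.
move=> HF; elim: s => [|i s IH].
  by under [X in regular X]funext do rewrite big_nil; apply: regular_cst.
by under [X in regular X]funext do rewrite big_cons; apply: regularD.
Qed.

Lemma regular_prod (I : Type) (s : seq I) (F : I -> Sp C n -> C) :
  (forall i, regular (F i)) -> regular (fun g => \prod_(i <- s) F i g).
Proof.
move=> HF; elim: s => [|i s IH].
  by under [X in regular X]funext do rewrite big_nil; apply: regular_cst.
by under [X in regular X]funext do rewrite big_cons; apply: regularM.
Qed.

Lemma regularX f e : regular f -> regular (fun g => f g ^+ e).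
Proof.
move=> fr; elim: e => [|e IH].
  by under [X in regular X]funext do rewrite expr0; apply: regular_cst.
by under [X in regular X]funext do rewrite exprS; apply: regularM.
Qed.

Lemma regular_det k (M : 'I_k -> 'I_k -> Sp C n -> C) :
  (forall i j, regular (M i j)) ->
  regular (fun g => \det (\matrix_(i, j) M i j g)).
Proof.
move=> HM; rewrite /determinant; apply: regular_sum => s.
apply: regularM; first exact: regular_cst.
apply: regular_prod => i.
by under [X in regular X]funext do rewrite mxE.
Qed.

Lemma regular_rtrans h f : regular f -> regular (rtrans h f).
Proof.
move=> fr; apply: (@regular_ind _ (fun g => (g * h)%g) (fun F => @regular C n F) f) => //;
  [exact: regular_cst | exact: regularD | exact: regularM | move=> i j].
under [X in regular X]funext do rewrite /= mxE.
apply: regular_sum => k; apply: regularM; first exact: regular_entry.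
exact: regular_cst.
Qed.

End Regular.

(** * Density of the nonvanishing locus of a minor *)

Section Density.
Variable C : numFieldType.

(** The kernel of the sum lies in that of [A], and [l] shows that the inclusion
    is strict. *)
Lemma rank_rank1_update (k : nat) (A : 'M[C]_k) (a : 'cV_k) (b : 'rV_k)
    (l : 'rV_k) (r : 'cV_k) :
  l *m A = 0 -> l *m a != 0 -> A *m r = 0 -> b *m r != 0 ->
  (\rank A < \rank (A + a *m b)%R)%N.
Proof.
move=> lA la Ar br.
have kA (x : 'rV_k) : x *m (A + a *m b) = 0 -> x *m A = 0 /\ x *m a = 0.
  move=> xE; have : x *m (A + a *m b) *m r = 0 by rewrite xE mul0mx.
  rewrite mulmxDr mulmxDl -mulmxA Ar mulmx0 add0r !mulmxA -mulmxA => /eqP xabr.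
  have xa : x *m a = 0.
    move: xabr br; rewrite (mx11_scalar (x *m a)) (mx11_scalar (b *m r)).
    rewrite -scalar_mxM => /eqP/matrixP/(_ 0 0); rewrite !mxE eqxx !mulr1n => /eqP.
    rewrite mulf_eq0 => /orP[/eqP->|/eqP->]; first by rewrite raddf0.
    by rewrite raddf0 eqxx.
  by split=> //; move: xE; rewrite mulmxDr mulmxA xa mul0mx addr0.
have lt_ker : (kermx (A + a *m b) < kermx A)%MS.
  rewrite ltmxE; apply/andP; split.
    by apply/rV_subP => x /sub_kermxP/kA[xA _]; apply/sub_kermxP.
  apply/negP => /rV_subP/(_ l); rewrite (introT sub_kermxP lA) => /(_ isT).
  by move=> /sub_kermxP/kA[_]; apply/eqP.
have := rank_ltmx lt_ker; rewrite !mxrank_ker.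
have := rank_leq_row A; have := rank_leq_row (A + a *m b). lia.
Qed.

(** Two proper subspaces do not cover a space: a basis vector or a sum of two
    of them avoids both hyperplanes. *)
Lemma common_nonvanishing (N : nat) (p : 'rV[C]_N) (q : 'cV[C]_N) :
  p != 0 -> q != 0 -> exists v : 'cV_N, p *m v != 0 /\ v^T *m q != 0.
Proof.
move=> /rV0Pn[i pi] /cV0Pn[j qj].
have pd k : p *m (delta_mx k 0 : 'cV_N) = (p 0 k)%:M.
  by rewrite -colE; apply/matrixP => x y; rewrite !mxE !ord1 eqxx mulr1n.
have qd k : (delta_mx k 0 : 'cV_N)^T *m q = (q k 0)%:M.
  by rewrite trmx_delta -rowE; apply/matrixP => x y; rewrite !mxE !ord1 eqxx mulr1n.
have s0 (c : C) : (c%:M == 0 :> 'M_1) = (c == 0).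
  apply/eqP/eqP => [/matrixP/(_ 0 0)|->]; last by rewrite raddf0.
  by rewrite !mxE eqxx mulr1n.
have [qi|qi] := boolP (q i 0 == 0); last first.
  by exists (delta_mx i 0); rewrite pd qd !s0.
have [pj|pj] := boolP (p 0 j == 0); last first.
  by exists (delta_mx j 0); rewrite pd qd !s0.
exists (delta_mx i 0 + delta_mx j 0).
rewrite mulmxDr !pd raddfD /= mulmxDl !qd -!raddfD /= !s0.
by rewrite (eqP qi) (eqP pj) addr0 add0r.
Qed.

Lemma poly_eq0_on (p : {poly C}) : (forall t, t != 0 -> p.[t] = 0) -> p = 0.
Proof.
move=> p0; apply/eqP/negPn/negP => np.
have := max_poly_roots (rs := [seq i.+1%:R | i <- iota 0 (size p)]) np.
rewrite size_map size_iota ltnn => H; suff : false by [].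
apply: H.
  apply/allP => _ /mapP[i _ ->]; apply/eqP/p0; by rewrite pnatr_eq0.
by rewrite map_inj_uniq ?iota_uniq // => i j /eqP; rewrite eqr_nat => /eqP[].
Qed.

Variable n : nat.

Definition transvection_mx (v : 'cV[C]_(n + n)) (t : C) : 'M[C]_(n + n) :=
  1%:M + t *: (J_mx C n *m v *m v^T).

Lemma J_form0 (v : 'cV[C]_(n + n)) : v^T *m J_mx C n *m v = 0.
Proof.
have H : (v^T *m J_mx C n *m v)^T = - (v^T *m J_mx C n *m v).
  by rewrite !trmx_mul trmxK J_tr mulNmx mulmxN mulmxA.
apply/matrixP => i j; rewrite !ord1 [RHS]mxE.
have /matrixP/(_ 0 0) := H; rewrite [LHS]mxE [RHS]mxE => /eqP.
by rewrite -subr_eq0 opprK -mulr2n mulrn_eq0 /= => /eqP.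
Qed.

Lemma transvection_symp v t : is_symplectic (transvection_mx v t).
Proof.
apply/eqP; rewrite /transvection_mx.
have -> : (1%:M + t *: (J_mx C n *m v *m v^T))^T =
    1%:M + t *: (v *m (v^T *m - J_mx C n)).
  by rewrite raddfD /= trmx1 linearZ /= !trmx_mul trmxK J_tr.
rewrite mulmxDl mul1mx -scalemxAl !mulmxDr !mulmx1 -!scalemxAr mulmxDl.
rewrite -scalemxAl.
have -> : v *m (v^T *m - J_mx C n) *m J_mx C n = v *m v^T.
  by rewrite mulmxN mulmxN mulNmx -!mulmxA J_mxK !mulmxN opprK mulmx1.
have -> : J_mx C n *m (J_mx C n *m v *m v^T) = - (v *m v^T).
  by rewrite !mulmxA J_mxK !mulNmx mul1mx.
have -> : v *m v^T *m (J_mx C n *m v *m v^T) = 0.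
  by rewrite -!mulmxA (mulmxA v^T) (mulmxA (v^T *m _)) J_form0 mul0mx mulmx0.
by rewrite scaler0 addr0 scalerN addrK.
Qed.

Definition transvection v t : Sp C n := MkSp (transvection_symp v t).

Lemma transvection0 v : transvection v 0 = 1%g.
Proof. by apply: val_inj; rewrite /= /transvection_mx scale0r addr0. Qed.

Lemma transvection_poly (f : Sp C n -> C) (g : Sp C n) v : regular f ->
  exists p : {poly C}, forall t, p.[t] = f (g * transvection v t)%g.
Proof.
move=> fr.
apply: (@regular_ind C n _ (fun t => (g * transvection v t)%g)
  (fun F => exists p : {poly C}, forall t, p.[t] = F t) f) => //.
- by move=> c; exists c%:P => t; rewrite hornerC.
- by move=> a b [p Hp] [q Hq]; exists (p + q) => t; rewrite hornerD Hp Hq.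
- by move=> a b [p Hp] [q Hq]; exists (p * q) => t; rewrite hornerM Hp Hq.
move=> i j; rewrite /= /transvection_mx.
exists ((sp_mx g i j)%:P + 'X * ((sp_mx g *m (J_mx C n *m v *m v^T)) i j)%:P) => t.
by rewrite mulmxDr mulmx1 -scalemxAr !mxE !hornerE.
Qed.

(** Right multiplication by a transvection changes the submatrix by a matrix
    of rank one; for a suitable transvection the rank goes up for every nonzero
    parameter [t]. A polynomial in [t] that vanishes there vanishes at 0, so the
    vanishing of [f] propagates down the rank. *)
Lemma density_minor (k : nat) (r c : 'I_k -> 'I_(n + n)) (f : Sp C n -> C) :
  injective r -> injective c -> regular f ->
  (forall g : Sp C n, \det (mxsub r c (sp_mx g)) != 0 -> f g = 0) ->
  forall g, f g = 0.
Proof.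
move=> ri ci fr f0.
suff H d g : (k <= d + \rank (mxsub r c (sp_mx g)))%N -> f g = 0.
  by move=> g; apply: (H k); rewrite leq_addr.
(* induction on the corank [d] of the submatrix *)
elim: d g => [|d IH] g kd.
  apply: f0; rewrite -unitfE -unitmxE -row_full_unit /row_full.
  by rewrite eqn_leq rank_leq_col.
set A := mxsub r c (sp_mx g) in kd.
have [rk|nrk] := boolP (row_full A).
  by apply: f0; rewrite -unitfE -unitmxE -row_full_unit.
have lA : exists2 l : 'rV_k, l *m A = 0 & l != 0.
  have : kermx A != 0 by rewrite kermx_eq0 row_free_unit -row_full_unit.
  by move=> /rowV0Pn[l /sub_kermxP lA l0]; exists l.
have rA : exists2 x : 'cV_k, A *m x = 0 & x != 0.
  have : kermx A^T != 0.
    by rewrite kermx_eq0 row_free_unit unitmx_tr -row_full_unit.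
  move=> /rowV0Pn[l /sub_kermxP lAt l0]; exists l^T.
    by apply: trmx_inj; rewrite trmx_mul trmxK lAt trmx0.
  by apply: contraNneq l0 => /(congr1 trmx); rewrite trmxK trmx0 => ->.
have [l lA0 l0] := lA; have [x Ax0 x0] := rA.
have rowE : rowsub r (sp_mx g) = rowsub r 1%:M *m sp_mx g := rowsubE _ _.
have lS : l *m rowsub r (sp_mx g) *m J_mx C n != 0.
  apply: contra_neq l0 => E0.
  have : l *m rowsub r (sp_mx g) = 0.
    have := congr1 (mulmx^~ (- J_mx C n)) E0.
    by rewrite -mulmxA mulmxN J_mxK opprK mulmx1 mul0mx.
  rewrite rowE mulmxA => /(congr1 (mulmx^~ (invmx (sp_mx g)))).
  rewrite mulmxK ?sp_unitmx // mul0mx => lr.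
  apply/rowP => i; have /rowP/(_ (r i)) := lr; rewrite !mxE (bigD1 i) //= !mxE eqxx.
  rewrite mulr1 big1 ?addr0 // => j ji; rewrite !mxE (inj_eq ri).
  by rewrite (negPf ji) mulr0.
have Ex : colsub c (1%:M : 'M_(n + n)) *m x != 0.
  apply: contra_neq x0 => E0; apply/colP => i; have /colP/(_ (c i)) := E0.
  rewrite !mxE (bigD1 i) //= !mxE eqxx mul1r big1 ?addr0 // => j ji.
  by rewrite !mxE (inj_eq ci) eq_sym (negPf ji) mul0r.
(* [v] is chosen so that the rank one update meets both kernels of [A] *)
have [v [vl vx]] := common_nonvanishing lS Ex.
have [p pE] := transvection_poly g v fr.
suff p0 : p = 0 by have := pE 0; rewrite transvection0 mulg1 p0 horner0.
apply: poly_eq0_on => t t0; rewrite pE; apply: IH.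
set a := t *: (rowsub r (sp_mx g) *m J_mx C n *m v).
have -> : mxsub r c (sp_mx (g * transvection v t)%g) = A + a *m (v^T *m colsub c 1%:M).
  have E0 : mxsub r c (sp_mx g *m (J_mx C n *m v *m v^T)) =
      rowsub r (sp_mx g) *m J_mx C n *m v *m (v^T *m colsub c 1%:M).
    by rewrite mulmx_colsub mulmx1 !mulmxA mxsub_mul !mul_rowsub_mx.
  rewrite /= /transvection_mx mulmxDr mulmx1 -scalemxAr /a -scalemxAl -E0.
  by apply/matrixP => i j; rewrite !mxE.
have lt_rk : (\rank A < \rank (A + a *m (v^T *m colsub c 1%:M))%R)%N.
  apply: (@rank_rank1_update _ A a _ l x) => //.
    by rewrite /a -scalemxAr !mulmxA scaler_eq0 (negPf t0).
  by rewrite -mulmxA.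
by move: kd lt_rk; lia.
Qed.

End Density.

(** * Symplectic matrices and triangular factorization *)

Section Symplectic.
Variables (C : numFieldType) (n : nat).
Implicit Types (g x b : Sp C n) (i j k : 'I_(n + n)).

Definition J_sign (i : nat) : C := if (i < n)%N then 1 else -1.

Lemma J_mxE i j : J_mx C n i j = (i == rev_ord j)%:R * J_sign i.
Proof.
rewrite /J_mx /J_sign !mxE; case: splitP => i' ei; rewrite mxE;
  case: splitP => j' ej; rewrite !mxE.
- rewrite -val_eqE /= ei ej; case: eqP => [E|_]; last by rewrite mul0r.
  by have := ltn_ord i'; have := ltn_ord j'; move: E; lia.
- rewrite -!val_eqE /= ei ej mulr1; congr (_%:R); congr nat_of_bool.
  by apply/eqP/eqP; lia.
- rewrite -!val_eqE /= ei ej mulrN1; congr (- (_ *+ _)).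
  by congr nat_of_bool; have := (ltn_ord i', ltn_ord j') => -[? ?]; apply/eqP/eqP; lia.
- rewrite -val_eqE /= ei ej; case: eqP => [E|_]; last by rewrite mul0r.
  by have := ltn_ord i'; have := ltn_ord j'; move: E; lia.
Qed.

Lemma symp_formE (A : 'M[C]_(n + n)) i j :
  (A^T *m J_mx C n *m A) i j = \sum_(k < n + n) J_sign k * A k i * A (rev_ord k) j.
Proof.
rewrite -mulmxA mxE; apply: eq_bigr => k _; rewrite !mxE (bigD1 (rev_ord k)) //=.
rewrite J_mxE rev_ordK eqxx mul1r big1 ?addr0.
  by rewrite mulrA [A k i * _]mulrC.
move=> l lk; rewrite J_mxE -(inj_eq rev_ord_inj) rev_ordK eq_sym.
by rewrite (negPf lk) !mul0r.
Qed.

Lemma sympP (A : 'M[C]_(n + n)) :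
  reflect (forall i j, \sum_(k < n + n) J_sign k * A k i * A (rev_ord k) j = J_mx C n i j)
    (is_symplectic A).
Proof.
apply: (iffP eqP) => [E i j|H]; first by rewrite -symp_formE E.
by apply/matrixP => i j; rewrite symp_formE.
Qed.

Lemma symp_rows g : sp_mx g *m J_mx C n *m (sp_mx g)^T = J_mx C n.
Proof.
have := mulmx1C (sp_linv g); rewrite mulmxN -[1%:M]opprK => /oppr_inj.
rewrite !mulmxA => E; rewrite -[LHS]mulmx1 -[1%:M]opprK -(J_mxK C n) mulmxN.
by rewrite mulmxA E mulNmx mul1mx opprK.
Qed.

Lemma symp_tr g : is_symplectic (sp_mx g)^T.
Proof. by apply/eqP; rewrite trmxK symp_rows. Qed.

Definition sp_tr g : Sp C n := MkSp (symp_tr g).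

Lemma lt_half (i : 'I_(n + n)) : (i < n)%N = ~~ (rev_ord i < n)%N.
Proof. by rewrite /=; have := ltn_ord i; lia. Qed.

(** If the first [n] columns are upper triangular, the symplectic relations
    between a column [i < n] and a column [j] solve for the entries of the last
    [n] rows, by forward substitution along the antidiagonal. *)
Lemma symp_upper b :
  (forall i j, (j < i)%N -> (j < n)%N -> b i j = 0) ->
  (forall i, (i < n)%N -> b i i != 0) ->
  forall i j, (j < i)%N -> b i j = 0.
Proof.
move=> b0 bd; suff H (d : nat) i j : (i <= d)%N -> (i < n)%N ->
    (j < rev_ord i)%N -> b (rev_ord i) j = 0.
  move=> i j ji; have [jn|nj] := ltnP j n; first exact: b0.
  rewrite -(rev_ordK i); apply: (H (rev_ord i)) => //; last by rewrite rev_ordK.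
  by have := ltn_ord i; rewrite /=; lia.
elim: d i j => [|d IH] i j id iN ji.
all: have /sympP/(_ i j) := sp_mxP b; rewrite (bigD1 i) //= big1 ?addr0.
all: try (rewrite J_mxE /J_sign iN mul1r -(inj_eq rev_ord_inj) rev_ordK;
  rewrite (_ : (rev_ord i == j) = false) ?mul0r;
    [by move/eqP; rewrite mulf_eq0 (negPf (bd _ iN)) /= => /eqP
    |by apply/eqP => E; move: ji; rewrite E ltnn]).
all: move=> k ki.
- have ik : (i < k)%N by rewrite -val_eqE /= in ki; move: id ki; lia.
  by rewrite b0 // mulr0 mul0r.
- have [ik|] := ltnP i k; first by rewrite b0 // mulr0 mul0r.
  rewrite leq_eqVlt val_eqE (negPf ki) /= => kilt.
  rewrite (IH k j) ?mulr0 //; first by move: kilt id; lia.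
    by move: kilt iN; lia.
  by move: kilt ji; rewrite /=; have := ltn_ord i; lia.
Qed.

Lemma symp_upper_diag b : (forall i j, (j < i)%N -> b i j = 0) ->
  forall i, b i i * b (rev_ord i) (rev_ord i) = 1.
Proof.
move=> b0; suff H i : (i < n)%N -> b i i * b (rev_ord i) (rev_ord i) = 1.
  move=> i; have [/H//|] := ltnP i n; rewrite leqNgt lt_half negbK => /H.
  by rewrite rev_ordK mulrC.
move=> iN; have /sympP/(_ i (rev_ord i)) := sp_mxP b.
rewrite (bigD1 i) //= big1 ?addr0.
  by rewrite J_mxE rev_ordK eqxx /J_sign iN !mul1r.
move=> k ki; have [ik|] := ltnP i k; first by rewrite b0 // mulr0 mul0r.
rewrite leq_eqVlt val_eqE (negPf ki) /= => kilt.
by rewrite (b0 (rev_ord k)) ?mulr0 //=; have := ltn_ord i; move: kilt; lia.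
Qed.

Lemma diag_symp (d : 'rV[C]_(n + n)) :
  (forall i, d 0 i * d 0 (rev_ord i) = 1) -> is_symplectic (diag_mx d).
Proof.
move=> dd; apply/sympP => i j; rewrite (bigD1 i) //= big1 ?addr0 => [|k ki].
  rewrite J_mxE -(inj_eq rev_ord_inj) rev_ordK !mxE eqxx mulr1n.
  case: eqP => _; last by rewrite mulr0n mulr0 mul0r.
  by rewrite mulr1n mul1r -mulrA dd mulr1.
by rewrite !mxE (negPf ki) mulr0n mulr0 mul0r.
Qed.

Lemma upper_factor b : (forall i j, (j < i)%N -> b i j = 0) ->
  exists t x : Sp C n, [/\ in_T t, in_U x, b = (t * x)%g &
    forall i, t i i = b i i].
Proof.
move=> b0; have bd := symp_upper_diag b0.
have ds : is_symplectic (diag_mx (\row_i b i i)).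
  by apply: diag_symp => i; rewrite !mxE.
pose t : Sp C n := MkSp ds.
have bE : b = (t * (t^-1 * b))%g by rewrite mulVKg.
have bi i : b i i != 0.
  by apply/eqP => E; move: (bd i) => /eqP; rewrite E mul0r eq_sym oner_eq0.
have xE i j : b i j = b i i * (t^-1 * b)%g i j.
  have /(congr1 (@sp_mx C n)) := bE.
  by rewrite /= => /matrixP/(_ i j); rewrite mul_diag_mx !mxE.
exists t, (t^-1 * b)%g; split => //.
- by rewrite /in_T /=; apply: diag_mx_is_diag.
- split=> [i|i j ji].
    by have /eqP := xE i i; rewrite -{1}[b i i]mulr1 => /eqP/(mulfI (bi i)).
  by have /eqP := xE i j; rewrite (b0 _ _ ji) eq_sym mulf_eq0 (negPf (bi i)) => /eqP.
- by move=> i; rewrite !mxE eqxx mulr1n.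
Qed.

End Symplectic.

Section LU.
Variables (C : numFieldType) (n : nat).
Implicit Types (g x b : Sp C n) (i j k : 'I_(n + n)).

(** Each row of the lower unitriangular factor solves a linear system whose
    matrix is a leading block of [A]. *)
Lemma lower_elimination (A : 'M[C]_n) :
  (forall (k : nat) (kn : (k <= n)%N),
     \det (mxsub (widen_ord kn) (widen_ord kn) A) != 0) ->
  exists L : 'M[C]_n, [/\ forall i : 'I_n, L i i = 1,
    forall i j : 'I_n, (i < j)%N -> L i j = 0 &
    forall i j : 'I_n, (j < i)%N -> (L *m A) i j = 0].
Proof.
move=> Adet.
have row_ex (i : 'I_n) : exists l : {ffun 'I_n -> C}, [/\ l i = 1,
    forall j : 'I_n, (i < j)%N -> l j = 0 &
    forall j : 'I_n, (j < i)%N -> \sum_k l k * A k j = 0].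
  have iN : (i <= n)%N by apply: ltnW.
  set w := widen_ord iN; set B := mxsub w w A.
  have Bu : B \in unitmx by rewrite unitmxE unitfE; apply: Adet.
  pose y := - (\row_(j < i) A i (w j)) *m invmx B.
  exists [ffun j : 'I_n =>
    (if insub (val j) is Some j' then y 0 j' else (j == i)%:R : C)].
  split.
  - by rewrite ffunE insubN ?ltnn ?eqxx.
  - move=> j ij; rewrite ffunE insubN -?leqNgt ?(ltnW ij) //.
    by rewrite -val_eqE gtn_eqF.
  move=> j ji; rewrite (bigID (fun k : 'I_n => k < i)%N) /=.
  rewrite (big_ord_narrow iN) /= (bigD1 i) ?ltnn //= ffunE insubN ?ltnn //= eqxx mul1r.
  rewrite [X in _ + (_ + X)]big1 ?addr0 => [|k /andP[ki kni]]; last first.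
    by rewrite ffunE insubN // (negPf kni) mul0r.
  pose j' := Ordinal ji.
  have yB : (y *m B) 0 j' = - A i j.
    rewrite /y mulmxKV // !mxE; congr (- A _ _); exact: val_inj.
  rewrite mxE in yB; rewrite -[X in _ + X]opprK -yB; apply/eqP; rewrite subr_eq0.
  apply/eqP; apply: eq_bigr => k _; rewrite ffunE /= valK [B _ _]mxE.
  by congr (_ * A _ _); apply: val_inj.
have [L LP] := fin_all_exists row_ex.
exists (\matrix_(i < n, j < n) L i j); split.
- by move=> i; rewrite mxE; case: (LP i).
- by move=> i j ij; rewrite mxE; case: (LP i) => _ ->.
- move=> i j ji; rewrite mxE; have [_ _ /(_ _ ji) lA0] := LP i; rewrite -[RHS]lA0.
  by apply: eq_bigr => k _; rewrite mxE.
Qed.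

Lemma invmxM (P Q : 'M[C]_n) : P \in unitmx -> Q \in unitmx ->
  invmx (P *m Q) = invmx Q *m invmx P.
Proof.
move=> Pu Qu; have PQu : P *m Q \in unitmx by rewrite unitmx_mul Pu.
by apply: (can_inj (mulKmx PQu)); rewrite mulmxV // mulmxA mulmxK // mulmxV.
Qed.

Lemma anti_tr : (anti_mx C n)^T = anti_mx C n.
Proof.
by apply/matrixP => i j; rewrite !mxE -(inj_eq rev_ord_inj) rev_ordK eq_sym.
Qed.

Lemma ublock_symp (X B D : 'M[C]_n) :
  X^T *m anti_mx C n *m D = anti_mx C n ->
  D^T *m anti_mx C n *m B = B^T *m anti_mx C n *m D ->
  is_symplectic (block_mx X B 0 D).
Proof.
move=> XD DB; have DX : D^T *m anti_mx C n *m X = anti_mx C n.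
  by apply: trmx_inj; rewrite !trmx_mul trmxK anti_tr mulmxA.
apply/eqP; rewrite /J_mx tr_block_mx trmx0 !mulmx_block.
rewrite !(mulmx0, mul0mx, mulmxN, mulNmx, addr0, add0r, oppr0).
by rewrite XD DX DB ?addNr ?subrr.
Qed.

Lemma lshift_lt i : (i < n)%N -> exists i' : 'I_n, i = lshift n i'.
Proof. by move=> iN; exists (Ordinal iN); apply: val_inj. Qed.

(** The block upper triangular matrix with top rows [L *m (A, B)] has exactly
    one symplectic completion. *)
Lemma borel_reduction x :
  (forall (k : nat) (kn : (k <= n)%N), \det (mxsub
     (lshift n \o widen_ord kn) (lshift n \o widen_ord kn) (sp_mx x)) != 0) ->
  exists l b : Sp C n, [/\ in_Ubar l, forall i j, (j < i)%N -> b i j = 0 & (l * x)%g = b].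
Proof.
move=> xdet; set A := ulsubmx (sp_mx x); set B := ursubmx (sp_mx x).
have AE (k : nat) (kn : (k <= n)%N) : \det (mxsub (widen_ord kn) (widen_ord kn) A) != 0.
  have := xdet k kn; congr (\det _ != 0).
  by apply/matrixP => i j; rewrite !mxE.
have [L [L1 Ll LA0]] := lower_elimination AE.
have Lu : L \in unitmx.
  rewrite unitmxE det_trig; last exact/is_trig_mxP.
  by rewrite big1 ?unitr1 // => i _.
have Au : A \in unitmx.
  rewrite unitmxE unitfE; have := AE n (leqnn n); congr (\det _ != 0).
  by apply/matrixP => i j; rewrite !mxE; congr (sp_mx x _ _); apply: val_inj.
pose s := anti_mx C n; have sK : s *m s = 1%:M := anti_mxK C n.
(* the lower right block is forced by the upper left one *)
pose D := s *m (invmx (L *m A))^T *m s.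
have LAu : L *m A \in unitmx by rewrite unitmx_mul Lu.
have iso : A *m s *m B^T = B *m s *m A^T.
  have := symp_rows x; rewrite -[sp_mx x]submxK -/A -/B.
  rewrite /J_mx tr_block_mx !mulmx_block => /(congr1 ulsubmx).
  rewrite !block_mxKul !mulmx0 !addr0 !add0r mulmxN mulNmx => /eqP.
  by rewrite addrC subr_eq0 => /eqP.
have bs : is_symplectic (block_mx (L *m A) (L *m B) 0 D).
  apply: ublock_symp.
    rewrite -/s /D !mulmxA -(mulmxA _ s s) sK mulmx1 -trmx_mul mulVmx //.
    by rewrite trmx1 mul1mx.
  rewrite -/s; have -> : D^T *m s *m (L *m B) = s *m invmx A *m B.
    rewrite /D !trmx_mul trmxK anti_tr -/s -!mulmxA (mulmxA s s) sK mul1mx.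
    by rewrite invmxM // -!mulmxA (mulmxA (invmx L)) mulVmx // mul1mx.
  apply: trmx_inj; rewrite !trmx_mul !trmxK anti_tr -/s /D.
  rewrite invmxM //.
  have -> : s *m (invmx A *m invmx L *m s) *m (s *m (L *m B)) = s *m invmx A *m B.
    rewrite -!mulmxA (mulmxA s s) sK mul1mx (mulmxA (invmx L)) mulVmx // mul1mx.
    by [].
  have H : s *m B^T *m (invmx A)^T = invmx A *m B *m s.
    have := congr1 (fun M => invmx A *m M *m (invmx A)^T) iso.
    rewrite /= !mulmxA mulVmx // mul1mx => ->.
    by rewrite -!mulmxA -trmx_mul mulVmx // trmx1 mulmx1.
  have := congr1 (fun M => s *m M *m s) H; rewrite /= !mulmxA sK mul1mx => ->.
  by rewrite -!mulmxA sK mulmx1.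
pose b : Sp C n := MkSp bs.
have b0 i j : (j < i)%N -> b i j = 0.
  move: i j; apply: symp_upper => [i j ji jn | i iN].
    rewrite /b /= mxE; case: splitP => i' ei; rewrite mxE; case: splitP => j' ej.
    - by apply: LA0; rewrite -ei -ej.
    - by move: jn; rewrite ej; lia.
    - by rewrite mxE.
    - by move: jn; rewrite ej; lia.
  have [i' ->] := lshift_lt iN; rewrite /b /= block_mxEul.
  have := LAu; rewrite unitmxE -det_tr det_trig; last first.
    by apply/is_trig_mxP => i1 j1 ij; rewrite mxE LA0.
  rewrite unitfE prodf_seq_neq0 => /allP/(_ i'); rewrite mem_index_enum mxE.
  exact.
exists (b * x^-1)%g, b; split => //; last by rewrite -mulgA mulVg mulg1.
have lE : usubmx (sp_mx (b * x^-1)%g) = row_mx L 0.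
  have -> : sp_mx (b * x^-1)%g = sp_mx b *m invmx (sp_mx x) by [].
  have bu : usubmx (sp_mx b) = row_mx L 0 *m sp_mx x.
    rewrite /b /= /block_mx col_mxKu -[sp_mx x]submxK -/A -/B mul_row_block.
    by rewrite !mul0mx !addr0.
  by rewrite -mul_usub_mx bu mulmxK ?sp_unitmx.
have tE : forall (i' : 'I_n) j, sp_mx (b * x^-1)%g (lshift n i') j = (row_mx L 0 : 'M_(n, n + n)) i' j.
  by move=> i' j; rewrite -lE [RHS]mxE.
set l := (b * x^-1)%g in tE *.
have lL (i' j' : 'I_n) : l (lshift n i') (lshift n j') = L i' j' by rewrite tE row_mxEl.
have l0 i j : (i < j)%N -> l i j = 0.
  move=> ij; have := @symp_upper C n (sp_tr l) _ _ j i ij; rewrite /= !mxE; apply.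
    move=> i1 j1 ji jn; rewrite mxE; have [j2 j2E] := lshift_lt jn.
    rewrite j2E tE mxE; case: splitP => i' ei; last by rewrite mxE.
    by apply: Ll; rewrite -ei; move: ji; rewrite j2E.
  by move=> i1 iN; rewrite mxE; have [i' ->] := lshift_lt iN; rewrite lL L1 oner_eq0.
split=> // i.
have l1 i1 : (i1 < n)%N -> l i1 i1 = 1.
  by move=> iN; have [i' ->] := lshift_lt iN; rewrite lL L1.
have [/l1//|] := ltnP i n; rewrite leqNgt lt_half negbK => /l1 lr.
have trE i1 j1 : sp_tr l i1 j1 = l j1 i1 by rewrite [LHS]mxE.
have := @symp_upper_diag C n (sp_tr l) _ i; rewrite !trE lr mulr1; apply.
by move=> i1 j1 ji; rewrite trE l0.
Qed.

End LU.

(** * A chart for the double quotient *)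

Section Chart.
Variables (C : numFieldType) (m : nat).
Notation n := m.+1.
Implicit Types (g x u : Sp C n) (i j : 'I_(n + n)) (a : 'cV[C]_(n + n)).

Definition ord_idx (k : nat) : 'I_(n + n) := @inord (m + n) k.

Lemma idxE k : (k < n + n)%N -> ord_idx k = k :> nat.
Proof. by move=> kn; rewrite /ord_idx inordK. Qed.

Lemma idx_val i : ord_idx i = i.
Proof. by apply: val_inj; rewrite /= idxE. Qed.

Lemma idx_inj k l : (k < n + n)%N -> (l < n + n)%N -> ord_idx k = ord_idx l -> k = l.
Proof. by move=> kn ln /(congr1 val) /=; rewrite !idxE. Qed.

(** The first [k] rows and the columns [c 0, ..., c k.-1], in this order. *)
Definition minor (k : nat) (c : nat -> nat) g : C :=
  \det (\matrix_(i < k, j < k) g (ord_idx i) (ord_idx (c j))).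

(** Cyclic permutation of the columns: it moves the columns of [e_n] and
    [e_(-n)] to the two extreme positions and keeps the order of the others. *)
Definition cyc (j : nat) : nat :=
  if (j < m)%N then j.+1 else if j == m then 0%N
  else if j == m.+1 then (m + m).+1 else j.-1.

Lemma cyc_lt (j : nat) : (j < n + n)%N -> (cyc j < n + n)%N.
Proof. by rewrite /cyc; do 3?case: ifP; lia. Qed.

Lemma cyc_inj (j k : nat) : (j < n + n)%N -> (k < n + n)%N -> cyc j = cyc k -> j = k.
Proof. by rewrite /cyc; do 6?case: ifP; lia. Qed.

Lemma cyc_rev (j : nat) : (j < n + n)%N -> cyc (n + n - j.+1) = (n + n - (cyc j).+1)%N.
Proof. by rewrite /cyc; do 6?case: ifP; lia. Qed.

Lemma cyc_half (j : nat) : (j < n + n)%N -> (cyc j < n)%N = (j < n)%N.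
Proof. by rewrite /cyc; do 3?case: ifP; lia. Qed.

Lemma cyc_mono (j k : nat) : (j < k)%N -> (k < n + n)%N -> j != m -> j != m.+1 ->
  k != m -> k != m.+1 -> (cyc j < cyc k)%N.
Proof. by rewrite /cyc; do 6?case: ifP; lia. Qed.

Definition w_mx : 'M[C]_(n + n) := \matrix_(i, j) (i == cyc j :> nat)%:R.

Lemma mulmx_w (A : 'M[C]_(n + n)) i j : (A *m w_mx) i j = A i (ord_idx (cyc j)).
Proof.
rewrite mxE (bigD1 (ord_idx (cyc j))) //= !mxE idxE ?cyc_lt // eqxx mulr1 big1 ?addr0 //.
move=> k kj; rewrite !mxE (_ : _ == _ = false) ?mulr0 //.
by apply: contraNF kj => /eqP <-; rewrite idx_val.
Qed.

Lemma w_symp : is_symplectic w_mx.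
Proof.
apply/sympP => i j; rewrite (bigD1 (ord_idx (cyc i))) //= big1 ?addr0 => [|k ki].
  have ci := cyc_lt (ltn_ord i); have cj := cyc_lt (ltn_ord j).
  rewrite J_mxE !mxE /= idxE // eqxx mulr1 /J_sign cyc_half // mulrC.
  congr (_%:R * _); rewrite -cyc_rev // -val_eqE /=; congr nat_of_bool.
  have := ltn_ord i; have := ltn_ord j => jN iN.
  apply/eqP/eqP => [/cyc_inj H|->]; last by congr cyc; lia.
  have : (n + n - i.+1)%N = j by apply: H => //; lia.
  lia.
rewrite !mxE (_ : _ == _ = false) ?mulr0 ?mul0r //.
by apply: contraNF ki => /eqP <-; rewrite idx_val.
Qed.

Definition w_sp : Sp C n := MkSp w_symp.

(** The product of [S] and the form lies in the symplectic Lie algebra and squares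
    to zero, so that adding the identity gives its exponential. *)
Lemma siegel_symp (S : 'M[C]_(n + n)) : S^T = S -> S *m J_mx C n *m S = 0 ->
  is_symplectic (1%:M + S *m J_mx C n).
Proof.
move=> ST SJS; apply/eqP; rewrite [(_ + _)^T]raddfD /= trmx1 trmx_mul ST J_tr.
have E : J_mx C n *m S *m J_mx C n *m (S *m J_mx C n) = 0.
  transitivity (J_mx C n *m (S *m J_mx C n *m S) *m J_mx C n); first by rewrite !mulmxA.
  by rewrite SJS mulmx0 mul0mx.
rewrite mulNmx mulmxDl mul1mx mulNmx mulmxDl !mulmxDr !mulmx1 !mulNmx E oppr0 addr0.
by rewrite mulmxA addrK.
Qed.

Definition lst : 'I_(n + n) := rshift n (@ord_max m).
Definition e0 : 'cV[C]_(n + n) := delta_mx (lshift n ord0) 0.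
(** Multiplied by the form, these symmetric matrices with [a lst 0 = 0] are the Lie
    algebra of the unipotent radical of the stabilizer of the line through [e_1],
    a Heisenberg algebra. *)
Definition heis_sym a : 'M[C]_(n + n) := a *m e0^T + e0 *m a^T.

Lemma e0_J (v : 'cV[C]_(n + n)) : e0^T *m J_mx C n *m v = (v lst 0)%:M.
Proof.
apply/matrixP => i j; rewrite !ord1 mxE (bigD1 lst) //= trmx_delta -rowE.
rewrite [row _ _ _ _]mxE J_mxE big1 => [|k km].
  rewrite [RHS]mxE eqxx mulr1n addr0.
  rewrite (_ : _ == _ = true) /J_sign /= ?mul1r ?mulr1 //.
  by apply/eqP; apply: val_inj; rewrite /=; lia.
rewrite [row _ _ _ _]mxE J_mxE (_ : _ == _ = false) ?mul0r //.
apply: contraNF km => /eqP E; apply/eqP/rev_ord_inj; rewrite -E.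
by apply: val_inj; rewrite /=; lia.
Qed.

Lemma heis_SJS a : a lst 0 = 0 ->
  heis_sym a *m J_mx C n *m heis_sym a = 0.
Proof.
move=> a0; have E1 : e0^T *m J_mx C n *m a = 0 by rewrite e0_J a0 raddf0.
have E2 : a^T *m J_mx C n *m e0 = 0.
  apply: trmx_inj; rewrite !trmx_mul trmxK J_tr mulNmx mulmxN mulmxA E1.
  by rewrite oppr0 trmx0.
rewrite /heis_sym !mulmxDl !mulmxDr -!mulmxA.
rewrite !(mulmxA (_^T)) !(mulmxA (_^T *m _)) E1 E2 !J_form0.
by rewrite !mul0mx !mulmx0 !addr0.
Qed.

Lemma heis_symT a : (heis_sym a)^T = heis_sym a.
Proof. by rewrite /heis_sym raddfD /= !trmx_mul !trmxK addrC. Qed.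

(** The last coordinate, the pairing with [e_1], must vanish for
    [heis_SJS]. *)
Definition heis_vec a : 'cV[C]_(n + n) :=
  \col_i (if i == lst then 0 else a i 0).

Lemma heis_vec_max a : heis_vec a lst 0 = 0.
Proof. by rewrite mxE eqxx. Qed.

Definition heis a : Sp C n :=
  MkSp (siegel_symp (heis_symT (heis_vec a)) (heis_SJS (heis_vec_max a))).

Lemma mulmx_JE (A : 'M[C]_(n + n)) i j :
  (A *m J_mx C n) i j = A i (rev_ord j) * J_sign C n (rev_ord j).
Proof.
rewrite mxE (bigD1 (rev_ord j)) //= J_mxE eqxx mul1r big1 ?addr0 // => k kj.
by rewrite J_mxE (negPf kj) mul0r mulr0.
Qed.

Lemma heisE a i j : heis a i j = (i == j)%:R +
  ((j == lst)%:R * heis_vec a i 0 + (i == 0 :> nat)%:R * heis_vec a (rev_ord j) 0)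
  * J_sign C n (rev_ord j).
Proof.
rewrite [LHS]mxE [X in X + _]mxE mulmx_JE; congr (_ + _ * _).
rewrite [LHS]mxE; congr (_ + _); rewrite [LHS]mxE big_ord1 /e0.
  rewrite [in X in _ * X]mxE [in X in _ * X]mxE eqxx andbT mulrC; congr (_%:R * _).
  rewrite -(inj_eq rev_ord_inj) rev_ordK -val_eqE -[in RHS]val_eqE /=.
  by congr nat_of_bool; apply/eqP/eqP; lia.
rewrite [in X in _ * X]mxE mxE eqxx andbT; congr (_%:R * _).
Qed.

Lemma J_sign0 : J_sign C n 0 = 1. Proof. by []. Qed.

Lemma heis_upper a : in_U (heis a).
Proof.
split=> [i|i j ji].
  rewrite heisE eqxx; have [->|nl] := eqVneq i lst.
    by rewrite heis_vec_max mulr0 add0r (_ : _ == _ = false) ?mul0r ?mul0r ?addr0 //=.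
  rewrite mul0r add0r; have [i0|] := eqVneq (i : nat) 0%N; last by rewrite !mul0r addr0.
  rewrite (_ : rev_ord i = lst) ?heis_vec_max ?mulr0 ?mul0r ?addr0 //.
  by apply: val_inj; rewrite /= i0; lia.
have ij : (i == j) = false by apply/eqP => E; move: ji; rewrite E ltnn.
have jl : (j == lst) = false.
  by apply/eqP => E; move: ji; rewrite E /=; have := ltn_ord i; lia.
have i0 : ((i : nat) == 0%N) = false by apply/eqP => E; move: ji; rewrite E.
by rewrite heisE ij jl i0 !mulr0n !mul0r !addr0 mul0r addr0.
Qed.

Lemma in_U_mul x g : in_U x -> in_U g -> in_U (x * g)%g.
Proof.
move=> [x1 x0] [g1 g0]; split=> [i|i j ji].
  rewrite mxE (bigD1 i) //= x1 g1 mulr1 big1 ?addr0 // => k ki.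
  have [ik|] := ltnP i k; first by rewrite (g0 k i) // mulr0.
  by rewrite leq_eqVlt val_eqE (negPf ki) /= => /x0 ->; rewrite mul0r.
rewrite mxE big1 // => k _; have [ki|ik] := ltnP k i; first by rewrite x0 // mul0r.
by rewrite g0 ?mulr0 //; apply: leq_trans ik.
Qed.

Lemma heisK a : (heis a * heis (- a))%g = 1%g.
Proof.
have vN : heis_vec (- a) = - heis_vec a.
  by apply/colP => i; rewrite !mxE; case: ifP => _; rewrite ?oppr0.
have sN : heis_sym (heis_vec (- a)) = - heis_sym (heis_vec a).
  by rewrite vN /heis_sym mulNmx [(- _)^T]raddfN /= mulmxN opprD.
apply: val_inj; rewrite /= sN; set S := heis_sym _.
rewrite mulmxDl mul1mx mulmxDr mulmx1 mulmxA mulmxN.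
by rewrite (heis_SJS (heis_vec_max a)) oppr0 mul0mx addr0 mulNmx addrNK.
Qed.

Lemma sp_pred_cols u : in_Sp_pred u <->
  forall i, u i (ord_idx m) = (i == m :> nat)%:R /\ u i (ord_idx n) = (i == n :> nat)%:R.
Proof.
have pE : ord_idx m = lshift n ord_max by apply: val_inj; rewrite /= idxE //; lia.
have nE : ord_idx n = rev_ord (lshift n ord_max).
  by apply: val_inj; rewrite /= idxE //; lia.
have dE (A : 'M[C]_(n + n)) k i : (A *m delta_mx k (0 : 'I_1)) i 0 = A i k.
  by rewrite -colE mxE.
have vE k i : (delta_mx k 0 : 'cV[C]_(n + n)) i 0 = (i == k :> nat)%:R.
  by rewrite mxE eqxx andbT -val_eqE.
have [km kn] : ord_idx m = m :> nat /\ ord_idx n = n :> nat by rewrite !idxE //; lia.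
split=> [H i|H i [im]].
  have [//|Hp Hn] := H ord_max; split.
    by rewrite -[LHS]dE pE -/(e_pos C ord_max) Hp vE -pE km.
  by rewrite -[LHS]dE nE -/(e_neg C ord_max) Hn vE -nE kn.
have -> : i = ord_max by apply: val_inj.
split; apply/matrixP => k l; rewrite !ord1 dE vE.
  by rewrite -pE km; case: (H k).
by rewrite -nE kn; case: (H k).
Qed.

(** The form pairs [e_i] with the coordinate [rev_ord i] only, so fixing [e_i]
    pins down the corresponding row. *)
Lemma sp_fixed_row g i j : (forall k, g k i = (k == i)%:R) ->
  g (rev_ord i) j = (rev_ord i == j)%:R.
Proof.
move=> gi; have /sympP/(_ i j) := sp_mxP g.
rewrite (bigD1 i) //= big1 ?addr0 => [|k ki]; last first.
  by rewrite gi (negPf ki) mulr0 mul0r.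
rewrite gi eqxx mulr1 J_mxE -(inj_eq rev_ord_inj) rev_ordK mulrC => /mulIf.
by apply; rewrite /J_sign; case: ifP; rewrite ?oppr_eq0 oner_eq0.
Qed.

End Chart.

Section ChartThm.
Variables (C : numFieldType) (m : nat).
Notation n := m.+1.
Implicit Types (g x u : Sp C n) (i : 'I_(n + n)).

(** The column of [e_n] comes first, then those of [e_1], [e_2] and so on. *)
Definition colu (j : nat) : nat := if j is j'.+1 then j' else m.

Lemma cyc_colu j : (j < n)%N -> cyc m (colu j) = j.
Proof. by case: j => [|j] /=; rewrite /cyc; do 3?case: ifP; lia. Qed.

Lemma colu_lt j : (j < n)%N -> (colu j < n + n)%N.
Proof. by case: j => [|j] /=; lia. Qed.

Lemma w_cols x i (j : nat) : (j < n + n)%N -> (x * w_sp C m)%g i (ord_idx m j) = x i (ord_idx m (cyc m j)).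
Proof. by move=> jn; rewrite -[LHS]/((sp_mx x *m w_mx C m) i (ord_idx m j)) mulmx_w idxE. Qed.

Lemma w_rows u i j : (w_sp C m * u)%g (ord_idx m (cyc m i)) j = u i j.
Proof.
rewrite mxE (bigD1 i) //= mxE idxE ?cyc_lt // eqxx mul1r big1 ?addr0 // => k ki.
rewrite mxE idxE ?cyc_lt // (_ : _ == _ = false) ?mul0r //.
by apply: contraNF ki => /eqP/cyc_inj E; rewrite -val_eqE /= E.
Qed.

(** The cyclic permutation carries the columns of [e_n] and [e_(-n)] to the first
    and the last column of [x], and both of these are trivial; on the other
    indices it preserves the order, hence triangularity. *)
Lemma w_conj_pred x : in_U x -> (forall i, x i (lst m) = (i == lst m)%:R) ->
  in_U ((w_sp C m)^-1 * x * w_sp C m)%g /\ in_Sp_pred ((w_sp C m)^-1 * x * w_sp C m)%g.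
Proof.
move=> [x1 x0] xl; set u := (_ * _ * _)%g.
have uE i j : u i j = x (ord_idx m (cyc m i)) (ord_idx m (cyc m j)).
  rewrite -w_rows mulgA mulgA mulgV mul1g.
  by rewrite -[in LHS](idx_val j) w_cols.
have idxm : ord_idx m m = m :> nat by rewrite idxE //; lia.
have idxn : ord_idx m n = n :> nat by rewrite idxE //; lia.
have lstE : ord_idx m (m + m).+1 = lst m by apply: val_inj; rewrite /= idxE; lia.
have u_col i : u i (ord_idx m m) = (i == m :> nat)%:R /\ u i (ord_idx m n) = (i == n :> nat)%:R.
  rewrite !uE idxm idxn [cyc m m](_ : _ = 0%N); last by rewrite /cyc; do 2?case: ifP; lia.
  rewrite [cyc m n](_ : _ = (m + m).+1); last by rewrite /cyc; do 3?case: ifP; lia.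
  rewrite lstE xl -lstE.
  have iN := ltn_ord i; have cN := cyc_lt iN.
  split; last first.
    congr (_%:R); congr nat_of_bool; rewrite -val_eqE /= !idxE //; last by lia.
    by apply/eqP/eqP; rewrite /cyc; do 3?case: ifP; lia.
  have [im|im] := eqVneq (i : nat) m.
    by rewrite (_ : cyc m i = 0%N) ?x1 // /cyc; do 2?case: ifP; lia.
  by rewrite x0 // !idxE //; move: im cN; rewrite /cyc; do 3?case: ifP; lia.
have u_row i : u (ord_idx m m) i = (i == m :> nat)%:R /\ u (ord_idx m n) i = (i == n :> nat)%:R.
  have rm : rev_ord (ord_idx m m) = ord_idx m n by apply: val_inj; rewrite /= idxm idxn; lia.
  have rn : rev_ord (ord_idx m n) = ord_idx m m by rewrite -rm rev_ordK.
  split.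
    rewrite -rn sp_fixed_row ?rn => [|k]; last by case: (u_col k) => _ ->; rewrite -[in RHS]val_eqE /= idxn.
    by rewrite eq_sym -val_eqE /= idxm.
  rewrite -rm sp_fixed_row ?rm => [|k]; last by case: (u_col k) => -> _; rewrite -[in RHS]val_eqE /= idxm.
  by rewrite eq_sym -val_eqE /= idxn.
split; last by apply/sp_pred_cols.
split=> [i|i j ji]; first by rewrite uE x1.
have ii k : (i : nat) = k -> i = ord_idx m k by move=> <-; rewrite idx_val.
have jj k : (j : nat) = k -> j = ord_idx m k by move=> <-; rewrite idx_val.
have [/jj jE|jm] := eqVneq (j : nat) m.
  by rewrite jE; case: (u_col i) => -> _; rewrite gtn_eqF //; move: ji; rewrite jE idxm.
have [/jj jE|jn] := eqVneq (j : nat) n.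
  by rewrite jE; case: (u_col i) => _ ->; rewrite gtn_eqF //; move: ji; rewrite jE idxn.
have [/ii iE|im] := eqVneq (i : nat) m.
  by rewrite iE; case: (u_row j) => -> _; rewrite ltn_eqF //; move: ji; rewrite iE idxm.
have [/ii iE|iN] := eqVneq (i : nat) n.
  by rewrite iE; case: (u_row j) => _ ->; rewrite ltn_eqF //; move: ji; rewrite iE idxn.
by rewrite uE x0 // !idxE ?cyc_lt // cyc_mono.
Qed.

(** The nonvanishing minors are, up to the cyclic permutation [w_sp], the leading
    minors, so the matrix has a triangular factorization; the last column of its
    unipotent factor is split off as an element of the Heisenberg group. *)
Lemma chart_decomposition g : (forall k, (k < n)%N -> minor k.+1 colu g != 0) ->
  exists (l t : Sp C n) a u, [/\ in_Ubar l, in_T t, in_U u /\ in_Sp_pred u &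
    (l * g = t * (heis a * w_sp C m) * u)%g].
Proof.
move=> gu; set w := w_sp C m.
have [x gx] : exists x : Sp C n, g = (x * w)%g.
  by exists (g * w^-1)%g; rewrite -mulgA mulVg mulg1.
have [l [b [lU b0 lx]]] : exists l b : Sp C n,
    [/\ in_Ubar l, forall i j : 'I_(n + n), (j < i)%N -> b i j = 0 & (l * x)%g = b].
  apply: borel_reduction => -[|k] kn; first by rewrite det_mx00 oner_eq0.
  have := gu k kn; rewrite /minor; congr (\det _ != 0).
  apply/matrixP => i j; rewrite !mxE gx.
  have jn : (j < n)%N by have := ltn_ord j; lia.
  have iN : (i < n)%N by have := ltn_ord i; lia.
  rewrite w_cols ?colu_lt // cyc_colu //.
  by congr (sp_mx x _ _); apply: val_inj; rewrite /= idxE //; lia.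
have [t [x' [tT x'U bE _]]] := upper_factor b0.
(* the corner entry of [heis a] is twice the first entry of [a] *)
pose a : 'cV[C]_(n + n) :=
  \col_i (if i == 0 :> nat then x' i (lst m) / 2%:R else x' i (lst m)).
have r0 : rev_ord (lst m) = 0%N :> nat by rewrite /=; lia.
have hl i : heis a i (lst m) = x' i (lst m).
  rewrite heisE eqxx mul1r r0 J_sign0 mulr1.
  have [->|nl] := eqVneq i (lst m).
    by rewrite heis_vec_max (_ : _ == _ = false) //= mul0r !addr0; case: x'U => ->.
  rewrite !mxE (negPf nl) add0r (_ : rev_ord (lst m) == lst m = false) //; last first.
    by apply/eqP => /(congr1 val) /=; lia.
  rewrite r0 eqxx; case: eqP => [i0|_]; last by rewrite mul0r addr0.
  rewrite mul1r (_ : rev_ord (lst m) = i) -?mulrDl; last exact/val_inj/(etrans r0)/esym.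
  by rewrite -mulr2n -[x' _ _ *+ 2]mulr_natr mulfK // pnatr_eq0.
(* what remains has the last column of the identity *)
pose x'' := (heis (- a) * x')%g.
have x''U : in_U x'' by apply: in_U_mul => //; apply: heis_upper.
have x''l i : x'' i (lst m) = (i == lst m)%:R.
  rewrite [LHS]mxE; under eq_bigr do rewrite -hl.
  have := congr1 (fun y : Sp C n => y i (lst m)) (heisK (- a)).
  by rewrite opprK [LHS]mxE => ->; rewrite [LHS]mxE.
have [uU uP] := w_conj_pred x''U x''l.
exists l, t, a, (w^-1 * x'' * w)%g; split => //.
rewrite gx mulgA lx bE -/w !mulgA -(mulgA _ w) mulgV mulg1 /x''.
by rewrite -(mulgA t (heis a)) heisK mulg1.
Qed.

End ChartThm.

(** * Invariant minors *)

Section DetLemmas.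
Variable R : comNzRingType.

Lemma det2 (A : 'M[R]_2) : \det A = A 0 0 * A 1 1 - A 0 1 * A 1 0.
Proof.
rewrite (expand_det_row _ 0) !big_ord_recl big_ord0 addr0 /cofactor !det_mx11 !mxE /=.
rewrite expr0 expr1 mul1r mulN1r mulrN.
by congr (_ * A _ _ - A _ _ * A _ _); apply: val_inj.
Qed.

Lemma det_upper (k : nat) (A : 'M[R]_k) : (forall i j : 'I_k, (j < i)%N -> A i j = 0) ->
  \det A = \prod_i A i i.
Proof.
move=> A0; rewrite -det_tr det_trig; last by apply/is_trig_mxP => i j ij; rewrite mxE A0.
by apply: eq_bigr => i _; rewrite mxE.
Qed.

Lemma det_col0 (k : nat) (A B D : 'M[R]_k.+1) (b d : R) :
  (forall i, A i 0 = b * B i 0 + d * D i 0) ->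
  (forall i j, j != 0 -> B i j = A i j) -> (forall i j, j != 0 -> D i j = A i j) ->
  \det A = b * \det B + d * \det D.
Proof.
move=> A0 BA DA; rewrite -det_tr -(det_tr B) -(det_tr D).
apply: (@determinant_multilinear _ _ _ _ _ 0).
- by apply/rowP => i; rewrite !mxE A0.
- by apply/matrixP => i j; rewrite !mxE BA.
- by apply/matrixP => i j; rewrite !mxE DA.
Qed.

(** Schur complement. *)
Lemma det_bordered (k : nat) (z : R) (al : 'rV_k) (be : 'cV_k) :
  \det (block_mx z%:M al be 1%:M : 'M_(1 + k)) = z - (al *m be) 0 0.
Proof.
have := det_mulmx (block_mx z%:M al be 1%:M : 'M_(1 + k)) (block_mx 1%:M 0 (- be) 1%:M).
rewrite mulmx_block !mulmx1 !mul1mx !mulmx0 add0r subrr add0r det_ublock det_lblock.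
by rewrite !det1 !mulr1 => <-; rewrite det_mx11 mulmxN !mxE eqxx mulr1n.
Qed.

End DetLemmas.

Section Minors.
Variables (C : numFieldType) (m : nat).
Notation n := m.+1.
Implicit Types (g b x u : Sp C n) (c : nat -> nat) (k : nat).
Notation idx := (ord_idx m).

Lemma regular_minor k c : regular (@minor C m k c).
Proof. by apply: regular_det => i j; apply: regular_entry. Qed.

Lemma sum_idx (F : 'I_(n + n) -> C) k : (k <= n + n)%N ->
  (forall l : 'I_(n + n), (k <= l)%N -> F l = 0) ->
  \sum_l F l = \sum_(l < k) F (idx l).
Proof.
move=> kn F0; rewrite (bigID (fun l : 'I_(n + n) => (l < k)%N)) /= (big_ord_narrow kn).
rewrite [X in _ + X]big1 ?addr0 => [|l]; last by rewrite -leqNgt => /F0.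
apply: eq_bigr => l _; congr F; apply: val_inj; rewrite /= idxE //.
exact: leq_trans (ltn_ord l) kn.
Qed.

Lemma minor_mull b g k c : (k <= n + n)%N ->
  (forall i j : 'I_(n + n), (i < j)%N -> b i j = 0) ->
  minor k c (b * g)%g = \prod_(i < k) b (idx i) (idx i) * minor k c g.
Proof.
move=> kn b0; have iE (i : 'I_k) : idx i = i :> nat.
  by rewrite idxE //; apply: leq_trans (ltn_ord i) kn.
have -> : \prod_(i < k) b (idx i) (idx i) = \det (\matrix_(i < k, j < k) b (idx i) (idx j)).
  rewrite det_trig; first by apply: eq_bigr => i _; rewrite mxE.
  by apply/is_trig_mxP => i j ij; rewrite mxE b0 // !iE.
rewrite /minor -det_mulmx; congr (\det _); apply/matrixP => i j; rewrite !mxE.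
rewrite (sum_idx kn) => [|l kl].
  by apply: eq_bigr => l _; rewrite !mxE.
by rewrite b0 ?mul0r // iE; apply: leq_trans (ltn_ord i) kl.
Qed.

(** Right multiplication by an upper triangular matrix acts on the columns [c]
    through its square submatrix on [c] if [c] contains, with each column, all
    earlier ones; the columns [m] and [n] are exempt because [b] has there the
    columns of the identity. *)
Lemma minor_borel b g k c :
  (forall i, (i < k)%N -> (c i < n + n)%N) ->
  (forall i j, (i < k)%N -> (j < k)%N -> c i = c j -> i = j) ->
  (forall i j : 'I_(n + n), (j < i)%N -> b i j = 0) ->
  (forall i : 'I_(n + n), i != idx m -> b i (idx m) = 0) ->
  (forall i : 'I_(n + n), i != idx n -> b i (idx n) = 0) ->
  (forall j, (j < k)%N -> c j = m \/ c j = n \/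
     forall l, (l <= c j)%N -> exists2 i, (i < k)%N & c i = l) ->
  (forall i j, (j < i)%N -> (i < k)%N -> c j = m \/ c j = n \/ (c j < c i)%N) ->
  minor k c (g * b)%g = minor k c g * \prod_(i < k) b (idx (c i)) (idx (c i)).
Proof.
move=> cn cI b0 bm bn cl co.
pose h (i : 'I_k) := idx (c i).
have hI : injective h.
  move=> i j /idx_inj E; apply: val_inj; apply: cI => //=.
  by apply: E; apply: cn.
have hE (i : 'I_k) l : idx (c i) = idx l -> (l < n + n)%N -> c i = l.
  by move=> /idx_inj E ln; apply: E => //; apply: cn.
have -> : \prod_(i < k) b (idx (c i)) (idx (c i)) =
    \det (\matrix_(i < k, j < k) b (h i) (h j)).
  rewrite det_upper; first by apply: eq_bigr => i _; rewrite mxE.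
  move=> i j ji; rewrite mxE /h.
  have cij : c i != c j by apply/eqP => /cI E; move: ji; rewrite E ?ltnn.
  have [E|[E|E]] := co i j ji (ltn_ord i).
  - rewrite E bm //; apply: contraNneq cij => /hE ->; [by rewrite E | lia].
  - rewrite E bn //; apply: contraNneq cij => /hE ->; [by rewrite E | lia].
  - by rewrite b0 // !idxE ?cn.
rewrite /minor -det_mulmx; congr (\det _); apply/matrixP => i j; rewrite !mxE.
rewrite (bigID (mem [set h l | l : 'I_k])) /= [X in _ + X]big1 ?addr0 => [|l lh].
  rewrite big_imset /=; last by move=> ? ? _ _; apply: hI.
  by apply: eq_bigr => l _; rewrite !mxE.
have lN i' : (i' < k)%N -> l != idx (c i').
  by move=> ik; apply: contraNneq lh => ->; apply/imsetP; exists (Ordinal ik).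
have jk := ltn_ord j.
have [E|[E|E]] := cl j jk.
- by rewrite E bm ?mulr0 //; have := lN j jk; rewrite E.
- by rewrite E bn ?mulr0 //; have := lN j jk; rewrite E.
have [lj|jl] := leqP l (c j); last by rewrite b0 ?mulr0 // idxE ?cn.
have [i' ik ci] := E _ lj.
by have := lN i' ik; rewrite ci idx_val eqxx.
Qed.

Definition colv (j : nat) : nat := if j is j'.+1 then j' else n.
Definition colg (i j : nat) : nat :=
  if j == 0%N then m else if (j <= i)%N then j.-1 else n.

(** The four families are the minors u_k, v_k, Delta_k and Gamma_k; each is
    invariant under the unipotent groups. *)
Definition uu k : Sp C n -> C := minor k.+1 (colu m).
Definition vv k : Sp C n -> C := minor k.+1 colv.
Definition dl k : Sp C n -> C := minor k.+1 id.
Definition gm k : Sp C n -> C := minor k.+2 (colg k).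

Section Borel.
Variables (b g : Sp C n).
Hypothesis b0 : forall i j : 'I_(n + n), (j < i)%N -> b i j = 0.
Hypothesis bm : forall i : 'I_(n + n), b i (idx m) = (i == idx m)%:R.
Hypothesis bn : forall i : 'I_(n + n), b i (idx n) = (i == idx n)%:R.

Let bm0 (i : 'I_(n + n)) : i != idx m -> b i (idx m) = 0.
Proof. by move=> im; rewrite bm (negPf im). Qed.
Let bn0 (i : 'I_(n + n)) : i != idx n -> b i (idx n) = 0.
Proof. by move=> im; rewrite bn (negPf im). Qed.

Lemma uu_borel k : (k < n)%N -> uu k (g * b)%g = uu k g * \prod_(i < k) b (idx i) (idx i).
Proof.
move=> kn; rewrite /uu minor_borel //; first by rewrite big_ord_recl /= bm eqxx mul1r.
- by case=> [|i] /= ik; lia.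
- by case=> [|i] [|j] /= ik jk; lia.
- case=> [|j] /= jk; first by left.
  by right; right => l lj; exists l.+1 => //; lia.
- case=> [|i] [|j] //= ji ik; first by left.
  by right; right; lia.
Qed.

Lemma vv_borel k : (k < n)%N -> vv k (g * b)%g = vv k g * \prod_(i < k) b (idx i) (idx i).
Proof.
move=> kn; rewrite /vv minor_borel //; first by rewrite big_ord_recl /= bn eqxx mul1r.
- by case=> [|i] /= ik; lia.
- by case=> [|i] [|j] /= ik jk; lia.
- case=> [|j] /= jk; first by right; left.
  by right; right => l lj; exists l.+1 => //; lia.
- case=> [|i] [|j] //= ji ik; first by right; left.
  by right; right; lia.
Qed.

Lemma dl_borel k : (k < m)%N -> dl k (g * b)%g = dl k g * \prod_(i < k.+1) b (idx i) (idx i).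
Proof.
move=> kn; rewrite /dl minor_borel //.
- by move=> i ik; lia.
- move=> j jk; right; right => l lj; exists l => //; lia.
- by move=> i j ji ik; right; right.
Qed.

Lemma gm_borel k : (k < m)%N -> gm k (g * b)%g = gm k g * \prod_(i < k) b (idx i) (idx i).
Proof.
move=> kn; rewrite /gm minor_borel //.
- rewrite big_ord_recl big_ord_recr /= /colg /= bm eqxx mul1r ltnn bn eqxx mulr1.
  by congr (_ * _); apply: eq_bigr => i _; rewrite /= /bump /= add1n ltn_ord.
- by move=> i ik; rewrite /colg; do 2?case: ifP; lia.
- by move=> i j ik jk; rewrite /colg; do 4?case: ifP; lia.
- move=> j jk; rewrite {1 2}/colg; case: eqP => [_|j0]; first by left.
  case: ifP => jk'; last by right; left.
  right; right => l; rewrite {1}/colg; case: eqP => // _; rewrite jk' => lj.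
  by exists l.+1; rewrite /colg /=; [lia | rewrite ifT //; lia].
- by move=> i j ji ik; rewrite /colg; do 4?case: ifP; lia.
Qed.

End Borel.
End Minors.

(** * The action of SL_2 on the minors and their values on the chart *)

Section SL2Action.
Variables (C : numFieldType) (m : nat).
Notation n := m.+1.
Implicit Types (g b x u : Sp C n) (k : nat) (h : SL2 C).
Notation idx := (ord_idx m).

Lemma ord2 (i : 'I_2) : i = 0 \/ i = 1.
Proof. by case: i => [[|[|]]] // ?; [left|right]; apply: val_inj. Qed.

Lemma sl2_colE g h i (j : 'I_(n + n)) : (g * sl2_emb n h)%g i j =
  g i j + \sum_(q < 2) \sum_(p < 2) g i (idx (m + p)) * (h p q - (p == q)%:R)
    * (j == (m + q)%N :> nat)%:R.
Proof.
rewrite -[LHS]/((sp_mx g *m sl2_emb_mx n (sl2_mx h)) i j) /sl2_emb_mx.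
rewrite mulmxDr mulmx1 mxE; congr (_ + _); rewrite !mulmxA mxE.
apply: eq_bigr => q _; rewrite [(last_mx _ _)^T _ _]mxE [last_mx _ _ _ _]mxE mxE mulr_suml.
apply: eq_bigr => p _; congr (_ * _ * _); last by rewrite !mxE.
rewrite mxE (bigD1 (idx (m + p))) //= mxE idxE; last by have := ltn_ord p; lia.
rewrite eqxx mulr1 big1 ?addr0 // => l lp; rewrite mxE (_ : _ == _ = false) ?mulr0 //.
by apply: contraNF lp => /eqP <-; rewrite idx_val.
Qed.

Lemma sl2_col g h i : [/\
  forall j : nat, (j < m)%N -> (g * sl2_emb n h)%g i (idx j) = g i (idx j),
  (g * sl2_emb n h)%g i (idx m) = h 0 0 * g i (idx m) + h 1 0 * g i (idx n) &
  (g * sl2_emb n h)%g i (idx n) = h 0 1 * g i (idx m) + h 1 1 * g i (idx n)].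
Proof.
have l01 : lift ord0 ord0 = 1 :> 'I_2 by apply: val_inj.
have mE : (m == m + 0)%N = true by lia.
have mE1 : (m == m + 1)%N = false by lia.
have nE : (n == m + 0)%N = false by lia.
have nE1 : (n == m + 1)%N = true by lia.
have i1 : idx (m + 1) = idx n by congr (ord_idx _ _); lia.
have i0 : idx (m + 0) = idx m by congr (ord_idx _ _); lia.
split=> [j jm||]; rewrite sl2_colE !big_ord_recl !big_ord0 ?l01 /= ?i0 ?i1 idxE; try lia.
- rewrite (_ : (j == m + 0)%N = false); last by lia.
  by rewrite (_ : (j == m + 1)%N = false) ?mulr0 ?addr0 //; last by lia.
- rewrite mE mE1 !mulr0 !mulr1 !addr0 ?eqxx ?subr0. ring.
- rewrite nE nE1 !mulr0 !mulr1 !addr0 add0r ?eqxx ?subr0; ring.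
Qed.

Lemma uu_sl2 k g h : (k < n)%N ->
  uu k (g * sl2_emb n h)%g = h 0 0 * uu k g + h 1 0 * vv k g.
Proof.
have := sl2_col g h; move: (g * sl2_emb n h)%g => gh ghE kn.
apply: det_col0 => [i|i [[|j] jk] // _|i [[|j] jk] // _]; rewrite !mxE /=.
- by case: (ghE (idx i)).
- by case: (ghE (idx i)) => /(_ j) -> //; lia.
- by case: (ghE (idx i)) => /(_ j) -> //; lia.
Qed.

Lemma vv_sl2 k g h : (k < n)%N ->
  vv k (g * sl2_emb n h)%g = h 0 1 * uu k g + h 1 1 * vv k g.
Proof.
have := sl2_col g h; move: (g * sl2_emb n h)%g => gh ghE kn.
apply: det_col0 => [i|i [[|j] jk] // _|i [[|j] jk] // _]; rewrite !mxE /=.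
- by case: (ghE (idx i)).
- by case: (ghE (idx i)) => /(_ j) -> //; lia.
- by case: (ghE (idx i)) => /(_ j) -> //; lia.
Qed.

Lemma dl_sl2 k g h : (k < m)%N -> dl k (g * sl2_emb n h)%g = dl k g.
Proof.
have := sl2_col g h; move: (g * sl2_emb n h)%g => gh ghE km.
congr (\det _); apply/matrixP => i j; rewrite !mxE /=.
by case: (ghE (idx i)) => /(_ j) -> //; have := ltn_ord j; lia.
Qed.

End SL2Action.

Section Evaluation.
Variables (C : numFieldType) (m : nat).
Notation n := m.+1.
Implicit Types (g t x u : Sp C n) (k : nat) (a : 'cV[C]_(n + n)).
Notation idx := (ord_idx m).

Definition heis_coord a k : C := heis_vec a (idx k) 0.

Definition chart_pt a : Sp C n := (heis a * w_sp C m)%g.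

Lemma chart_pt_col a (i j : nat) : (j < n + n)%N -> chart_pt a (idx i) (idx j) = heis a (idx i) (idx (cyc m j)).
Proof. exact: w_cols. Qed.

Lemma idx_eq i j : (i < n + n)%N -> (j < n + n)%N -> (idx i == idx j) = (i == j).
Proof. by move=> iN jN; apply/eqP/eqP => [/idx_inj->|->]. Qed.

Lemma idx_rev j : (j < n + n)%N -> rev_ord (idx j) = idx (n + n - j.+1).
Proof. by move=> jN; apply: val_inj; rewrite /= !idxE //; lia. Qed.

Lemma lst_idx : lst m = idx (m + n).
Proof. by apply: val_inj; rewrite /= idxE; lia. Qed.

Lemma heis_top a i j : (i <= m)%N -> (j <= m)%N ->
  heis a (idx i) (idx j) = (i == j)%:R - (i == 0)%N%:R * heis_coord a (m + n - j).
Proof.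
move=> im jm; rewrite heisE lst_idx !idx_eq; try lia.
rewrite idx_rev; last by lia.
rewrite [(j == _)](_ : _ = false); last by lia.
rewrite mul0r add0r idxE; last by lia.
rewrite idxE /J_sign; last by lia.
rewrite ifF; last by lia.
rewrite mulrN1; congr (_ - _ * heis_vec _ (ord_idx _ _) _); lia.
Qed.

Lemma heis_last a i : (i <= m)%N ->
  heis a (idx i) (idx (m + n)) = heis_coord a i + (i == 0)%N%:R * heis_coord a 0.
Proof.
move=> im; rewrite heisE lst_idx !idx_eq; try lia.
rewrite idx_rev; last by lia.
rewrite [(i == _)](_ : _ = false); last by lia.
rewrite eqxx mul1r add0r idxE; last by lia.
rewrite (_ : (n + n - (m + n).+1)%N = 0%N); last by lia.
by rewrite idxE // J_sign0 mulr1.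
Qed.

Lemma uu_chart_pt a k : (k < n)%N -> uu k (chart_pt a) = 1.
Proof.
move=> kn; rewrite /uu /minor det_upper.
  rewrite big1 // => i _; have := ltn_ord i => ik.
  rewrite mxE chart_pt_col ?colu_lt ?cyc_colu ?heis_top ?eqxx; try lia.
  case: eqP => [->|_]; last by rewrite mul0r subr0.
  by rewrite /heis_coord subn0 -lst_idx heis_vec_max mulr0 subr0.
move=> i j ji; have := ltn_ord i => ik; rewrite mxE chart_pt_col ?colu_lt ?cyc_colu ?heis_top; try lia.
rewrite [_ == nat_of_ord j](_ : _ = false); last by lia.
by rewrite [_ == 0%N](_ : _ = false) ?mul0r ?subr0 //; lia.
Qed.

Lemma gm_chart_pt a k : (k < m)%N -> gm k (chart_pt a) = heis_coord a k.+1.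
Proof.
move=> km.
have gE (i j : nat) : (i <= k.+1)%N -> (j <= k.+1)%N ->
    chart_pt a (idx i) (idx (colg m k j)) = heis a (idx i) (idx (if (j <= k)%N then j else m + n)).
  move=> ik jk; rewrite chart_pt_col; last by rewrite /colg; do 2?case: ifP; lia.
  congr (heis a _ (ord_idx _ _)); rewrite /colg /cyc; do 6?case: ifP; lia.
rewrite /gm /minor det_upper.
  rewrite big_ord_recr big1 /=.
    by rewrite mxE gE // ltnn heis_last ?mul0r ?addr0 ?mul1r //; lia.
  move=> i _; have := ltn_ord i => ik; rewrite mxE gE /=; try lia.
  rewrite (_ : (i <= k)%N = true) ?heis_top ?eqxx; try lia.
  case: eqP => [->|_]; last by rewrite mul0r subr0.
  by rewrite /heis_coord subn0 -lst_idx heis_vec_max mulr0 subr0.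
move=> i j ji; have := ltn_ord i => ik; rewrite mxE gE; try lia.
rewrite (_ : (j <= k)%N = true) ?heis_top; try lia.
rewrite [_ == nat_of_ord j](_ : _ = false); last by lia.
by rewrite [_ == 0%N](_ : _ = false) ?mul0r ?subr0 //; lia.
Qed.

Lemma dl_chart_pt a k : (k < m)%N -> dl k (chart_pt a) = (-1) ^+ k.+1 * heis_coord a (m + m - k).
Proof.
move=> km; pose M := \matrix_(i < k.+1, j < k.+1) chart_pt a (idx i) (idx j).
have ME (i j : 'I_k.+1) : M i j = (i == j.+1 :> nat)%:R - (i == 0 :> nat)%:R * heis_coord a (m + m - j).
  have := ltn_ord i; have := ltn_ord j => jk ik; rewrite mxE chart_pt_col; last by lia.
  rewrite (_ : cyc m j = j.+1); last by rewrite /cyc ifT //; lia.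
  by rewrite heis_top; try lia; congr (_ - _ * heis_coord _ _); lia.
rewrite /dl -[minor _ _ _]/(\det M) (expand_det_col _ ord_max) (bigD1 ord0) //= big1 ?addr0.
  rewrite ME /= mul1r sub0r /cofactor /= add0n.
  have -> : row' ord0 (col' ord_max M) = 1%:M.
    apply/matrixP => i j; rewrite mxE mxE ME /= /bump leq0n add1n.
    have jk := ltn_ord j; rewrite (_ : (k <= j)%N = false) ?add0n; last by lia.
    by rewrite mul0r subr0 eqSS [RHS]mxE -val_eqE.
  by rewrite det1 mulr1 exprS; ring.
move=> i i0; rewrite ME /= (_ : (i == k.+1 :> nat) = false); last by have := ltn_ord i; lia.
by rewrite (_ : (i == 0 :> nat) = false) ?mul0r ?subr0 ?mul0r //; apply: negPf.
Qed.

Lemma vv_chart_pt a k : (k < n)%N ->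
  vv k (chart_pt a) = heis_coord a 0 + heis_coord a 0 + \sum_(s < k) heis_coord a (m + m - s) * heis_coord a s.+1.
Proof.
move=> kn.
pose al := \row_(s < k) (- heis_coord a (m + m - s)); pose be := \col_(s < k) heis_coord a s.+1.
have colv_lt j : (j < n)%N -> (colv m j < n + n)%N by case: j => /=; lia.
have -> : vv k (chart_pt a) = \det (block_mx (heis_coord a 0 + heis_coord a 0)%:M al be 1%:M : 'M_(1 + k)).
  congr (\det _); apply/matrixP => i j; rewrite [LHS]mxE [RHS]mxE.
  have := ltn_ord i; have := ltn_ord j => jk ik; rewrite chart_pt_col; last by apply: colv_lt; lia.
  case: splitP => i' ei; rewrite [RHS]mxE; case: splitP => j' ej;
    rewrite [RHS]mxE ?ord1 ei ej ?ord1 /=.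
  - rewrite (_ : cyc m n = m + n)%N; last by rewrite /cyc; do 3?case: ifP; lia.
    by rewrite heis_last // mul1r mulr1n.
  - have := ltn_ord j' => jk'.
    rewrite (_ : cyc m j' = j'.+1)%N; last by rewrite /cyc ifT //; lia.
    rewrite heis_top //; last by lia.
    by rewrite sub0r mul1r; congr (- heis_coord _ _); lia.
  - have := ltn_ord i' => ik'.
    rewrite (_ : cyc m n = m + n)%N; last by rewrite /cyc; do 3?case: ifP; lia.
    by rewrite heis_last ?mul0r ?addr0 //; lia.
  - have := ltn_ord i' => ik'; have := ltn_ord j' => jk'.
    rewrite (_ : cyc m j' = j'.+1)%N; last by rewrite /cyc ifT //; lia.
    by rewrite heis_top; try lia; rewrite mul0r subr0 !add1n eqSS -val_eqE.
rewrite det_bordered mxE -sumrN; congr (_ + _); apply: eq_bigr => s _.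
by rewrite !mxE mulNr opprK.
Qed.

End Evaluation.

(** * Weight spaces *)

Section WeightSpaces.
Variables (C : numFieldType) (m : nat).
Notation n := m.+1.
Implicit Types (g t x u s : Sp C n) (k : nat) (p q : bidegree n) (f : Sp C n -> C).
Notation idx := (ord_idx m).

Lemma lamE p (i : 'I_n) : nth 0%N (lam p) i = p (rshift n.-1 i).
Proof. by rewrite /lam (nth_map i) ?size_enum_ord // nth_ord_enum. Qed.

Lemma muE p (i : 'I_n.-1) : nth 0%N (mu p) i = p (lshift n i).
Proof. by rewrite /mu (nth_map i) ?size_enum_ord // nth_ord_enum. Qed.

Lemma size_lam p : size (lam p) = n.
Proof. by rewrite size_map size_enum_ord. Qed.

Lemma size_mu p : size (mu p) = m.
Proof. by rewrite size_map size_enum_ord. Qed.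

Lemma lam0E i : nth 0%N (lam (0%MM : bidegree n)) i = 0%N.
Proof.
have [iN|iN] := ltnP i n; last by rewrite nth_default ?size_lam.
by rewrite (lamE _ (Ordinal iN)) mnm0E.
Qed.

Lemma mu0E i : nth 0%N (mu (0%MM : bidegree n)) i = 0%N.
Proof.
have [iN|iN] := ltnP i m; last by rewrite nth_default ?size_mu.
by rewrite (muE _ (Ordinal iN : 'I_n.-1)) mnm0E.
Qed.

Lemma lamD p q i : nth 0%N (lam (p + q)%MM) i = (nth 0 (lam p) i + nth 0 (lam q) i)%N.
Proof.
have [iN|iN] := ltnP i n; last by rewrite !nth_default ?size_lam.
by rewrite !(lamE _ (Ordinal iN)) mnmDE.
Qed.

Lemma muD p q i : nth 0%N (mu (p + q)%MM) i = (nth 0 (mu p) i + nth 0 (mu q) i)%N.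
Proof.
have [iN|iN] := ltnP i m; last by rewrite !nth_default ?size_mu.
by rewrite !(muE _ (Ordinal iN : 'I_n.-1)) mnmDE.
Qed.

Lemma lamMn p k i : nth 0%N (lam (p *+ k)%MM) i = (nth 0 (lam p) i * k)%N.
Proof.
have [iN|iN] := ltnP i n; last by rewrite !nth_default ?size_lam.
by rewrite !(lamE _ (Ordinal iN)) mulmnE.
Qed.

Lemma muMn p k i : nth 0%N (mu (p *+ k)%MM) i = (nth 0 (mu p) i * k)%N.
Proof.
have [iN|iN] := ltnP i m; last by rewrite !nth_default ?size_mu.
by rewrite !(muE _ (Ordinal iN : 'I_n.-1)) mulmnE.
Qed.

Lemma bidegP p q : (forall i, (i < m)%N -> nth 0%N (mu p) i = nth 0%N (mu q) i) ->
  (forall i, (i < n)%N -> nth 0%N (lam p) i = nth 0%N (lam q) i) -> p = q.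
Proof.
move=> pqm pql; apply/mnmP => i; case: (splitP i) => j ij.
  rewrite (_ : i = lshift n j); last exact: val_inj.
  by rewrite -!muE; apply: pqm; apply: ltn_ord.
rewrite (_ : i = rshift n.-1 j); last exact: val_inj.
by rewrite -!lamE; apply: pql; apply: ltn_ord.
Qed.

Definition mkdeg (M L : nat -> nat) : bidegree n :=
  [multinom match fintype.split k with inl i => M i | inr i => L i end | k < n.-1 + n].

Lemma lam_mkdeg M L i : (i < n)%N -> nth 0%N (lam (mkdeg M L)) i = L i.
Proof.
move=> iN; rewrite (lamE _ (Ordinal iN)) mnmE.
by rewrite -[rshift _ _]/(unsplit (inr _)) unsplitK.
Qed.

Lemma mu_mkdeg M L i : (i < m)%N -> nth 0%N (mu (mkdeg M L)) i = M i.
Proof.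
move=> iN; rewrite (muE _ (Ordinal iN : 'I_n.-1)) mnmE.
by rewrite -[lshift _ _]/(unsplit (inl _)) unsplitK.
Qed.

Lemma char_lamD p q t : torus_char_lam (p + q)%MM t = torus_char_lam p t * torus_char_lam q t.
Proof. by rewrite /torus_char_lam -big_split; apply: eq_bigr => i _; rewrite lamD exprD. Qed.

Lemma char_muD p q t : torus_char_mu (p + q)%MM t = torus_char_mu p t * torus_char_mu q t.
Proof. by rewrite /torus_char_mu -big_split; apply: eq_bigr => i _; rewrite muD exprD. Qed.

Lemma W_mul p q f f' : W p f -> W q f' -> W (p + q)%MM (fun g => f g * f' g).
Proof.
move=> [[fr fi] fw] [[fr' fi'] fw']; split; first split.
- exact: regularM.
- by move=> *; rewrite fi ?fi'.
- by move=> t s g tT sT sP; rewrite fw ?fw' // char_lamD char_muD; ring.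
Qed.

Lemma W_one : W (0%MM : bidegree n) (fun _ : Sp C n => 1).
Proof.
split; first by split=> //; apply: regular_cst.
move=> t s g _ _ _; rewrite mulr1 /torus_char_lam /torus_char_mu.
by rewrite !big1 ?mulr1 // => i _; rewrite ?lam0E ?mu0E expr0.
Qed.

Lemma W_lin p f f' (c : C) : W p f -> W p f' -> W p (fun g => c * f g + f' g).
Proof.
move=> [[fr fi] fw] [[fr' fi'] fw']; split; first split.
- by apply: regularD => //; apply: regularM => //; apply: regular_cst.
- by move=> *; rewrite fi ?fi'.
- by move=> t s g tT sT sP; rewrite fw ?fw' //; ring.
Qed.

Lemma W_zero p : W p (fun _ : Sp C n => 0).
Proof.
split; first by split=> //; apply: regular_cst.
by move=> *; rewrite mulr0.
Qed.

Lemma W_scale p f (c : C) : W p f -> W p (fun g => c * f g).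
Proof.
move=> fW; rewrite (_ : (fun g => c * f g) = fun g => c * f g + 0).
  exact: W_lin (W_zero p).
by apply: funext => g; rewrite addr0.
Qed.

Lemma W_sum p (I : Type) (r : seq I) (P : pred I) (F : I -> Sp C n -> C) :
  (forall i, P i -> W p (F i)) -> W p (fun g => \sum_(i <- r | P i) F i g).
Proof.
move=> FW; elim: r => [|i r IH].
  by under [X in W p X]funext do rewrite big_nil; apply: W_zero.
case Pi: (P i); last first.
  rewrite (_ : (fun g => _) = fun g => \sum_(j <- r | P j) F j g) //.
  by apply: funext => g; rewrite big_cons Pi.
rewrite (_ : (fun g => _) = fun g => 1 * F i g + \sum_(j <- r | P j) F j g).
  by apply: W_lin => //; apply: FW.
by apply: funext => g; rewrite big_cons Pi mul1r.
Qed.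

Section Torus.
Variables (s : nat -> C) (sN : forall i, s i != 0).

Definition tor_diag : 'rV[C]_(n + n) :=
  \row_i (if (i < n)%N then s i else (s (rev_ord i))^-1).

Lemma tor_symp : is_symplectic (diag_mx tor_diag).
Proof.
apply: diag_symp => i; rewrite !mxE rev_ordK; have := lt_half i.
by case: (i < n)%N; case: (rev_ord i < n)%N => // _; rewrite ?mulVf ?mulfV.
Qed.

Definition tor : Sp C n := MkSp tor_symp.

Lemma tor_T : in_T tor.
Proof. exact: diag_mx_is_diag. Qed.

Lemma torE i : (i < n)%N -> tor (idx i) (idx i) = s i.
Proof. by move=> iN; rewrite !mxE eqxx mulr1n idxE ?iN //; lia. Qed.

Lemma tor_pred : s m = 1 -> in_Sp_pred tor.
Proof.
have tE (i j : 'I_(n + n)) : tor i j = tor_diag 0 i *+ (i == j) by rewrite mxE.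
have idE (i : 'I_(n + n)) (k : nat) : (k < n + n)%N -> (i == idx k) = (i == k :> nat).
  by move=> kn; rewrite -val_eqE /= idxE.
have dm : tor_diag 0 (idx m) = s m by rewrite mxE idxE ?ltnSn //; lia.
have dn : tor_diag 0 (idx n) = (s m)^-1.
  rewrite mxE idxE ?ltnn; last by lia.
  by congr (s _)^-1; rewrite /= idxE; lia.
move=> sm; apply/sp_pred_cols => i; rewrite !tE -!idE; try lia.
split; case: eqP => [->|_]; rewrite ?mulr0n // ?dm ?dn sm ?invr1 //.
Qed.

End Torus.

Lemma torus_diag t i j : in_T t -> i != j -> t i j = 0.
Proof. by move=> /is_diag_mxP; apply. Qed.

Lemma lidx (i : 'I_n) : lshift n i = idx i.
Proof. by apply: val_inj; rewrite /= idxE //; have := ltn_ord i; lia. Qed.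

Lemma char_lam_fund p t K : (K <= n)%N ->
  (forall i, (i < n)%N -> nth 0%N (lam p) i = (i < K)%N) ->
  torus_char_lam p t = \prod_(i < K) t (idx i) (idx i).
Proof.
move=> KN pE; rewrite /torus_char_lam (bigID (fun i : 'I_n => (i < K)%N)) /=.
rewrite [X in _ * X]big1 ?mulr1 => [|i /negPf iK]; last by rewrite pE // iK expr0.
rewrite (big_ord_narrow KN); apply: eq_bigr => i _.
by rewrite lidx /= pE ?(leq_trans (ltn_ord i)) // ltn_ord expr1.
Qed.

Lemma char_mu_fund p s K : (K <= m)%N ->
  (forall i, (i < m)%N -> nth 0%N (mu p) i = (i < K)%N) ->
  torus_char_mu p s = \prod_(i < K) s (idx i) (idx i).
Proof.
move=> KN pE; rewrite /torus_char_mu.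
have KN' : (K <= n)%N by lia.
rewrite (bigID (fun i : 'I_n => (i < K)%N)) /=.
rewrite [X in _ * X]big1 ?mulr1 => [|i /andP[im /negPf iK]]; last by rewrite pE // iK expr0.
rewrite (eq_bigl (fun i : 'I_n => (i < K)%N)) => [|i]; last by lia.
rewrite (big_ord_narrow KN'); apply: eq_bigr => i _.
rewrite lidx /= pE; last by have := ltn_ord i; lia.
by rewrite ltn_ord expr1.
Qed.

Definition two_at (k i : nat) : C := if i == k then 2%:R else 1.

Lemma two_at_neq0 k i : two_at k i != 0.
Proof. by rewrite /two_at; case: ifP => _; rewrite ?pnatr_eq0 ?oner_eq0. Qed.

Lemma char_lam_two p k : (k < n)%N ->
  torus_char_lam p (tor (two_at_neq0 k)) = 2%:R ^+ nth 0%N (lam p) k.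
Proof.
move=> kn; rewrite /torus_char_lam (bigD1 (Ordinal kn)) //= big1 ?mulr1 => [|i ik].
  by rewrite lidx (torE (two_at_neq0 k)) // /two_at /= eqxx.
by rewrite lidx (torE (two_at_neq0 k)) // /two_at ifF ?expr1n //; apply: negPf; rewrite -val_eqE in ik.
Qed.

Lemma char_mu_two p k : (k < m)%N ->
  torus_char_mu p (tor (two_at_neq0 k)) = 2%:R ^+ nth 0%N (mu p) k.
Proof.
move=> km; have kn : (k < n)%N by lia.
rewrite /torus_char_mu (bigD1 (Ordinal kn)) //= big1 ?mulr1 => [|i /andP[_ ik]].
  by rewrite lidx (torE (two_at_neq0 k)) // /two_at /= eqxx.
by rewrite lidx (torE (two_at_neq0 k)) // /two_at ifF ?expr1n //; apply: negPf; rewrite -val_eqE in ik.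
Qed.

Lemma char_lam1 p : torus_char_lam p (1%g : Sp C n) = 1.
Proof. by rewrite /torus_char_lam big1 // => i _; rewrite mxE eqxx expr1n. Qed.

Lemma char_mu1 p : torus_char_mu p (1%g : Sp C n) = 1.
Proof. by rewrite /torus_char_mu big1 // => i _; rewrite mxE eqxx expr1n. Qed.

Lemma one_T : in_T (1%g : Sp C n).
Proof. by apply/is_diag_mxP => i j ij; rewrite mxE -val_eqE /= (negPf ij). Qed.

Lemma one_pred : in_Sp_pred (1%g : Sp C n).
Proof. by move=> i _; rewrite /= !mul1mx. Qed.

(** The torus elements with a single eigenvalue 2 already separate the
    characters, so independence of weights applies. *)
Lemma W_indep (ps : seq (bidegree n)) (F : bidegree n -> Sp C n -> C) :
  uniq ps -> (forall p, p \in ps -> W p (F p)) ->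
  (forall g, \sum_(p <- ps) F p g = 0) ->
  forall p, p \in ps -> forall g, F p g = 0.
Proof.
move=> ups FW F0.
pose T (k : 'I_(n.-1 + n)) (g : Sp C n) : Sp C n :=
  match fintype.split k with
  | inl i => (1 * g * tor (two_at_neq0 i))%g
  | inr i => (tor (two_at_neq0 i) * g * 1)%g
  end.
apply: (@weight_indep C _ _ T ps F) => // p pps k g.
have [_ Fw] := FW p pps; rewrite /T; case: splitP => i ki.
  rewrite Fw; [|exact: one_T|exact: tor_T|]; last first.
    by apply: tor_pred; rewrite /two_at ifF //; have := ltn_ord i; rewrite /=; lia.
  rewrite char_lam1 mul1r char_mu_two; last by have := ltn_ord i.
  by rewrite muE (_ : k = lshift n i) //; apply: val_inj.
rewrite Fw; [|exact: tor_T|exact: one_T|exact: one_pred].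
rewrite char_mu1 mulr1 char_lam_two; last by have := ltn_ord i.
by rewrite lamE (_ : k = rshift n.-1 i) //; apply: val_inj.
Qed.

End WeightSpaces.

(** * Weights of the minors, density of the chart, Pluecker relations *)

Section Generators.
Variables (C : numFieldType) (m : nat).
Notation n := m.+1.
Implicit Types (g t x u b s : Sp C n) (k : nat) (p q : bidegree n) (f : Sp C n -> C).
Notation idx := (ord_idx m).

Definition deg_u k : bidegree n := mkdeg m (fun i => (i < k)%N) (fun i => (i < k.+1)%N).
Definition deg_d k : bidegree n := mkdeg m (fun i => (i < k.+1)%N) (fun i => (i < k.+1)%N).
Definition deg_g k : bidegree n := mkdeg m (fun i => (i < k)%N) (fun i => (i < k.+2)%N).

Lemma pred_col b : in_Sp_pred b -> forall i : 'I_(n + n),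
  b i (idx m) = (i == idx m)%:R /\ b i (idx n) = (i == idx n)%:R.
Proof.
move=> /sp_pred_cols bP i; have [-> ->] := bP i.
by rewrite -!val_eqE /= !idxE //; lia.
Qed.

Lemma W_minor K K' c M L : (K <= n)%N -> (K' <= m)%N ->
  (forall i, L i = (i < K)%N) -> (forall i, M i = (i < K')%N) ->
  (forall b g : Sp C n, (forall i j : 'I_(n + n), (j < i)%N -> b i j = 0) ->
    (forall i : 'I_(n + n), b i (idx m) = (i == idx m)%:R) ->
    (forall i : 'I_(n + n), b i (idx n) = (i == idx n)%:R) ->
    minor K c (g * b)%g = minor K c g * \prod_(i < K') b (idx i) (idx i)) ->
  W (mkdeg m M L) (@minor C m K c).
Proof.
move=> KN KN' LE ME Hb; have KNN : (K <= n + n)%N by lia.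
split; first split.
- exact: regular_minor.
- move=> ub u g [ub1 ub0] [u1 u0] uP; rewrite Hb // => [|i|i]; try by case: (pred_col uP i).
  rewrite minor_mull //.
  have -> : \prod_(i < K) ub (idx i) (idx i) = 1 by rewrite big1.
  have -> : \prod_(i < K') u (idx i) (idx i) = 1 by rewrite big1.
  by rewrite mul1r mulr1.
move=> t s g tT sT sP; rewrite Hb => [|i j ji|i|i]; last first.
- by case: (pred_col sP i).
- by case: (pred_col sP i).
- by rewrite torus_diag //; apply: contraTneq ji => ->; rewrite ltnn.
rewrite minor_mull // => [|i j ij]; last first.
  by rewrite torus_diag //; apply: contraTneq ij => ->; rewrite ltnn.
rewrite (@char_lam_fund _ _ _ _ K) // => [|i iN]; last by rewrite lam_mkdeg // LE.
rewrite (@char_mu_fund _ _ _ _ K') // => [|i iN]; last by rewrite mu_mkdeg // ME.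
by rewrite mulrAC mulrC mulrA mulrC mulrA.
Qed.

Lemma uuW k : (k < n)%N -> W (deg_u k) (@uu C m k).
Proof. by move=> kn; apply: (@W_minor _ k) => // b g b0 bm bn; apply: uu_borel. Qed.

Lemma vvW k : (k < n)%N -> W (deg_u k) (@vv C m k).
Proof. by move=> kn; apply: (@W_minor _ k) => // b g b0 bm bn; apply: vv_borel. Qed.

Lemma dlW k : (k < m)%N -> W (deg_d k) (@dl C m k).
Proof. by move=> kn; apply: (@W_minor _ k.+1) => //; [lia|move=> b g b0 bm bn; apply: dl_borel]. Qed.

Lemma gmW k : (k < m)%N -> W (deg_g k) (@gm C m k).
Proof. by move=> kn; apply: (@W_minor _ k) => //; [lia|move=> b g b0 bm bn; apply: gm_borel]. Qed.

Lemma minor_cancel k (c : nat -> nat) f : (k <= n + n)%N ->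
  (forall i, (i < k)%N -> (c i < n + n)%N) ->
  (forall i j, (i < k)%N -> (j < k)%N -> c i = c j -> i = j) ->
  regular f -> (forall g, minor k c g * f g = 0) -> forall g, f g = 0.
Proof.
move=> kn cn cI fr f0.
apply: (@density_minor C n k (fun i => idx i) (fun j => idx (c j))) => //.
- move=> i j /idx_inj E; apply: val_inj; apply: E.
    exact: leq_trans (ltn_ord _) kn.
  exact: leq_trans (ltn_ord _) kn.
- move=> i j /idx_inj E; apply: val_inj; apply: cI => //=.
  by apply: E; apply: (cn _ (ltn_ord _)).
move=> g g0; have /eqP := f0 g; rewrite mulf_eq0 => /orP[/eqP E|/eqP//].
move: g0; rewrite (_ : mxsub _ _ _ = \matrix_(i, j) g (idx i) (idx (c j))).
  by rewrite -/(minor k c g) E eqxx.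
by apply/matrixP => i j; rewrite !mxE.
Qed.

Lemma uu_cancel k f : (k < n)%N -> regular f -> (forall g, uu k g * f g = 0) ->
  forall g, f g = 0.
Proof.
move=> kn; apply: minor_cancel => [|i ik|i j ik jk]; first lia.
  by apply: colu_lt; lia.
by case: i j ik jk => [|i] [|j] /=; lia.
Qed.

Lemma dl_cancel k f : (k < m)%N -> regular f -> (forall g, dl k g * f g = 0) ->
  forall g, f g = 0.
Proof. by move=> kn; apply: minor_cancel => [|i ik|//]; lia. Qed.

(** The functions [uu k] are removed one after the other: at each step the
    product of the first ones with [f] is killed by the next one. *)
Lemma uu_density f : regular f ->
  (forall g, (forall k, (k < n)%N -> uu k g != 0) -> f g = 0) -> forall g, f g = 0.
Proof.
move=> fr f0.
suff H K : (K <= n)%N -> forall g, (forall k, (k < K)%N -> uu k g != 0) -> f g = 0.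
  by move=> g; apply: (H 0%N).
have [d Kd] : exists d, (n - K <= d)%N by exists n; lia.
elim: d K Kd => [|d IH] K Kd KN g gK.
  by apply: f0 => k kn; apply: gK; lia.
have [Kn|Kn] := ltnP K n; last by apply: f0 => k kn; apply: gK; lia.
pose F g := \prod_(k < K) uu k g * f g.
suff F0 : F g = 0.
  move: F0; rewrite /F => /eqP; rewrite mulf_eq0 => /orP[|/eqP//].
  by rewrite prodf_seq_eq0 => /hasP[k _ /andP[_ E]]; have := gK k (ltn_ord k); rewrite E.
have Fr : regular F.
  apply: regularM => //; apply: regular_prod => k; exact: regular_minor.
apply: (@uu_cancel K) => // {gK}g; rewrite /F.
have [/forallP gK|/forallPn[k]] := boolP [forall k : 'I_K.+1, uu k g != 0].
  rewrite (IH K.+1) ?mulr0 //; first by lia.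
  by move=> k kK; apply: (gK (Ordinal kK)).
rewrite negbK => /eqP uk; have := ltn_ord k; rewrite ltnS leq_eqVlt => /orP[/eqP kK|kK].
  by rewrite -[K in uu K]kK uk mul0r.
by rewrite (bigD1 (Ordinal kK)) //= uk !mul0r mulr0.
Qed.

Lemma one_U : in_U (1%g : Sp C n).
Proof. by split=> [i|i j ij]; rewrite mxE ?eqxx // -val_eqE /= gtn_eqF. Qed.

Lemma one_Ubar : in_Ubar (1%g : Sp C n).
Proof. by split=> [i|i j ij]; rewrite mxE ?eqxx // -val_eqE /= ltn_eqF. Qed.

Lemma W_torus p f t g : W p f -> in_T t -> f (t * g)%g = torus_char_lam p t * f g.
Proof.
move=> [_ fw] tT; have := fw t 1%g g tT (@one_T C m) (@one_pred C m).
by rewrite mulg1 char_mu1 mulr1.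
Qed.

Lemma chart_point g : (forall k, (k < n)%N -> uu k g != 0) ->
  exists t a, in_T t /\
    forall p f, W p f -> f g = torus_char_lam p t * f (chart_pt a).
Proof.
move=> /chart_decomposition[l [t [a [u [lU tT [uU uP] E]]]]].
exists t, a; split=> // p f fW; have [[_ fi] _] := fW.
have {}E : (l * g = t * chart_pt a * u)%g := E.
rewrite -(W_torus _ fW tT) -(fi 1%g u (t * chart_pt a)%g one_Ubar uU uP) mul1g -E.
by rewrite -(fi l 1%g g lU one_U (@one_pred C m)) mulg1.
Qed.

Lemma W_eq0 p f : W p f -> (forall a, f (chart_pt a) = 0) -> forall g, f g = 0.
Proof.
move=> fW f0; have [[fr _] _] := fW; apply: uu_density => // g /chart_point[t [a [_ gE]]].
by rewrite (gE p f fW) f0 mulr0.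
Qed.

Lemma deg_rel k : (deg_u k + deg_u k.+1 = deg_d k + deg_g k)%MM.
Proof.
apply: bidegP => i iN; rewrite ?muD ?lamD ?mu_mkdeg ?lam_mkdeg //.
by rewrite addnC.
Qed.

(** Both sides have the same weight, so the identity may be checked on the chart,
    where [uu k] is 1 and consecutive [vv k] differ, up to sign, by the product
    of [dl k] and [gm k]. *)
Lemma plucker k g : (k < m)%N ->
  uu k g * vv k.+1 g = uu k.+1 g * vv k g + (-1) ^+ k.+1 * (dl k g * gm k g).
Proof.
move=> km; have kn : (k < n)%N by lia.
have km1 : (k.+1 < n)%N by [].
pose F g := -1 * (uu k g * vv k.+1 g) +
  (uu k.+1 g * vv k g + (-1) ^+ k.+1 * (dl k g * gm k g)).
have FW : W (deg_u k + deg_u k.+1)%MM F.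
  apply: W_lin; first exact: W_mul (uuW kn) (vvW km1).
  rewrite (_ : (fun g => _) = fun g => 1 * (uu k.+1 g * vv k g) +
    (-1) ^+ k.+1 * (dl k g * gm k g)); last by apply: funext => x; rewrite mul1r.
  apply: W_lin; first by rewrite addmC; exact: W_mul (uuW km1) (vvW kn).
  by apply: W_scale; rewrite deg_rel; apply: W_mul (dlW km) (gmW km).
have F0 a : F (chart_pt a) = 0.
  rewrite /F !uu_chart_pt // !vv_chart_pt // dl_chart_pt // gm_chart_pt // big_ord_recr /= !mul1r mulN1r.
  by rewrite !mulrA -exprMn mulrNN mulr1 expr1n mul1r; ring.
have /eqP := W_eq0 FW F0 g.
by rewrite /F mulN1r addrC subr_eq0 => /eqP <-.
Qed.

(** By the Pluecker relation [dl k * gm k] is, up to sign, a two-by-two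
    determinant in the [uu] and [vv], hence invariant; [dl k] is invariant and
    cancels. *)
Lemma gm_sl2 k g (h : SL2 C) : (k < m)%N -> gm k (g * sl2_emb n h)%g = gm k g.
Proof.
move=> km; have kn : (k < n)%N by lia.
apply/eqP; rewrite -subr_eq0 -mulN1r addrC; apply/eqP.
move: g; apply: (@dl_cancel k) => //.
  apply: regularD.
    by apply: regularM; [apply: regular_cst|apply: regular_minor].
  exact: (regular_rtrans _ (@regular_minor C m k.+2 (colg m k))).
move=> g; have dh : h 0 0 * h 1 1 - h 0 1 * h 1 0 = 1.
  by have /eqP := sl2_mxP h; rewrite det2.
have := plucker (g * sl2_emb n h)%g km.
rewrite !uu_sl2 // !vv_sl2 // dl_sl2 //; move: (gm k (g * sl2_emb n h)%g) => X E1.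
have E2 := plucker g km.
have sN : (-1) ^+ k.+1 != 0 :> C by rewrite signr_eq0.
apply: (mulfI sN); rewrite mulr0.
have -> : (-1) ^+ k.+1 * (dl k g * (-1 * gm k g + X)) =
    (-1) ^+ k.+1 * (dl k g * X) - (-1) ^+ k.+1 * (dl k g * gm k g) by ring.
have -> : (-1) ^+ k.+1 * (dl k g * X) =
    (uu k g * vv k.+1 g - uu k.+1 g * vv k g) * (h 0 0 * h 1 1 - h 0 1 * h 1 0).
  apply: (addrI ((h 0 0 * uu k.+1 g + h 1 0 * vv k.+1 g) *
    (h 0 1 * uu k g + h 1 1 * vv k g))); rewrite -E1; ring.
by rewrite dh E2; ring.
Qed.

End Generators.

(** * Polynomials in weight vectors *)

Section Monomials.
Variables (C : numFieldType) (m : nat).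
Notation n := m.+1.
Implicit Types (g : Sp C n) (p q : bidegree n) (f : Sp C n -> C).

Lemma W_exp p f e : W p f -> W (p *+ e)%MM (fun g => f g ^+ e).
Proof.
move=> fW; elim: e => [|e IH].
  by rewrite mulm0n; under [X in W _ X]funext do rewrite expr0; apply: W_one.
by rewrite mulmS; under [X in W _ X]funext do rewrite exprS; apply: W_mul.
Qed.

Lemma W_prod (I : Type) (r : seq I) (pp : I -> bidegree n) (ff : I -> Sp C n -> C) :
  (forall i, W (pp i) (ff i)) ->
  W (\big[+%MM/0%MM]_(i <- r) pp i) (fun g => \prod_(i <- r) ff i g).
Proof.
move=> HW; elim: r => [|i r IH].
  by rewrite big_nil; under [X in W _ X]funext do rewrite big_nil; apply: W_one.
by rewrite big_cons; under [X in W _ X]funext do rewrite big_cons; apply: W_mul.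
Qed.

Variables (K : nat) (fg : 'I_K -> Sp C n -> C) (fd : 'I_K -> bidegree n).
Hypothesis fgW : forall k, W (fd k) (fg k).

Definition degm (e : 'X_{1..K}) : bidegree n := \big[+%MM/0%MM]_(k < K) (fd k *+ e k)%MM.

Definition evg (P : {mpoly C[K]}) g : C := P.@[fun k => fg k g].

Lemma mono_W e : W (degm e) (evg 'X_[e]).
Proof.
rewrite (_ : evg 'X_[e] = fun g => \prod_(k < K) fg k g ^+ e k).
  by apply: W_prod => k; apply: W_exp.
by apply: funext => g; rewrite /evg mevalX.
Qed.

Lemma evg_regular P : regular (evg P).
Proof.
elim/mpolyind: P => [|c e P _ _ IH].
  by rewrite /evg; under [X in regular X]funext do rewrite meval0; apply: regular_cst.
rewrite (_ : evg _ = fun g => c * evg 'X_[e] g + evg P g).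
  apply: regularD => //; apply: regularM; first exact: regular_cst.
  by have [[]] := mono_W e.
by apply: funext => g; rewrite /evg mevalD mevalZ.
Qed.

Lemma mu_degm e i : nth 0%N (mu (degm e)) i = (\sum_(k < K) nth 0 (mu (fd k)) i * e k)%N.
Proof.
rewrite /degm; elim: (index_enum _) => [|k r IH]; first by rewrite !big_nil mu0E.
by rewrite !big_cons muD IH muMn.
Qed.

Lemma lam_degm e i : nth 0%N (lam (degm e)) i = (\sum_(k < K) nth 0 (lam (fd k)) i * e k)%N.
Proof.
rewrite /degm; elim: (index_enum _) => [|k r IH]; first by rewrite !big_nil lam0E.
by rewrite !big_cons lamD IH lamMn.
Qed.

Definition part p (P : {mpoly C[K]}) : {mpoly C[K]} :=
  \sum_(e <- msupp P | degm e == p) P@_e *: 'X_[e].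

Lemma evg_sum (I : Type) (r : seq I) (Q : pred I) (F : I -> {mpoly C[K]}) g :
  evg (\sum_(i <- r | Q i) F i) g = \sum_(i <- r | Q i) evg (F i) g.
Proof. exact: (raddf_sum (meval (fun k => fg k g))). Qed.

Lemma part_W p P : W p (evg (part p P)).
Proof.
rewrite (_ : evg _ = fun g => \sum_(e <- msupp P | degm e == p) evg (P@_e *: 'X_[e]) g).
  apply: W_sum => e /eqP <-.
  rewrite (_ : evg _ = fun g => P@_e * evg 'X_[e] g); first exact: W_scale (mono_W e).
  by apply: funext => g; rewrite /evg mevalZ.
by apply: funext => g; rewrite /part evg_sum.
Qed.

Lemma evg_parts P g : evg P g =
  \sum_(p <- undup [seq degm e | e <- msupp P]) evg (part p P) g.
Proof.
rewrite [in LHS](mpolyE P) evg_sum; under [RHS]eq_bigr do rewrite /part evg_sum.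
rewrite (exchange_big_dep xpredT) //=; rewrite big_seq [RHS]big_seq.
apply: eq_bigr => e eP; rewrite -big_filter.
rewrite (_ : [seq p <- _ | degm e == p] = [:: degm e]) ?big_seq1 //.
rewrite (eq_filter (a2 := pred1 (degm e))) => [|p]; last by rewrite /= eq_sym.
by rewrite filter_pred1_uniq ?undup_uniq // mem_undup; apply: map_f.
Qed.

(** Comparing components of all weights: by independence, those of weights other
    than [p] contribute zero. *)
Lemma evg_part p P f : W p f -> (forall g, evg P g = f g) ->
  forall g, evg (part p P) g = f g.
Proof.
move=> fW Pf g; apply/eqP; rewrite -subr_eq0; apply/eqP.
set ps := undup (p :: [seq degm e | e <- msupp P]).
pose F q g := evg (part q P) g - (if q == p then f g else 0).
have part0 q : q \notin [seq degm e | e <- msupp P] -> part q P = 0.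
  move=> qP; rewrite /part big_seq_cond big1 // => e /andP[eP /eqP E].
  by move: qP; rewrite -E map_f.
have ppu : p \in ps by rewrite mem_undup mem_head.
have := @W_indep C m ps F (undup_uniq _) _ _ p ppu g.
rewrite /F eqxx; apply => [q _|{}g].
  rewrite (_ : (fun g => _) = fun g => -1 * (if q == p then f g else 0) + evg (part q P) g).
    apply: W_lin; last exact: part_W.
    by case: eqP => [->|_]; [exact: fW|exact: W_zero].
  by apply: funext => x; rewrite mulN1r addrC.
rewrite sumrB [X in _ - X](_ : _ = f g); last first.
  rewrite (bigD1_seq p) ?undup_uniq //= eqxx big1 ?addr0 // => q /negPf ->.
  by [].
apply/eqP; rewrite subr_eq0 -Pf evg_parts; apply/eqP.
rewrite /ps /=; case: ifP => // /negbT pP.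
by rewrite big_cons part0 // /evg meval0 add0r.
Qed.

End Monomials.

(** * Weight vectors are polynomials in the minors after localization *)

Section Localization.
Variables (C : numFieldType) (m : nat).
Notation n := m.+1.
Implicit Types (g : Sp C n) (p q : bidegree n) (f : Sp C n -> C).
Notation idx := (ord_idx m).

Definition fgen (k : 'I_((n + n) + (m + m))) : Sp C n -> C :=
  match fintype.split k with
  | inl k1 => match fintype.split k1 with inl i => uu i | inr i => vv i end
  | inr k2 => match fintype.split k2 with inl i => dl i | inr i => gm i end
  end.

Definition fdeg (k : 'I_((n + n) + (m + m))) : bidegree n :=
  match fintype.split k with
  | inl k1 => match fintype.split k1 with inl i => deg_u m i | inr i => deg_u m i end
  | inr k2 => match fintype.split k2 with inl i => deg_d m i | inr i => deg_g m i end
  end.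

Lemma fgenW k : W (fdeg k) (fgen k).
Proof.
rewrite /fdeg /fgen; case: (fintype.split k) => k'; case: (fintype.split k') => i.
- exact: uuW (ltn_ord i).
- exact: vvW (ltn_ord i).
- exact: dlW (ltn_ord i).
- exact: gmW (ltn_ord i).
Qed.

Notation ku i := (lshift (m + m) (lshift n i)).
Notation kv i := (lshift (m + m) (rshift n i)).
Notation kd i := (rshift (n + n) (lshift m i)).
Notation kg i := (rshift (n + n) (rshift m i)).

Lemma fgen_u (i : 'I_n) : fgen (ku i) = uu i.
Proof. by rewrite /fgen -[lshift _ (lshift _ _)]/(unsplit (inl (unsplit (inl _)))) !unsplitK. Qed.
Lemma fgen_v (i : 'I_n) : fgen (kv i) = vv i.
Proof. by rewrite /fgen -[lshift _ (rshift _ _)]/(unsplit (inl (unsplit (inr _)))) !unsplitK. Qed.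
Lemma fgen_d (i : 'I_m) : fgen (kd i) = dl i.
Proof. by rewrite /fgen -[rshift _ (lshift _ _)]/(unsplit (inr (unsplit (inl _)))) !unsplitK. Qed.
Lemma fgen_g (i : 'I_m) : fgen (kg i) = gm i.
Proof. by rewrite /fgen -[rshift _ (rshift _ _)]/(unsplit (inr (unsplit (inr _)))) !unsplitK. Qed.

Lemma fdeg_u (i : 'I_n) : fdeg (ku i) = deg_u m i.
Proof. by rewrite /fdeg -[lshift _ (lshift _ _)]/(unsplit (inl (unsplit (inl _)))) !unsplitK. Qed.
Lemma fdeg_v (i : 'I_n) : fdeg (kv i) = deg_u m i.
Proof. by rewrite /fdeg -[lshift _ (rshift _ _)]/(unsplit (inl (unsplit (inr _)))) !unsplitK. Qed.
Lemma fdeg_d (i : 'I_m) : fdeg (kd i) = deg_d m i.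
Proof. by rewrite /fdeg -[rshift _ (lshift _ _)]/(unsplit (inr (unsplit (inl _)))) !unsplitK. Qed.
Lemma fdeg_g (i : 'I_m) : fdeg (kg i) = deg_g m i.
Proof. by rewrite /fdeg -[rshift _ (rshift _ _)]/(unsplit (inr (unsplit (inr _)))) !unsplitK. Qed.

Definition chart g : Prop := forall k, (k < n)%N -> uu k g != 0.
Definition UU g : C := \prod_(k < n) uu k g.

(** The functions that lie, on the chart, in the localization of the ring
    generated by the minors; the exponent of the denominator is quantified
    inside so that the class is closed under ring operations. *)
Definition localized (F : Sp C n -> C) : Prop :=
  exists N (P : {mpoly C[(n + n) + (m + m)]}),
    forall g, chart g -> F g * UU g ^+ N = evg fgen P g.

Lemma localized_cst (c : C) : localized (fun=> c).
Proof. by exists 0%N, c%:MP => g _; rewrite expr0 mulr1 /evg mevalC. Qed.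

Lemma UU_evg : exists P, forall g, UU g = evg fgen P g.
Proof.
exists (\prod_(i < n) 'X_(ku i)) => g; rewrite /evg rmorph_prod; apply: eq_bigr => i _.
by rewrite /= mevalXU fgen_u.
Qed.

Lemma localizedD F G : localized F -> localized G -> localized (fun g => F g + G g).
Proof.
move=> [N [P HP]] [M [Q HQ]]; have [D HD] := UU_evg.
exists (N + M)%N, (P * D ^+ M + Q * D ^+ N) => g gc.
rewrite /evg mevalD !mevalM !rmorphXn /= -!/(evg fgen _ g) -HP // -HQ // -HD exprD; ring.
Qed.

Lemma localizedM F G : localized F -> localized G -> localized (fun g => F g * G g).
Proof.
move=> [N [P HP]] [M [Q HQ]].
exists (N + M)%N, (P * Q) => g gc.
by rewrite /evg mevalM -!/(evg fgen _ g) -HP // -HQ // exprD; ring.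
Qed.

Lemma localizedX F e : localized F -> localized (fun g => F g ^+ e).
Proof.
move=> LF; elim: e => [|e IH].
  by under [X in localized X]funext do rewrite expr0; apply: localized_cst.
by under [X in localized X]funext do rewrite exprS; apply: localizedM.
Qed.

Lemma localized_prod (I : Type) (r : seq I) (F : I -> Sp C n -> C) :
  (forall i, localized (F i)) -> localized (fun g => \prod_(i <- r) F i g).
Proof.
move=> HF; elim: r => [|i r IH].
  by under [X in localized X]funext do rewrite big_nil; apply: localized_cst.
by under [X in localized X]funext do rewrite big_cons; apply: localizedM.
Qed.

Lemma localized_gen k : localized (fgen k).
Proof. by exists 0%N, 'X_k => g _; rewrite expr0 mulr1 /evg mevalXU. Qed.

Lemma localized_uu k : (k < n)%N -> localized (uu k).
Proof. by move=> kn; have := localized_gen (ku (Ordinal kn)); rewrite fgen_u. Qed.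
Lemma localized_vv k : (k < n)%N -> localized (vv k).
Proof. by move=> kn; have := localized_gen (kv (Ordinal kn)); rewrite fgen_v. Qed.
Lemma localized_dl k : (k < m)%N -> localized (dl k).
Proof. by move=> kn; have := localized_gen (kd (Ordinal kn)); rewrite fgen_d. Qed.
Lemma localized_gm k : (k < m)%N -> localized (gm k).
Proof. by move=> kn; have := localized_gen (kg (Ordinal kn)); rewrite fgen_g. Qed.

Lemma localized_inv k : (k < n)%N -> localized (fun g => (uu k g)^-1).
Proof.
move=> kn; exists 1%N, (\prod_(i < n | i != Ordinal kn) 'X_(ku i)) => g gc.
rewrite expr1 /UU (bigD1 (Ordinal kn)) //= mulrA mulVf ?mul1r ?gc //.
by rewrite /evg rmorph_prod; apply: eq_bigr => i _; rewrite /= mevalXU fgen_u.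
Qed.

(** The coordinates of a point of the chart, expressed by the generators: the
    diagonal of its torus part, then the vector of its Heisenberg part. *)
Definition tcoord (i : nat) g : C := if i is i'.+1 then uu i g / uu i' g else uu 0 g.

Definition acoord (j : nat) g : C :=
  if j == 0%N then vv 0 g / uu 0 g / 2%:R
  else if (j <= m)%N then gm j.-1 g / uu j g
  else if (j <= m + m)%N then (-1) ^+ (m + m - j).+1 * (dl (m + m - j) g / uu (m + m - j) g)
  else 0.

Definition Hpoint g : Sp C n := chart_pt (\col_i acoord i g).

Lemma localized_tcoord i : (i < n)%N -> localized (tcoord i).
Proof.
case: i => [|i] iN; first exact: localized_uu.
apply: localizedM; first exact: localized_uu.
by apply: localized_inv; lia.
Qed.

Lemma localized_acoord j : localized (acoord j).
Proof.
rewrite /acoord; case: eqP => [_|j0].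
  apply: localizedM; last exact: localized_cst.
  by apply: localizedM; [apply: localized_vv|apply: localized_inv].
case: (leqP j m) => jm.
  by apply: localizedM; [apply: localized_gm|apply: localized_inv]; lia.
case: (leqP j (m + m)) => jm'; last exact: localized_cst.
apply: localizedM; first exact: localized_cst.
by apply: localizedM; [apply: localized_dl|apply: localized_inv]; lia.
Qed.

Lemma localized_heis_vec (i : 'I_(n + n)) :
  localized (fun g => heis_vec (\col_i acoord i g) i 0).
Proof.
have [->|il] := eqVneq i (lst m).
  under [X in localized X]funext do rewrite heis_vec_max; exact: localized_cst.
rewrite (_ : (fun g => _) = acoord i); first exact: localized_acoord.
by apply: funext => g; rewrite !mxE (negPf il).
Qed.

Lemma localized_Hpoint f : regular f -> localized (fun g => f (Hpoint g)).
Proof.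
move=> fr; apply: (@regular_ind C n _ Hpoint localized f _ _ _ _ fr).
- exact: localized_cst.
- exact: localizedD.
- exact: localizedM.
move=> i j; rewrite (_ : (fun g => _) = fun g => heis (\col_i acoord i g) i (idx (cyc m j))).
  under [X in localized X]funext do rewrite heisE.
  apply: localizedD; first exact: localized_cst.
  apply: localizedM; last exact: localized_cst.
  apply: localizedD; apply: localizedM; try exact: localized_cst; exact: localized_heis_vec.
by apply: funext => g; rewrite /Hpoint /chart_pt -{1}(idx_val j) w_cols.
Qed.

Lemma chart_pt_eq (a b : 'cV[C]_(n + n)) : (forall k, (k <= m + m)%N -> heis_coord a k = heis_coord b k) -> chart_pt a = chart_pt b.
Proof.
move=> ab; suff E : heis_vec a = heis_vec b.
  by rewrite /chart_pt; congr (_ * _)%g; apply: val_inj; rewrite /= E.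
apply/colP => i; have [->|il] := eqVneq i (lst m); first by rewrite !heis_vec_max.
rewrite -(idx_val i); apply: ab.
by move: il; rewrite -val_eqE /=; have := ltn_ord i; lia.
Qed.

(** The torus part and the chart coordinates of [g] are recovered from the values
    of the minors, since these are weight vectors with known values on the
    chart. *)
Lemma chart_eval g : chart g -> forall p f, W p f ->
  f g = \prod_(i < n) tcoord i g ^+ nth 0%N (lam p) i * f (Hpoint g).
Proof.
move=> gc; have [t [a [tT E]]] := chart_point gc.
have uE k : (k < n)%N -> uu k g = \prod_(i < k.+1) t (idx i) (idx i).
  move=> kn; rewrite (E _ _ (uuW C kn)) uu_chart_pt // mulr1 (@char_lam_fund _ _ _ _ k.+1) //.
  by move=> i iN; rewrite lam_mkdeg.
have dE k : (k < m)%N -> dl k g = uu k g * dl k (chart_pt a).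
  move=> kn; rewrite (E _ _ (dlW C kn)) (@char_lam_fund _ _ _ _ k.+1) ?uE //; try lia.
  by move=> i iN; rewrite lam_mkdeg.
have gE k : (k < m)%N -> gm k g = uu k.+1 g * gm k (chart_pt a).
  move=> kn; rewrite (E _ _ (gmW C kn)) (@char_lam_fund _ _ _ _ k.+2) ?uE //; try lia.
  by move=> i iN; rewrite lam_mkdeg.
have vE k : (k < n)%N -> vv k g = uu k g * vv k (chart_pt a).
  move=> kn; rewrite (E _ _ (vvW C kn)) (@char_lam_fund _ _ _ _ k.+1) ?uE //.
  by move=> i iN; rewrite lam_mkdeg.
have tE i : (i < n)%N -> tcoord i g = t (idx i) (idx i).
  case: i => [|i] iN; rewrite /tcoord; first by rewrite uE // big_ord1.
  have ui : uu i g != 0 by apply: gc; lia.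
  rewrite uE // big_ord_recr /= -uE; last by lia.
  by rewrite mulrC mulKf.
have HE : Hpoint g = chart_pt a.
  apply: chart_pt_eq => k km.
  have -> : @heis_coord C m (\col_i acoord i g) k = acoord k g.
    rewrite /heis_coord mxE ifF; first by rewrite mxE idxE //; lia.
    by apply/eqP => /(congr1 val); rewrite /= idxE; lia.
  rewrite /acoord; case: eqP => [->|k0].
    rewrite vE // vv_chart_pt // big_ord0 addr0 [uu 0 g * _ / _]mulrAC mulfV ?gc // mul1r -mulr2n.
    by rewrite -[_ *+ 2]mulr_natr mulfK // pnatr_eq0.
  case: ifP => km1.
    have kE : k.-1.+1 = k by lia.
    rewrite gE; last by lia.
    by rewrite kE gm_chart_pt ?kE; [rewrite mulrAC mulfV ?mul1r // gc | ]; lia.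
  rewrite km dE; last by lia.
  rewrite dl_chart_pt; last by lia.
  rewrite mulrAC mulfV ?mul1r; last by apply: gc; lia.
  rewrite mulrA -exprMn mulrNN mulr1 expr1n mul1r; congr (heis_coord _ _); lia.
move=> p f fW; rewrite (E p f fW) HE; congr (_ * _).
by apply: eq_bigr => i _; rewrite lidx tE.
Qed.

(** On the chart this is the evaluation formula; both sides being regular, it
    extends to the whole group by density. *)
Lemma W_localized p f : W p f -> exists N P,
  forall g, f g * UU g ^+ N = evg fgen P g.
Proof.
move=> fW; have [[fr _] _] := fW.
have [N [P HP]] : localized f.
  have [N [P HP]] : localized (fun g =>
      \prod_(i < n) tcoord i g ^+ nth 0%N (lam p) i * f (Hpoint g)).
    apply: localizedM; last exact: localized_Hpoint.
    by apply: localized_prod => i; apply: localizedX; apply: localized_tcoord.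
  by exists N, P => g gc; rewrite (chart_eval gc fW) HP.
exists N, P => g; apply/eqP; rewrite -subr_eq0 -mulN1r; apply/eqP; move: g.
apply: uu_density => [|g gc]; last by rewrite HP // mulN1r subrr.
apply: regularD.
  by apply: regularM => //; apply: regularX; apply: regular_prod => k; apply: regular_minor.
apply: regularM; first exact: regular_cst.
exact: (evg_regular fgenW).
Qed.

End Localization.

(** * The generators attached to an order type are algebraically independent *)

Section OrderType.
Variables (C : numFieldType) (m : nat) (sigma : order_type m.+1).
Notation n := m.+1.
Implicit Types (g : Sp C n) (p q : bidegree n) (f : Sp C n -> C).
Notation idx := (ord_idx m).

Definition zz (i : 'I_n.-1) : Sp C n -> C :=
  match tnth sigma i with ge_letter => dl i | le_letter => gm i end.

Definition zdeg (i : 'I_n.-1) : bidegree n :=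
  match tnth sigma i with ge_letter => deg_d m i | le_letter => deg_g m i end.

Notation K := ((n + n) + n.-1)%N.
Notation ku i := (lshift n.-1 (lshift n i)).
Notation kv i := (lshift n.-1 (rshift n i)).
Notation kz i := (rshift (n + n) i).

Definition sgen (k : 'I_K) : Sp C n -> C :=
  match fintype.split k with
  | inl k1 => match fintype.split k1 with inl i => uu i | inr i => vv i end
  | inr i => zz i
  end.

Definition gen_deg (k : 'I_K) : bidegree n :=
  match fintype.split k with
  | inl k1 => match fintype.split k1 with inl i => deg_u m i | inr i => deg_u m i end
  | inr i => zdeg i
  end.

Lemma zzW i : W (zdeg i) (zz i).
Proof. by rewrite /zdeg /zz; case: (tnth sigma i); [apply: dlW|apply: gmW]; apply: ltn_ord i. Qed.

Lemma sgenW k : W (gen_deg k) (sgen k).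
Proof.
rewrite /gen_deg /sgen; case: (fintype.split k) => k'; last exact: zzW.
by case: (fintype.split k') => i; [apply: uuW|apply: vvW].
Qed.

Lemma split3 (T : Type) (a b : 'I_n -> T) (c : 'I_n.-1 -> T) (F : 'I_K -> T) :
  (forall k, F k = match fintype.split k with
     | inl k1 => match fintype.split k1 with inl i => a i | inr i => b i end
     | inr i => c i end) ->
  [/\ forall i, F (ku i) = a i, forall i, F (kv i) = b i & forall i, F (kz i) = c i].
Proof.
move=> FE; split=> i; rewrite FE.
- by rewrite -[lshift _ (lshift _ _)]/(unsplit (inl (unsplit (inl _)))) !unsplitK.
- by rewrite -[lshift _ (rshift _ _)]/(unsplit (inl (unsplit (inr _)))) !unsplitK.
- by rewrite -[rshift _ _]/(unsplit (inr _)) unsplitK.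
Qed.

Lemma split3P (P : 'I_K -> Prop) :
  (forall i, P (ku i)) -> (forall i, P (kv i)) -> (forall i, P (kz i)) -> forall k, P k.
Proof.
move=> Pu Pv Pz k; rewrite -(splitK k); case: (fintype.split k) => k' /=; last exact: Pz.
by rewrite -(splitK k'); case: (fintype.split k') => i /=.
Qed.

Lemma sgenE : [/\ forall i, sgen (ku i) = uu i, forall i, sgen (kv i) = vv i &
  forall i, sgen (kz i) = zz i].
Proof. exact: (split3 (F := sgen)). Qed.

Lemma sdegE : [/\ forall i, gen_deg (ku i) = deg_u m i, forall i, gen_deg (kv i) = deg_u m i &
  forall i, gen_deg (kz i) = zdeg i].
Proof. exact: (split3 (F := gen_deg)). Qed.

Notation ev := (evg sgen).

(** The chart coordinates can be solved for: for each [i] the Pluecker relation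
    prescribes the product of the values of [dl i] and [gm i] ([del] below, up to
    normalization), and the one selected by the order type is nonzero, which
    determines the other. *)
Lemma realize_u (U V : nat -> C) (Z : 'I_n.-1 -> C) :
  (forall k, U k != 0) -> (forall i, Z i != 0) ->
  exists g, [/\ forall k, (k < n)%N -> uu k g = U k,
    forall k, (k < n)%N -> vv k g = V k & forall i, zz i g = Z i].
Proof.
move=> U0 Z0.
pose s i := if i is i'.+1 then U i / U i' else U 0%N.
have s0 i : s i != 0 by case: i => [|i]; rewrite /s ?mulf_neq0 ?invr_eq0.
have sU k : \prod_(i < k.+1) s i = U k.
  elim: k => [|k IH]; first by rewrite big_ord1.
  by rewrite big_ord_recr IH /= mulrC divfK.
(* the value that the Pluecker relation prescribes for the product [D k * G k] below *)
pose del k := V k.+1 / U k.+1 - V k / U k.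
pose ZZ i := if insub i is Some j then Z j else 1.
have ZZ0 i : ZZ i != 0 by rewrite /ZZ; case: insub => [j|]; rewrite ?Z0 ?oner_eq0.
have ZZE (i : 'I_n.-1) : ZZ i = Z i by rewrite /ZZ valK.
pose isge i := if insub i is Some j then
  (if tnth sigma j is ge_letter then true else false) else true.
have isgeE (i : 'I_n.-1) : isge i = if tnth sigma i is ge_letter then true else false.
  by rewrite /isge valK.
(* values at the chart point of the coordinates seen by [dl i] and [gm i] *)
pose D i := if isge i then (-1) ^+ i.+1 * (ZZ i / U i) else del i * U i.+1 / ZZ i.
pose G i := if isge i then del i / D i else ZZ i / U i.+1.
have DG i : D i * G i = del i.
  rewrite /G; case E: (isge i).
    rewrite mulrC divfK // /D E mulf_neq0 ?signr_eq0 // mulf_neq0 ?invr_eq0 ?U0 ?ZZ0 //.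
  by rewrite /D E; field; rewrite U0 ZZ0.
pose A j := if j == 0%N then V 0%N / U 0%N / 2%:R else if (j <= m)%N then G j.-1
  else D (m + m - j)%N.
pose a : 'cV[C]_(n + n) := \col_i A i.
have avE k : (k <= m + m)%N -> @heis_coord C m a k = A k.
  move=> km; rewrite /heis_coord mxE ifF; first by rewrite mxE idxE //; lia.
  by apply/eqP => /(congr1 val); rewrite /= idxE; lia.
have avD i : (i < m)%N -> @heis_coord C m a (m + m - i) = D i.
  move=> im; rewrite avE ?leq_subr // /A ifF; last by lia.
  by rewrite ifF; [congr D | ]; lia.
have avG i : (i < m)%N -> @heis_coord C m a i.+1 = G i.
  by move=> im; rewrite avE; [rewrite /A /= im | lia].
pose t := tor m s0.
have gE kk p (c : Sp C n -> C) : (kk < n)%N ->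
    (forall i, (i < n)%N -> nth 0%N (lam p) i = (i < kk.+1)%N) ->
    W p c -> c (t * chart_pt a)%g = U kk * c (chart_pt a).
  move=> kn pE cW; rewrite (W_torus _ cW (tor_T m s0)) (@char_lam_fund _ _ _ _ kk.+1) //.
  congr (_ * _); rewrite -[RHS]sU; apply: eq_bigr => i _; rewrite torE //.
  by have := ltn_ord i; lia.
exists (t * chart_pt a)%g; split=> [k kn|k kn|i].
- rewrite (gE k _ _ kn _ (uuW C kn)) ?uu_chart_pt ?mulr1 // => i iN.
  by rewrite lam_mkdeg.
- rewrite (gE k _ _ kn _ (vvW C kn)); last by move=> i iN; rewrite lam_mkdeg.
  rewrite vv_chart_pt // -[RHS](divfK (U0 k)) mulrC; congr (_ * _).
  elim: k kn => [|k IH] kn.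
    by rewrite big_ord0 addr0 avE // /A eqxx; field; rewrite ?U0 ?pnatr_eq0.
  rewrite big_ord_recr addrA /= IH; last by lia.
  by rewrite avD // avG // DG /del addrCA subrr addr0.
have im : (i < m)%N := ltn_ord i.
rewrite /zz; have := isgeE i; case: (tnth sigma i) => iE.
  rewrite (gE i _ _ _ _ (dlW C im)); [|lia|by move=> j jN; rewrite lam_mkdeg].
  rewrite dl_chart_pt // avD // /D iE ZZE.
  rewrite (mulrA ((-1) ^+ _)) -exprMn mulrNN mulr1 expr1n mul1r mulrC.
  exact: divfK.
rewrite (gE i.+1 _ _ _ _ (gmW C im)); [|lia|by move=> j jN; rewrite lam_mkdeg].
by rewrite gm_chart_pt // avG // /G iE ZZE mulrC divfK.
Qed.

Lemma zz_sl2 i g (h : SL2 C) : zz i (g * sl2_emb n h)%g = zz i g.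
Proof. by rewrite /zz; case: (tnth sigma i); rewrite ?dl_sl2 ?gm_sl2 //; apply: ltn_ord i. Qed.

Lemma sgen_eq g (v : 'I_K -> C) : (forall i : 'I_n, uu i g = v (ku i)) ->
  (forall i : 'I_n, vv i g = v (kv i)) -> (forall i, zz i g = v (kz i)) ->
  forall k, sgen k g = v k.
Proof.
move=> gu gv gz; have [su sv sz] := sgenE.
by apply: split3P => i; rewrite ?su ?sv ?sz.
Qed.

Definition ext_nat (T : Type) (d : T) (N : nat) (v : 'I_N -> T) (k : nat) : T :=
  if insub k is Some i then v i else d.

Lemma ext_natE (T : Type) (d : T) (N : nat) (v : 'I_N -> T) i : ext_nat d v (val i) = v i.
Proof. by rewrite /ext_nat valK. Qed.

Lemma ext_nat_neq0 (N : nat) (v : 'I_N -> C) k : (forall i, v i != 0) -> ext_nat 1 v k != 0.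
Proof. by move=> v0; rewrite /ext_nat; case: insub => [i|] //; apply: oner_neq0. Qed.

Lemma realize_u_pt (v : 'I_K -> C) : (forall i, v (ku i) != 0) -> (forall i, v (kz i) != 0) ->
  exists g, forall k, sgen k g = v k.
Proof.
move=> u0 z0.
have [g [gu gv gz]] := @realize_u (ext_nat 1 (fun i => v (ku i))) (ext_nat 1 (fun i => v (kv i)))
  (fun i => v (kz i)) (fun k => ext_nat_neq0 k u0) z0.
by exists g; apply: sgen_eq => // i; rewrite ?gu ?gv ?ltn_ord // ext_natE.
Qed.

Lemma rot_det : \det (\matrix_(i < 2, j < 2) ((j == 1)%:R * (i == 0)%:R - (i == 1)%:R * (j == 0)%:R) : 'M[C]_2) == 1.
Proof.
rewrite (expand_det_row _ 0) !big_ord_recl big_ord0 addr0 /cofactor !det_mx11 !mxE /=.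
by apply/eqP; rewrite !(mul0r, mulr0, mul1r, mulr1, subr0, sub0r, add0r, addr0, expr0, expr1) mulrNN mulr1.
Qed.

(** The quarter turn of SL_2 exchanges the roles of the [uu k] and the [vv k]. *)
Lemma realize_v_pt (v : 'I_K -> C) : (forall i, v (kv i) != 0) -> (forall i, v (kz i) != 0) ->
  exists g, forall k, sgen k g = v k.
Proof.
move=> v0 z0; pose h : SL2 C := MkSL2 rot_det.
have [g [gu gv gz]] := @realize_u (ext_nat 1 (fun i => v (kv i)))
  (fun k => - ext_nat 1 (fun i => v (ku i)) k)
  (fun i => v (kz i)) (fun k => ext_nat_neq0 k v0) z0.
exists (g * sl2_emb n h)%g; apply: sgen_eq => i; rewrite ?zz_sl2 //.
  rewrite uu_sl2 ?ltn_ord // gu ?gv ?ltn_ord // !ext_natE /h /= !mxE /=.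
  by rewrite !(mul0r, mulr0, mul1r, mulr1, subr0, sub0r, add0r) mulrNN mul1r.
rewrite vv_sl2 ?ltn_ord // gu ?gv ?ltn_ord // !ext_natE /h /= !mxE /=.
by rewrite !(mul0r, mulr0, mul1r, mulr1, subr0, sub0r, add0r, addr0).
Qed.

Lemma ev_eq0 Q : (forall g, ev Q g = 0) -> Q = 0.
Proof.
move=> Q0; apply: (@meval_eq0_on C K Q (\prod_(k < K) 'X_k)).
  apply/eqP => /(congr1 (meval (fun=> 1))); rewrite rmorph_prod meval0 big1.
    by apply/eqP; apply: oner_neq0.
  by move=> k _; rewrite /= mevalXU.
move=> v; rewrite rmorph_prod prodf_seq_neq0 => /allP v0.
have {}v0 k : v k != 0 by have := v0 k (mem_index_enum _); rewrite /= mevalXU.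
have [g gv] := realize_u_pt (fun i => v0 _) (fun i => v0 _).
by rewrite -(Q0 g) /evg; apply: meval_eq => k; rewrite gv.
Qed.

Lemma ev_inj Q Q' : (forall g, ev Q g = ev Q' g) -> Q = Q'.
Proof.
move=> QQ; apply/eqP; rewrite -subr_eq0; apply/eqP/ev_eq0 => g.
by rewrite /evg mevalB -!/(ev _ g) QQ subrr.
Qed.

Definition inEv f : Prop := exists Q, forall g, f g = ev Q g.

Lemma inEv_cst (c : C) : inEv (fun=> c).
Proof. by exists c%:MP => g; rewrite /evg mevalC. Qed.

Lemma inEvD F G : inEv F -> inEv G -> inEv (fun g => F g + G g).
Proof. by move=> [P HP] [Q HQ]; exists (P + Q) => g; rewrite HP HQ /evg mevalD. Qed.

Lemma inEvM F G : inEv F -> inEv G -> inEv (fun g => F g * G g).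
Proof. by move=> [P HP] [Q HQ]; exists (P * Q) => g; rewrite HP HQ /evg mevalM. Qed.

Lemma inEvX F e : inEv F -> inEv (fun g => F g ^+ e).
Proof. by move=> [P HP]; exists (P ^+ e) => g; rewrite HP /evg rmorphXn. Qed.

Lemma inEv_prod (I : Type) (r : seq I) (F : I -> Sp C n -> C) :
  (forall i, inEv (F i)) -> inEv (fun g => \prod_(i <- r) F i g).
Proof.
move=> HF; elim: r => [|i r IH].
  by under [X in inEv X]funext do rewrite big_nil; apply: inEv_cst.
by under [X in inEv X]funext do rewrite big_cons; apply: inEvM.
Qed.

Lemma inEv_gen k : inEv (sgen k).
Proof. by exists 'X_k => g; rewrite /evg mevalXU. Qed.

Lemma inEv_uu k : (k < n)%N -> inEv (uu k).
Proof. by move=> kn; have := inEv_gen (ku (Ordinal kn)); have [-> _ _] := sgenE. Qed.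

Lemma inEv_vv k : (k < n)%N -> inEv (vv k).
Proof. by move=> kn; have := inEv_gen (kv (Ordinal kn)); have [_ -> _] := sgenE. Qed.

Lemma inEv_zz i : inEv (zz i).
Proof. by have := inEv_gen (kz i); have [_ _ ->] := sgenE. Qed.

End OrderType.

(** * The generators attached to an order type generate *)

Section MainW.
Variables (C : numFieldType) (m : nat) (sigma : order_type m.+1).
Notation n := m.+1.
Implicit Types (g : Sp C n) (p q : bidegree n) (f : Sp C n -> C).

Notation K := ((n + n) + n.-1)%N.
Notation ku i := (lshift n.-1 (lshift n i)).
Notation kv i := (lshift n.-1 (rshift n i)).
Notation kz i := (rshift (n + n) i).
Notation fu i := (lshift (m + m) (lshift n i)).
Notation fv i := (lshift (m + m) (rshift n i)).
Notation fd i := (rshift (n + n) (lshift m i)).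
Notation fg i := (rshift (n + n) (rshift m i)).
Notation ev := (evg (@sgen C m sigma)).

Lemma inEv_eq (F G : Sp C n -> C) : F =1 G -> inEv sigma G -> inEv sigma F.
Proof. by move=> FG [Q HQ]; exists Q => g; rewrite FG. Qed.

Lemma inEv_dlgm i : (i < m)%N -> inEv sigma (fun g => @dl C m i g * gm i g).
Proof.
move=> im; have iN : (i < n)%N by lia.
have im1 : (i.+1 < n)%N by [].
apply: (@inEv_eq _ (fun g => (-1) ^+ i.+1 * (uu i g * vv i.+1 g + (-1) * (uu i.+1 g * vv i g)))).
  move=> g; rewrite (plucker g im) mulN1r addrAC subrr add0r mulrA -exprMn mulrNN mulr1.
  by rewrite expr1n mul1r.
apply: inEvM; first exact: inEv_cst.
apply: inEvD; first by apply: inEvM; [apply: inEv_uu|apply: inEv_vv].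
apply: inEvM; first exact: inEv_cst.
by apply: inEvM; [apply: inEv_uu|apply: inEv_vv].
Qed.

(** The bidegrees of [uu k] and [vv k] contribute equally to [mu_i] and to
    [lambda_(i+1)]; only [dl i] and [gm i] distinguish the two. Hence the
    difference of their exponents is a function of the bidegree. *)
Lemma exponent_balance (e : 'X_{1..(n + n) + (m + m)}) (i : 'I_m) :
  (nth 0 (mu (degm (@fdeg m) e)) i + e (fg i) =
   nth 0 (lam (degm (@fdeg m) e)) i.+1 + e (fd i))%N.
Proof.
have im := ltn_ord i; have im1 : (i.+1 < n)%N by [].
rewrite mu_degm lam_degm !big_split_ord /=.
under eq_bigr => j _ do rewrite fdeg_u mu_mkdeg //.
under [X in (_ + X + _ + _ = _)%N]eq_bigr => j _ do rewrite fdeg_v mu_mkdeg //.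
under [X in (_ + (X + _) + _ = _)%N]eq_bigr => j _ do rewrite fdeg_d mu_mkdeg //.
under [X in (_ + (_ + X) + _ = _)%N]eq_bigr => j _ do rewrite fdeg_g mu_mkdeg //.
under [in RHS]eq_bigr => j _ do rewrite fdeg_u lam_mkdeg //.
under [X in (_ = _ + X + _ + _)%N]eq_bigr => j _ do rewrite fdeg_v lam_mkdeg //.
under [X in (_ = _ + (X + _) + _)%N]eq_bigr => j _ do rewrite fdeg_d lam_mkdeg //.
under [X in (_ = _ + (_ + X) + _)%N]eq_bigr => j _ do rewrite fdeg_g lam_mkdeg //.
have shift (x : 'I_m -> nat) :
    (\sum_(j < m) (i < j.+1)%N * x j = x i + \sum_(j < m) (i < j)%N * x j)%N.
  rewrite (bigD1 i) //= ltnSn mul1n [in RHS](bigD1 i) //= ltnn mul0n add0n.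
  congr (_ + _)%N; apply: eq_bigr => j ji; congr (nat_of_bool _ * _)%N.
  by rewrite ltnS leq_eqVlt eq_sym val_eqE (negPf ji).
have -> : (\sum_(j < m) (i.+1 < j.+2) * e (fg j) = \sum_(j < m) (i < j.+1) * e (fg j))%N by [].
have -> : (\sum_(j < m) (i.+1 < j.+1) * e (fd j) = \sum_(j < m) (i < j) * e (fd j))%N by [].
have -> : (\sum_(j < n) (i.+1 < j.+1) * e (fu j) = \sum_(j < n) (i < j) * e (fu j))%N by [].
have -> : (\sum_(j < n) (i.+1 < j.+1) * e (fv j) = \sum_(j < n) (i < j) * e (fv j))%N by [].
rewrite !shift; ring.
Qed.

(** The exponents of [dl i] and [gm i] are ordered as the letter of [sigma]
    says; their common part is a power of the product, which the Pluecker
    relation rewrites in the [uu] and [vv]. *)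
Lemma mono_inEv (e : 'X_{1..(n + n) + (m + m)}) :
  of_order_type sigma (degm (@fdeg m) e) -> inEv sigma (evg (@fgen C m) 'X_[e]).
Proof.
move=> esig.
pose F g := (\prod_(i < n) @uu C m i g ^+ e (fu i)) * (\prod_(i < n) vv i g ^+ e (fv i)) *
  \prod_(i < m) (dl i g ^+ e (fd i) * gm i g ^+ e (fg i)).
apply: (@inEv_eq _ F) => [g|].
  rewrite /evg mevalX !big_split_ord /= /F big_split /=.
  by congr (_ * _ * (_ * _)); apply: eq_bigr => i _;
    rewrite ?fgen_u ?fgen_v ?fgen_d ?fgen_g.
apply: inEvM; first apply: inEvM.
- by apply: inEv_prod => i; apply/inEvX/inEv_uu/ltn_ord.
- by apply: inEv_prod => i; apply/inEvX/inEv_vv/ltn_ord.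
apply: inEv_prod => i; have im := ltn_ord i.
have := exponent_balance e i; have := inEv_zz C sigma i; have := esig i; rewrite /zz.
have ddg := inEv_dlgm im.
case: (tnth sigma i) => le_ml ez bal.
  apply: (@inEv_eq _ (fun g => dl i g ^+ (e (fd i) - e (fg i)) * (dl i g * gm i g) ^+ e (fg i))).
    move=> g; rewrite exprMn mulrA -exprD subnK //.
    by rewrite -(leq_add2l (nth 0%N (mu (degm (@fdeg m) e)) i)) bal leq_add2r.
  by apply: inEvM; apply: inEvX.
apply: (@inEv_eq _ (fun g => gm i g ^+ (e (fg i) - e (fd i)) * (dl i g * gm i g) ^+ e (fd i))).
  move=> g; rewrite exprMn mulrCA -exprD subnK //.
  by rewrite -(leq_add2l (nth 0%N (lam (degm (@fdeg m) e)) i.+1)) -bal leq_add2r.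
by apply: inEvM; apply: inEvX.
Qed.

Lemma mpoly_ring_ind (R : comNzRingType) (k : nat) (P : {mpoly R[k]} -> Prop) :
  (forall c, P c%:MP) -> (forall i, P 'X_i) -> (forall a b, P a -> P b -> P (a + b)) ->
  (forall a b, P a -> P b -> P (a * b)) -> forall a, P a.
Proof.
move=> Pc PX PD PM; elim/mpolyind => [|c e a _ _ IH]; first by rewrite -mpolyC0.
apply: (PD) => //; rewrite -mul_mpolyC mpolyXE_id; apply: (PM) => //.
elim: (index_enum _) => [|i r IHr]; first by rewrite big_nil -mpolyC1.
rewrite big_cons; apply: (PM) => //; elim: (e i) => [|d IHd]; first by rewrite expr0 -mpolyC1.
by rewrite exprS; apply: PM.
Qed.

(** Division with remainder by a variable: the remainder is the substitution
    of zero for that variable. *)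
Lemma mpoly_subst0 (k : 'I_K) (Q : {mpoly C[K]}) :
  exists s, Q = (Q \mPo [tuple if j == k then 0 else 'X_j | j < K]) + 'X_k * s.
Proof.
elim/mpoly_ring_ind: Q => [c|i|p q [s ps] [t qt]|p q [s ps] [t qt]].
- by exists 0; rewrite comp_mpolyC mulr0 addr0.
- rewrite comp_mpolyXU -tnth_nth tnth_mktuple; case: eqP => [->|_].
    by exists 1; rewrite mulr1 add0r.
  by exists 0; rewrite mulr0 addr0.
- by exists (s + t); rewrite comp_mpolyD {1}ps {1}qt; ring.
- set sg := [tuple _ | _ < _] in ps qt *.
  exists ((p \mPo sg) * t + s * (q \mPo sg) + 'X_k * s * t).
  by rewrite rmorphM {1}ps {1}qt; ring.
Qed.

(** The remainder [Q0] of [Q] modulo the variable of [uu i] vanishes at every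
    point with nonzero values of the [vv k] and the generators [zz j]: such a
    point is realized on the group with [uu i] equal to zero, where [ev Q]
    vanishes by hypothesis. *)
Lemma ev_div (i : 'I_n) (Q : {mpoly C[K]}) f : regular f ->
  (forall g, f g * uu i g = ev Q g) -> inEv sigma f.
Proof.
move=> fr fQ; have [s Qs] := mpoly_subst0 (ku i) Q.
have [su sv sz] := sgenE C sigma.
set Q0 := _ \mPo _ in Qs.
suff Q00 : Q0 = 0.
  exists s => g; apply/eqP; rewrite -subr_eq0 addrC -mulN1r; apply/eqP; move: g.
  apply: (@uu_cancel C m i) => //.
    apply: regularD => //; apply: regularM; first exact: regular_cst.
    exact: (evg_regular (@sgenW C m sigma)).
  move=> g; rewrite mulN1r mulrDr [uu i g * f g]mulrC fQ Qs Q00 add0r.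
  by rewrite /evg mevalM mevalXU su mulrN addNr.
apply: (@meval_eq0_on C K Q0 ((\prod_(j < n) 'X_(kv j)) * \prod_(j < n.-1) 'X_(kz j))).
  apply/eqP => /(congr1 (meval (fun=> 1))).
  rewrite mevalM !rmorph_prod meval0 !big1 ?mulr1; last first.
  - by move=> k _; rewrite /= mevalXU.
  - by move=> k _; rewrite /= mevalXU.
  by apply/eqP; apply: oner_neq0.
move=> v; rewrite mevalM mulf_eq0 negb_or !rmorph_prod !prodf_seq_neq0.
move=> /andP[/allP v0 /allP z0].
rewrite /Q0 comp_mpoly_meval; set v' := fun _ => _.
have v'E k : v' k = if k == ku i then 0 else v k.
  by rewrite /v' tnth_mktuple; case: ifP => _; rewrite ?meval0 ?mevalXU.
have [j|j|g gv] := @realize_v_pt C m sigma v'.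
- rewrite v'E ifF; first by have := v0 j (mem_index_enum _); rewrite /= mevalXU.
  by apply/eqP => /lshift_inj/eqP; rewrite eq_rlshift.
- rewrite v'E ifF; first by have := z0 j (mem_index_enum _); rewrite /= mevalXU.
  by rewrite eq_rlshift.
have := fQ g; rewrite -su gv v'E eqxx mulr0 => /esym <-.
by apply: meval_eq => k; rewrite gv.
Qed.

Lemma ev_div_prod (ks : seq 'I_n) (Q : {mpoly C[K]}) f : regular f ->
  (forall g, f g * \prod_(k <- ks) uu k g = ev Q g) -> inEv sigma f.
Proof.
elim: ks Q f => [|k ks IH] Q f fr fQ.
  by exists Q => g; rewrite -fQ big_nil mulr1.
have [|g|Q' fQ'] := @ev_div k Q (fun g => f g * \prod_(j <- ks) uu j g).
- by apply: regularM => //; apply: regular_prod => j; apply: regular_minor.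
- by rewrite -fQ big_cons mulrAC mulrA.
exact: IH fQ'.
Qed.

Lemma ev_div_UU N (Q : {mpoly C[K]}) f : regular f ->
  (forall g, f g * UU g ^+ N = ev Q g) -> inEv sigma f.
Proof.
elim: N Q f => [|N IH] Q f fr fQ.
  by exists Q => g; rewrite -fQ expr0 mulr1.
have [|g|Q' fQ'] := @ev_div_prod (index_enum 'I_n) Q (fun g => f g * UU g ^+ N).
- apply: regularM => //; apply: regularX; apply: regular_prod => j.
  exact: regular_minor.
- by rewrite -fQ exprSr mulrA.
exact: IH fQ'.
Qed.

Lemma UUW : W (\big[+%MM/0%MM]_(i < n) deg_u m i) (@UU C m).
Proof.
rewrite /UU; apply: (@W_prod C m 'I_n _ _ (fun i => @uu C m i)) => i.
exact: uuW (ltn_ord i).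
Qed.

(** The bidegree of each [uu k] has [mu_i = lambda_(i+1)], so multiplication by
    it respects every order type. *)
Lemma of_order_type_u p N : of_order_type sigma p ->
  of_order_type sigma (p + (\big[+%MM/0%MM]_(i < n) deg_u m i) *+ N)%MM.
Proof.
move=> ps i; have := ps i.
have im : (i < m)%N := ltn_ord i.
have E : nth 0%N (mu (\big[+%MM/0%MM]_(i < n) deg_u m i)) i =
         nth 0%N (lam (\big[+%MM/0%MM]_(i < n) deg_u m i)) i.+1.
  elim: (index_enum _) => [|k r IH]; first by rewrite !big_nil mu0E lam0E.
  by rewrite !big_cons muD lamD IH mu_mkdeg // lam_mkdeg.
by rewrite muD lamD muMn lamMn E; case: (tnth sigma i); rewrite leq_add2r.
Qed.

(** After multiplication by a power of the product of the [uu k] the function is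
    a polynomial in all minors; its monomials of the right weight are handled
    by [mono_inEv], and then the [uu k] are divided out. *)
Lemma W_inEv p f : of_order_type sigma p -> W p f -> inEv sigma f.
Proof.
move=> ps fW; have [[fr _] _] := fW.
have [N [P fP]] := W_localized fW.
have fUW := W_mul fW (W_exp N UUW).
have fP' := evg_part (@fgenW C m) fUW (fun g => esym (fP g)).
set p' := (p + _)%MM in fUW fP'.
have ps' : of_order_type sigma p' := of_order_type_u N ps.
have [Q HQ] : inEv sigma (evg (@fgen C m) (part (@fdeg m) p' P)).
  rewrite /part; elim: (msupp P) => [|e r IH].
    apply: (inEv_eq _ (inEv_cst sigma 0)) => g.
    by rewrite big_nil /evg meval0.
  rewrite big_cons; case: eqP => // ep.
  apply: (@inEv_eq _ (fun g => P@_e * evg (@fgen C m) 'X_[e] g +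
      evg (@fgen C m) (\sum_(j <- r | degm (@fdeg m) j == p') P@_j *: 'X_[j]) g)).
    by move=> g; rewrite /evg mevalD mevalZ.
  apply: inEvD => //; apply: inEvM; first exact: inEv_cst.
  by apply: mono_inEv; rewrite ep.
by apply: (@ev_div_UU N Q) => // g; rewrite -fP' HQ.
Qed.

End MainW.

(** * From polynomials in the generators to tensors *)

Section ToTensor.
Variables (C : numFieldType) (m : nat) (sigma : order_type m.+1).
Notation n := m.+1.
Implicit Types (g : Sp C n) (p q : bidegree n) (f : Sp C n -> C).

Notation K := ((n + n) + n.-1)%N.
Notation ku i := (lshift n.-1 (lshift n i)).
Notation kv i := (lshift n.-1 (rshift n i)).
Notation kz i := (rshift (n + n) i).
Notation ev := (evg (@sgen C m sigma)).
Notation sdeg := (@gen_deg m sigma).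
Implicit Types (Q : {mpoly C[K]}) (e : 'X_{1..K}).
Notation grT := {mpoly {mpoly C[n + n]}[n.-1 + n]}.

(** The minus sign comes from the contragredient action on the coordinates of
    the plane: [- y] and [x] transform as a basis of the plane itself. *)
Definition gen_coord (k : 'I_K) : {mpoly C[n + n]} :=
  match fintype.split k with
  | inl k1 => match fintype.split k1 with inl i => - 'X_(rshift n i) | inr i => 'X_(lshift n i) end
  | inr i => 1
  end.

Lemma gen_coordE : [/\ forall i, gen_coord (ku i) = - 'X_(rshift n i), forall i, gen_coord (kv i) = 'X_(lshift n i) &
  forall i, gen_coord (kz i) = 1].
Proof. exact: (split3 (F := gen_coord)). Qed.

Definition cst_cst : {rmorphism C -> grT} := (@mpolyC _ _) \o (@mpolyC _ _).

Definition to_tensor : {mpoly C[K]} -> grT := mmap cst_cst (fun k => (gen_coord k)%:MP * 'X_[sdeg k]).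

Lemma PsiD Q Q' : to_tensor (Q + Q') = to_tensor Q + to_tensor Q'. Proof. exact: mmapD. Qed.
Lemma PsiM Q Q' : to_tensor (Q * Q') = to_tensor Q * to_tensor Q'. Proof. exact: rmorphM. Qed.
Lemma PsiC c : to_tensor c%:MP = (c%:MP)%:MP. Proof. exact: mmapC. Qed.
Lemma Psi1 : to_tensor 1 = 1. Proof. exact: rmorph1. Qed.
Lemma PsiX k : to_tensor 'X_k = (gen_coord k)%:MP * 'X_[sdeg k].
Proof. by rewrite /to_tensor mmapX mmap1U. Qed.

Lemma Psi_sum (I : Type) (r : seq I) (P : pred I) (F : I -> {mpoly C[K]}) :
  to_tensor (\sum_(i <- r | P i) F i) = \sum_(i <- r | P i) to_tensor (F i).
Proof. exact: raddf_sum. Qed.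

Definition tensor_val (Q : {mpoly C[K]}) : {mpoly C[n + n]} := Q \mPo [tuple gen_coord k | k < K].

Lemma PsiXe e : to_tensor 'X_[e] = (tensor_val 'X_[e])%:MP * 'X_[degm sdeg e].
Proof.
rewrite /to_tensor mmapX /mmap1 /tensor_val comp_mpolyX rmorph_prod.
rewrite /degm (big_morph (fun q : bidegree n => 'X_[q]) (@mpolyXD _ _) (@mpolyX0 _ _)).
rewrite -big_split; apply: eq_bigr => k _.
by rewrite exprMn tnth_mktuple rmorphXn mpolyXn.
Qed.

Lemma Psi_coef Q p : (to_tensor Q)@_p = tensor_val (part sdeg p Q).
Proof.
rewrite [in LHS](mpolyE Q) Psi_sum raddf_sum /= /part /tensor_val raddf_sum /=.
rewrite [RHS]big_mkcond; apply: eq_bigr => e _.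
rewrite -mul_mpolyC PsiM PsiC PsiXe mulrA -mpolyCM mcoeffCM mcoeffX.
by case: eqP => _; rewrite ?mulr0 // mulr1 mul_mpolyC comp_mpolyZ -mul_mpolyC.
Qed.

Lemma part_homog p Q : (forall e, e \in msupp Q -> degm sdeg e = p) -> part sdeg p Q = Q.
Proof.
move=> Qp; rewrite [RHS]mpolyE /part big_seq_cond [RHS]big_seq; apply: eq_bigl => e.
by case: (boolP (e \in _)) => // /Qp ->; rewrite eqxx.
Qed.

Lemma part_supp p Q e : e \in msupp (part sdeg p Q) -> degm sdeg e = p.
Proof.
rewrite mcoeff_msupp /part raddf_sum /= => /eqP e0; apply/eqP/negPn/negP => ep; apply: e0.
rewrite big1 // => e' /eqP e'p; rewrite mcoeffZ mcoeffX.
by case: eqP => [E|_]; rewrite ?mulr0 //; move: ep; rewrite -E e'p eqxx.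
Qed.

Lemma Psi_homog p Q : (forall e, e \in msupp Q -> degm sdeg e = p) ->
  to_tensor Q = tensor_val Q *: 'X_[p].
Proof.
move=> Qp; apply/mpolyP => q; rewrite Psi_coef mcoeffZ mcoeffX.
case: eqP => [<-|pq]; first by rewrite mulr1 part_homog.
rewrite mulr0 /part big_seq_cond big1 ?comp_mpoly0 /tensor_val ?raddf0 //.
by move=> e /andP[/Qp -> /eqP].
Qed.

Definition is_ge (j : 'I_n.-1) : bool := if tnth sigma j is ge_letter then true else false.

Lemma zdeg_mu (j : 'I_n.-1) i : (i < m)%N ->
  nth 0%N (mu (zdeg sigma j)) i = ((i < j) + (i == j) * is_ge j)%N.
Proof.
move=> im; rewrite /zdeg /is_ge; case: (tnth sigma j); rewrite mu_mkdeg //.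
  by rewrite muln1 ltnS leq_eqVlt; case: eqP => [->|_]; rewrite ?ltnn ?addn0.
by rewrite muln0 addn0.
Qed.

Lemma zdeg_lam (j : 'I_n.-1) i : (i < m)%N ->
  nth 0%N (lam (zdeg sigma j)) i.+1 = ((i < j) + (i == j) * ~~ is_ge j)%N.
Proof.
move=> im; rewrite /zdeg /is_ge; case: (tnth sigma j); rewrite lam_mkdeg //.
  by rewrite muln0 addn0 ltnS.
by rewrite muln1 2!ltnS leq_eqVlt; case: eqP => [->|_]; rewrite ?ltnn ?addn0.
Qed.

Lemma zdeg_lam0 (j : 'I_n.-1) : nth 0%N (lam (zdeg sigma j)) 0 = 1%N.
Proof. by rewrite /zdeg; case: (tnth sigma j); rewrite lam_mkdeg. Qed.

(** Exponents are extended by zero to all natural indices, so that sums over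
    shifted ranges can be compared. *)
Definition aexp e (k : nat) : nat := if insub k is Some i then (e (ku i) + e (kv i))%N else 0%N.
Definition zexp e (k : nat) : nat := if insub k is Some i then e (kz i) else 0%N.

Lemma aexpE e (i : 'I_n) : aexp e i = (e (ku i) + e (kv i))%N.
Proof. by rewrite /aexp valK. Qed.
Lemma zexpE e (i : 'I_n.-1) : zexp e i = e (kz i).
Proof. by rewrite /zexp valK. Qed.

(** The sorted sequence of the entries of mu, lambda and 0 is
    xval 0, yval 0, xval 1, yval 1, and so on. *)
Definition xval e (i : nat) : nat :=
  (\sum_(k < n) (i <= k) * aexp e k + \sum_(j < n.-1) (i <= j) * zexp e j)%N.
Definition yval e (i : nat) : nat :=
  (\sum_(k < n) (i < k) * aexp e k + \sum_(j < n.-1) (i <= j) * zexp e j)%N.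

Lemma sum_delta (N : nat) (F : 'I_N -> nat) (i : 'I_N) :
  (\sum_(j < N) (val i == j) * F j)%N = F i.
Proof.
rewrite (bigD1 i) //= eqxx mul1n big1 ?addn0 // => j ji.
by rewrite eq_sym (negPf ji : (val j == val i) = false) mul0n.
Qed.

Lemma xvalS e (i : 'I_n.-1) : yval e i = (xval e i.+1 + e (kz i))%N.
Proof.
rewrite /xval /yval -addnA; congr (_ + _)%N.
rewrite -zexpE -(sum_delta (fun j => zexp e j) i) -big_split /=; apply: eq_bigr => j _.
by case: ltngtP => _; rewrite ?mul0n ?mul1n ?addn0 ?add0n.
Qed.

Lemma xvalE e (i : 'I_n) : xval e i = (aexp e i + yval e i)%N.
Proof.
rewrite /xval /yval addnA; congr (_ + _)%N.
rewrite -(sum_delta (fun k => aexp e k) i) -big_split /=; apply: eq_bigr => k _.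
by case: ltngtP => _; rewrite ?mul0n ?mul1n ?addn0 ?add0n.
Qed.

Lemma yval_last e : yval e m = 0%N.
Proof.
rewrite /yval !big1 // => j _; have := ltn_ord j; rewrite /= => jn.
  by rewrite leqNgt jn mul0n.
by rewrite ltnNge -ltnS jn mul0n.
Qed.

Lemma deg_mu e (i : nat) : (i < m)%N ->
  nth 0%N (mu (degm sdeg e)) i = (xval e i.+1 +
    (\sum_(j < n.-1) (i == j) * is_ge j * zexp e j))%N.
Proof.
move=> im; have [du dv dz] := @sdegE m sigma.
rewrite mu_degm !big_split_ord /= /xval -[RHS]addnA; congr (_ + _)%N.
  rewrite -big_split /=; apply: eq_bigr => j _.
  by rewrite du dv mu_mkdeg // aexpE mulnDr.
rewrite -big_split /=; apply: eq_bigr => j _.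
by rewrite dz zdeg_mu // zexpE mulnDl.
Qed.

Lemma deg_lam e (i : nat) : (i < m)%N ->
  nth 0%N (lam (degm sdeg e)) i.+1 = (xval e i.+1 +
    (\sum_(j < n.-1) (i == j) * ~~ is_ge j * zexp e j))%N.
Proof.
move=> im; have [du dv dz] := @sdegE m sigma.
rewrite lam_degm !big_split_ord /= /xval -[RHS]addnA; congr (_ + _)%N.
  rewrite -big_split /=; apply: eq_bigr => j _.
  by rewrite du dv lam_mkdeg // aexpE mulnDr.
rewrite -big_split /=; apply: eq_bigr => j _.
by rewrite dz zdeg_lam // zexpE mulnDl.
Qed.

Lemma deg_lam0 e : nth 0%N (lam (degm sdeg e)) 0 = xval e 0.
Proof.
have [du dv dz] := @sdegE m sigma.
rewrite lam_degm !big_split_ord /= /xval; congr (_ + _)%N.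
  rewrite -big_split /=; apply: eq_bigr => j _.
  by rewrite du dv lam_mkdeg // aexpE mulnDr.
by apply: eq_bigr => j _; rewrite dz zdeg_lam0 zexpE.
Qed.

(** Only the variable of [zz i] contributes differently to [mu_i] and to
    [lambda_(i+1)]: it counts for the one that the letter of [sigma] declares
    the larger. *)
Lemma deg_pair e (i : 'I_n.-1) :
  if is_ge i
  then nth 0%N (mu (degm sdeg e)) i = yval e i /\ nth 0%N (lam (degm sdeg e)) i.+1 = xval e i.+1
  else nth 0%N (mu (degm sdeg e)) i = xval e i.+1 /\ nth 0%N (lam (degm sdeg e)) i.+1 = yval e i.
Proof.
have im : (i < m)%N := ltn_ord i.
rewrite deg_mu // deg_lam // xvalS.
have E (b : 'I_n.-1 -> bool) :
    (\sum_(j < n.-1) (i == j :> nat) * b j * zexp e j = b i * e (kz i))%N.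
  rewrite -zexpE -(sum_delta (fun j => b j * zexp e j)%N i).
  by apply: eq_bigr => j _; rewrite mulnA.
rewrite (E is_ge) (E (fun j => ~~ is_ge j)).
by case: (is_ge i); rewrite ?mul1n ?mul0n ?addn0.
Qed.

End ToTensor.

(** * The exponents r_i and injectivity *)

Section Degrees.
Variables (C : numFieldType) (m : nat) (sigma : order_type m.+1).
Notation n := m.+1.
Implicit Types (g : Sp C n) (p q : bidegree n) (f : Sp C n -> C).

Notation K := ((n + n) + n.-1)%N.
Implicit Types (Q : {mpoly C[K]}) (e : 'X_{1..K}).
Notation ku i := (lshift n.-1 (lshift n i)).
Notation kv i := (lshift n.-1 (rshift n i)).
Notation kz i := (rshift (n + n) i).
Notation ev := (evg (@sgen C m sigma)).
Notation sdeg := (@gen_deg m sigma).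

Definition cval e (j : nat) : nat := if odd j then yval e j./2 else xval e j./2.

Lemma cval_even e i : cval e i.*2 = xval e i.
Proof. by rewrite /cval odd_double doubleK. Qed.
Lemma cval_odd e i : cval e i.*2.+1 = yval e i.
Proof. by rewrite /cval /= odd_double /= uphalf_double. Qed.

Lemma cval_desc e j : (cval e j.+1 <= cval e j)%N.
Proof.
rewrite -(odd_double_half j); case: (odd j); rewrite ?add1n ?add0n.
  rewrite -doubleS cval_even cval_odd /xval /yval leq_add //.
  by apply: leq_sum => k _; rewrite leq_mul2r; case: ltnP => [/ltnW->|]; rewrite ?orbT.
rewrite cval_odd cval_even /xval /yval leq_add2r.
by apply: leq_sum => k _; rewrite leq_mul2r; case: ltnP => [/ltnW->|]; rewrite ?orbT.
Qed.

Lemma count_cval (a : pred nat) e N :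
  count a (mkseq (cval e) N.*2) = (\sum_(i < N) (a (xval e i) + a (yval e i)))%N.
Proof.
elim: N => [|N IH]; first by rewrite big_ord0.
rewrite doubleS /mkseq -[N.*2.+2]addn2 iotaD map_cat count_cat -/(mkseq _ _) IH.
by rewrite big_ord_recr /= cval_even cval_odd addn0.
Qed.

Lemma count_nth (a : pred nat) (s : seq nat) :
  count a s = (\sum_(i < size s) a (nth 0 s i))%N.
Proof. by elim: s => [|x s IH]; rewrite ?big_ord0 //= big_ord_recl IH. Qed.

(** The interleaved values [xval 0, yval 0, xval 1, ...] are decreasing and, by
    [deg_pair], are the entries of mu, lambda and 0 up to a permutation. *)
Lemma rearrangementE e : rearrangement (degm sdeg e) = mkseq (cval e) n.*2.
Proof.
have tg : transitive geq by move=> a b c ba cb; apply: leq_trans cb ba.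
have ag : antisymmetric geq by move=> a b /andP[ab ba]; apply/eqP; rewrite eqn_leq; apply/andP.
apply: (sorted_eq tg ag).
- by apply: sort_sorted => a b; apply: leq_total.
- apply: (homo_sorted (e := leq) (f := cval e)); last exact: iota_sorted.
  move=> a b ab; rewrite /geq /=.
  elim: b ab => [|b IH]; first by rewrite leqn0 => /eqP ->.
  by rewrite leq_eqVlt => /orP[/eqP->//|/IH]; apply: leq_trans; apply: cval_desc.
rewrite perm_sort; apply/permP => a; rewrite count_cval !count_cat !count_nth.
rewrite size_mu size_lam !big_ord1 /= [X in (_ + (X + _))%N]big_ord_recl /= deg_lam0.
rewrite big_split /= [X in _ = (X + _)%N]big_ord_recl [X in _ = (_ + X)%N]big_ord_recr /= yval_last.
have key : (\sum_(i < m) a (nth 0 (mu (degm sdeg e)) i) +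
    \sum_(i < m) a (nth 0 (lam (degm sdeg e)) (bump 0 i)) =
    \sum_(i < m) a (xval e (bump 0 i)) + \sum_(i < m) a (yval e i))%N.
  rewrite -!big_split /=; apply: eq_bigr => i _; rewrite /bump leq0n add1n.
  have := deg_pair sigma e (i : 'I_n.-1).
  by case: ifP => _ [-> ->] //; rewrite addnC.
by rewrite addnA addnCA key; ring.
Qed.

Lemma r_degm e (i : 'I_n) : r (degm sdeg e) i = (e (ku i) + e (kv i))%N.
Proof.
have iN := ltn_ord i.
rewrite /r rearrangementE !nth_mkseq; try lia.
by rewrite cval_even cval_odd xvalE addnK aexpE.
Qed.

Lemma degm_order_type e : of_order_type sigma (degm sdeg e).
Proof.
move=> i; have := deg_pair sigma e i; rewrite /is_ge.
by case: (tnth sigma i) => -[-> ->]; rewrite xvalS leq_addr.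
Qed.

Lemma degm_dominant e : dominant (degm sdeg e).
Proof.
have [du dv dz] := @sdegE m sigma.
have D (k : 'I_K) : (forall i, (i.+1 < m)%N ->
    nth 0 (mu (sdeg k)) i.+1 <= nth 0 (mu (sdeg k)) i)%N /\ (forall i, (i.+1 < n)%N ->
    nth 0 (lam (sdeg k)) i.+1 <= nth 0 (lam (sdeg k)) i)%N.
  move: k; apply: split3P => j; rewrite ?du ?dv ?dz /zdeg; try case: (tnth sigma j);
    by split=> i iN; rewrite ?mu_mkdeg ?lam_mkdeg //; lia.
rewrite /dominant; apply/andP; split; apply/(sortedP 0%N) => i; rewrite ?size_mu ?size_lam => iN; rewrite /geq /=.
  by rewrite !mu_degm; apply: leq_sum => k _; rewrite leq_mul2r (proj1 (D k)) ?orbT.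
by rewrite !lam_degm; apply: leq_sum => k _; rewrite leq_mul2r (proj2 (D k)) ?orbT.
Qed.

Lemma Lambda_degm e : Lambda_sigma C sigma (degm sdeg e).
Proof.
split; last exact: degm_order_type.
split; first exact: degm_dominant.
exists (ev 'X_[e]); first exact: (mono_W (@sgenW C m sigma)).
move=> E; have : 'X_[e] = 0 :> {mpoly C[K]}.
  by apply: (@ev_eq0 C m sigma) => g; rewrite E.
by move=> /mpolyP/(_ e)/eqP; rewrite mcoeffX eqxx mcoeff0 oner_eq0.
Qed.

Lemma W_ev p f : Lambda_sigma C sigma p -> W p f -> exists2 Q, f = ev Q &
  forall e, e \in msupp Q -> degm sdeg e = p.
Proof.
move=> [_ ps] fW; have [Q fQ] := W_inEv ps fW.
exists (part sdeg p Q); last by move=> e; apply: part_supp.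
by apply: funext => g; rewrite (evg_part (@sgenW C m sigma) fW (fun g => esym (fQ g))).
Qed.

Lemma Lambda_ex p : Lambda_sigma C sigma p -> exists e, p = degm sdeg e.
Proof.
move=> pL; have [[_ [f fW f0]] _] := pL; have [Q fQ Qp] := W_ev pL fW.
case Qs : (msupp Q) => [|e s]; last by exists e; rewrite (Qp e) // Qs mem_head.
by case: f0; rewrite fQ; apply: funext => g; rewrite /evg mevalE Qs big_nil.
Qed.

Lemma homog_W p Q : (forall e, e \in msupp Q -> degm sdeg e = p) -> W p (ev Q).
Proof. by move=> Qp; rewrite -(part_homog Qp); apply: (part_W (@sgenW C m sigma)). Qed.

(** In a fixed bidegree the exponents of the variables for the [zz i] are
    constant, so setting these variables to 1 loses nothing. *)
Lemma tensor_val_part_eq0 p Q : (forall e, e \in msupp Q -> degm sdeg e = p) -> tensor_val Q = 0 -> Q = 0.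
Proof.
move=> Qp HQ; apply: meval_eq0 => v.
have [hu hv hz] := @gen_coordE C m.
(* the exponent of the variable of [zz i] in every monomial of bidegree [p] *)
pose b (i : 'I_n.-1) := ((nth 0 (mu p) i - nth 0 (lam p) i.+1) +
  (nth 0 (lam p) i.+1 - nth 0 (mu p) i))%N.
have eb e : e \in msupp Q -> forall i, e (kz i) = b i.
  move=> /Qp ep i; have := deg_pair sigma e i; rewrite /b -ep.
  by case: ifP => _ [-> ->]; rewrite xvalS; lia.
pose xy (k : 'I_(n + n)) : C := match fintype.split k with
  | inl i => v (kv i) | inr i => - v (ku i) end.
have := congr1 (meval xy) HQ; rewrite meval0 /tensor_val comp_mpoly_meval mevalE => E.
transitivity ((\prod_(i < n.-1) v (kz i) ^+ b i) * 0); last by rewrite mulr0.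
rewrite mevalE -[X in _ = _ * X]E mulr_sumr.
rewrite big_seq [RHS]big_seq; apply: eq_bigr => e eQ.
rewrite mulrCA; congr (_ * _); rewrite !big_split_ord /= [RHS]mulrC.
rewrite [X in _ = _ * X * _]big1 ?mulr1; last first.
  by move=> i _; rewrite tnth_mktuple hz meval1 expr1n.
congr (_ * _ * _); apply: eq_bigr => i _; last by rewrite eb.
- rewrite tnth_mktuple hu mevalN mevalXU /xy.
  by rewrite -[rshift n i]/(unsplit (inr i)) unsplitK opprK.
- rewrite tnth_mktuple hv mevalXU /xy.
  by rewrite -[lshift n i]/(unsplit (inl i)) unsplitK.
Qed.

Lemma Psi_inj Q Q' : to_tensor sigma Q = to_tensor sigma Q' -> Q = Q'.
Proof.
move=> E; apply/eqP; rewrite -subr_eq0; apply/eqP; set D := Q - Q'.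
have PD : to_tensor sigma D = 0.
  have -> : to_tensor sigma D = to_tensor sigma Q - to_tensor sigma Q' by apply: mmapB.
  by rewrite E subrr.
have part0 p : part sdeg p D = 0.
  by apply: (tensor_val_part_eq0 (p := p)); [move=> e; apply: part_supp|rewrite -Psi_coef PD mcoeff0].
apply: (@ev_eq0 C m sigma) => g; rewrite (evg_parts _ sdeg) big1 // => p _.
by rewrite part0 /evg meval0.
Qed.

End Degrees.

(** * The reference isomorphism *)

Section Iso.
Variables (C : numFieldType) (m : nat) (sigma : order_type m.+1).
Notation n := m.+1.
Implicit Types (g : Sp C n) (p q : bidegree n) (f : Sp C n -> C).

Notation K := ((n + n) + n.-1)%N.
Implicit Types (Q : {mpoly C[K]}) (e : 'X_{1..K}).
Notation ku i := (lshift n.-1 (lshift n i)).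
Notation kv i := (lshift n.-1 (rshift n i)).
Notation kz i := (rshift (n + n) i).
Notation ev := (evg (@sgen C m sigma)).
Notation sdeg := (@gen_deg m sigma).

Lemma place_X0 (i : 'I_n) : place i 'X_0 = 'X_(lshift n i) :> {mpoly C[n + n]}.
Proof. by rewrite /place comp_mpolyXU. Qed.

Lemma place_X1 (i : 'I_n) : place i 'X_1 = 'X_(rshift n i) :> {mpoly C[n + n]}.
Proof. by rewrite /place comp_mpolyXU. Qed.

Lemma A_comp0 p : A_comp p (0 : {mpoly C[n + n]}).
Proof. by exists [::]; split=> //; rewrite big_nil. Qed.

Lemma A_compD p (a b : {mpoly C[n + n]}) : A_comp p a -> A_comp p b -> A_comp p (a + b).
Proof.
move=> [us [usF ->]] [vs [vsF ->]]; exists (us ++ vs); split; last by rewrite big_cat.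
by move=> u; rewrite mem_cat => /orP[/usF|/vsF].
Qed.

Lemma A_comp_pure p (u : 'I_n -> {mpoly C[2]}) : (forall i, F (r p i) (u i)) ->
  A_comp p (pure_tensor u).
Proof.
move=> uF; exists [:: [ffun i => u i]]; split.
  by move=> v; rewrite inE => /eqP -> i; rewrite ffunE.
by rewrite big_seq1 /pure_tensor; apply: eq_bigr => i _; rewrite ffunE.
Qed.

Lemma A_compZ p c (a : {mpoly C[n + n]}) : A_comp p a -> A_comp p (c *: a).
Proof.
move=> [us [usF ->]]; elim: us usF => [|u us IH] usF.
  by rewrite big_nil scaler0; apply: A_comp0.
rewrite big_cons scalerDr; apply: A_compD; last first.
  by apply: IH => v vs; apply: usF; rewrite inE vs orbT.
have -> : c *: pure_tensor u = pure_tensor (fun i => if i == ord0 then c *: u i else u i).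
  rewrite /pure_tensor (bigD1 ord0) //= [RHS](bigD1 ord0) //= ?eqxx /place comp_mpolyZ.
  rewrite scalerAl; congr (_ * _); apply: eq_bigr => i /negPf ->. by [].
apply: A_comp_pure => i; have ui := usF u (mem_head _ _) i.
by case: ifP => // _; rewrite /F /=; apply: rpredZ.
Qed.

Lemma A_comp_sum p (I : Type) (s : seq I) (P : pred I) (G : I -> {mpoly C[n + n]}) :
  (forall i, P i -> A_comp p (G i)) -> A_comp p (\sum_(i <- s | P i) G i).
Proof.
move=> GA; elim: s => [|i s IH]; first by rewrite big_nil; apply: A_comp0.
by rewrite big_cons; case: ifP => // /GA Gi; apply: A_compD.
Qed.

Lemma tensor_val_mono e : tensor_val ('X_[e] : {mpoly C[K]}) =
  pure_tensor (fun i : 'I_n => (- 'X_1) ^+ e (ku i) * 'X_0 ^+ e (kv i)).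
Proof.
have [hu hv hz] := @gen_coordE C m.
rewrite /tensor_val comp_mpolyX !big_split_ord /= [X in _ * X]big1 ?mulr1 => [|i _]; last first.
  by rewrite tnth_mktuple hz expr1n.
rewrite -big_split /=; apply: eq_bigr => i _.
rewrite !tnth_mktuple hu hv /place rmorphM !rmorphXn /= rmorphN /=.
by rewrite -!/(place i _) place_X0 place_X1.
Qed.

Lemma homogX1 (k : 'I_2) d : ('X_k : {mpoly C[2]}) ^+ d \is d.-homog.
Proof.
have H : ('X_k : {mpoly C[2]}) \is 1.-homog by rewrite dhomogX /= mdeg1.
by have := dhomogMn d H; rewrite mul1n.
Qed.

Lemma tensor_val_A p Q : (forall e, e \in msupp Q -> degm sdeg e = p) -> A_comp p (tensor_val Q).
Proof.
move=> Qp; rewrite /tensor_val (mpolyE Q) raddf_sum /= big_seq; apply: A_comp_sum => e eQ.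
rewrite comp_mpolyZ; apply: A_compZ; rewrite -/(tensor_val _) tensor_val_mono; apply: A_comp_pure => i.
rewrite -(Qp e eQ) r_degm /F /=; apply: dhomogM; last exact: homogX1.
by rewrite exprNn -signr_odd mulr_sign; case: (odd _); rewrite ?rpredN; apply: homogX1.
Qed.

Lemma Psi_A Q : A_sigma sigma (to_tensor sigma Q).
Proof.
move=> p; rewrite mcoeff_msupp Psi_coef => H; split; last first.
  by apply: tensor_val_A => e; apply: part_supp.
case Qs : (msupp (part sdeg p Q)) => [|e s].
  have Q0 : part sdeg p Q = 0 by apply/eqP; rewrite -msupp_eq0 Qs.
  by move: H; rewrite Q0 /tensor_val comp_mpoly0 eqxx.
have <- : degm sdeg e = p by apply: (part_supp (Q := Q)); rewrite Qs mem_head.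
exact: Lambda_degm.
Qed.

Definition lift1 (i : 'I_n) (u : {mpoly C[2]}) : {mpoly C[K]} :=
  u \mPo [tuple 'X_(kv i); - 'X_(ku i)].

Lemma exp_shuffle (R : comNzRingType) (x y z : R) a b :
  (x ^+ a * z ^+ a) * (y ^+ b * z ^+ b) = x ^+ a * y ^+ b * z ^+ (a + b).
Proof. by rewrite mulrACA exprD. Qed.

Lemma Psi_lift1 (i : 'I_n) (u : {mpoly C[2]}) d : u \is d.-homog ->
  to_tensor sigma (lift1 i u) = (place i u)%:MP * 'X_[(deg_u m i *+ d)%MM].
Proof.
move=> /dhomogP ud; have [hu hv hz] := @gen_coordE C m; have [du dv dz] := @sdegE m sigma.
have -> : lift1 i u = \sum_(e <- msupp u) u@_e *: lift1 i 'X_[e].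
  rewrite /lift1 {1}(mpolyE u) raddf_sum; apply: eq_bigr => e _; exact: comp_mpolyZ.
have -> : place i u = \sum_(e <- msupp u) u@_e *: place i 'X_[e].
  rewrite /place {1}(mpolyE u) raddf_sum; apply: eq_bigr => e _; exact: comp_mpolyZ.
rewrite Psi_sum raddf_sum /= mulr_suml.
rewrite big_seq [RHS]big_seq; apply: eq_bigr => e eu.
rewrite -!mul_mpolyC PsiM PsiC mpolyCM -mulrA; congr (_ * _).
rewrite /lift1 /place !comp_mpolyX !big_ord_recl !big_ord0 !mulr1 /= /tnth /=.
have PV : @to_tensor C m sigma 'X_(kv i) = ('X_(lshift n i))%:MP * 'X_[deg_u m i].
  by rewrite PsiX hv dv.
have PU : @to_tensor C m sigma (- 'X_(ku i)) = ('X_(rshift n i))%:MP * 'X_[deg_u m i].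
  have -> : @to_tensor C m sigma (- 'X_(ku i)) = - to_tensor sigma 'X_(ku i) by apply: mmapN.
  by rewrite PsiX hu du raddfN /= mulNr opprK.
have PX (Q : {mpoly C[K]}) k : to_tensor sigma (Q ^+ k) = to_tensor sigma Q ^+ k by apply: rmorphXn.
rewrite PsiM !PX PV PU !exprMn mpolyCM !rmorphXn /=.
have -> : d = (e ord0 + e (lift ord0 ord0))%N.
  have <- : mdeg e = d := ud e eu.
  by rewrite mdegE !big_ord_recl big_ord0 addn0.
rewrite -[in RHS](@mpolyXn _ _ (deg_u m i)). exact: exp_shuffle.
Qed.

(** Substituting the variables of [vv i] and [uu i], the latter with a sign, for
    the two coordinates of the factors lifts the tensor; the power of [zz j] is
    the one found in any monomial of the given bidegree. *)
Lemma pure_lift p (u : 'I_n -> {mpoly C[2]}) : Lambda_sigma C sigma p ->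
  (forall i, F (r p i) (u i)) ->
  exists Q, to_tensor sigma Q = pure_tensor u *: 'X_[p].
Proof.
move=> /Lambda_ex[e ->] uF; have [hu hv hz] := @gen_coordE C m; have [du dv dz] := @sdegE m sigma.
exists ((\prod_(i < n) lift1 i (u i)) * \prod_(j < n.-1) 'X_(kz j) ^+ e (kz j)).
rewrite PsiM /to_tensor !rmorph_prod -/(to_tensor sigma) -mul_mpolyC /pure_tensor rmorph_prod.
have uE i : to_tensor sigma (lift1 i (u i)) =
    (place i (u i))%:MP * 'X_[(deg_u m i *+ (e (ku i) + e (kv i)))%MM].
  by apply: Psi_lift1; have := uF i; rewrite r_degm.
rewrite (eq_bigr _ (fun i _ => uE i)) big_split /= -mulrA; congr (_ * _).
rewrite /degm !big_split_ord /= !mpolyXD.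
rewrite !(big_morph (fun q : bidegree n => 'X_[q]) (@mpolyXD _ _) (@mpolyX0 _ _)) -big_split /=.
congr (_ * _); apply: eq_bigr => i _.
  rewrite du dv -mpolyXD; congr 'X_[_].
  by apply/mnmP => j; rewrite mnmDE !mulmnE mulnDr.
rewrite rmorphXn /= dz -[in RHS](@mpolyXn _ _ (zdeg sigma i)); congr (_ ^+ _).
by have := PsiX C sigma (kz i); rewrite hz dz mpolyC1 mul1r.
Qed.

Lemma A_lift p (a : {mpoly C[n + n]}) : Lambda_sigma C sigma p -> A_comp p a ->
  exists2 Q, to_tensor sigma Q = a *: 'X_[p] & forall e, e \in msupp Q -> degm sdeg e = p.
Proof.
move=> pL [us [usF ->]].
have [Q HQ] : exists Q, to_tensor sigma Q = (\sum_(u <- us) pure_tensor u) *: 'X_[p].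
  elim: us usF => [|u us IH] usF.
    by exists 0; rewrite big_nil scale0r /to_tensor mmap0.
  have [|Q QE] := IH; first by move=> v vs; apply: usF; rewrite inE vs orbT.
  have [Q' QE'] := pure_lift pL (usF u (mem_head _ _)).
  by exists (Q' + Q); rewrite PsiD QE QE' big_cons scalerDl.
exists (part sdeg p Q); last by move=> e; apply: part_supp.
rewrite (Psi_homog (p := p)); last by move=> e; apply: part_supp.
by rewrite -Psi_coef HQ mcoeffZ mcoeffX eqxx mulr1.
Qed.

Lemma B_sigmaP f : B_sigma sigma f <-> exists Q, f = ev Q.
Proof.
split=> [[ps [G [GW ->]]]|[Q ->]].
  elim: ps GW => [|p ps IH] GW.
    by exists 0; rewrite big_nil; apply: funext => g; rewrite /evg meval0.
  have [|Q QE] := IH; first by move=> q qps; apply: GW; rewrite inE qps orbT.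
  have [pL pW] := GW p (mem_head _ _); have [Q' QE' _] := W_ev pL pW.
  exists (Q' + Q); rewrite big_cons QE QE'.
  by apply: funext => g; rewrite /evg mevalD.
exists (undup [seq degm sdeg e | e <- msupp Q]), (fun p => ev (part sdeg p Q)); split.
  move=> p; rewrite mem_undup => /mapP[e _ ->]; split; first exact: Lambda_degm.
  exact: (part_W (@sgenW C m sigma)).
by apply: funext => g; rewrite (evg_parts _ sdeg) fct_sumE.
Qed.

Lemma W_B p f : Lambda_sigma C sigma p -> W p f -> B_sigma sigma f.
Proof. by move=> pL /(W_ev pL)[Q -> _]; apply/B_sigmaP; exists Q. Qed.

Definition lift_ev f : {mpoly C[K]} :=
  if pselect (exists Q, f = ev Q) is left H then projT1 (cid H) else 0.

Lemma lift_evK Q : lift_ev (ev Q) = Q.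
Proof.
rewrite /lift_ev; case: pselect => [H|[]]; last by exists Q.
by apply: (@ev_inj C m sigma) => g; rewrite -(projT2 (cid H)).
Qed.

Definition ref_iso f : graded_ring C n := to_tensor sigma (lift_ev f).

Lemma ref_isoE Q : ref_iso (ev Q) = to_tensor sigma Q.
Proof. by rewrite /ref_iso lift_evK. Qed.

End Iso.

(** * Equivariance *)

Section SL2Inverse.
Variable C : fieldType.

Lemma sl2_invE (h : SL2 C) : [/\ (h^-1)%g 0 0 = h 1 1, (h^-1)%g 0 1 = - h 0 1,
  (h^-1)%g 1 0 = - h 1 0 & (h^-1)%g 1 1 = h 0 0].
Proof.
pose B : 'M[C]_2 := \matrix_(i, j) (if i == j then h (1 - i) (1 - i) else - h i j).
have hB : sl2_mx h *m B = 1%:M.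
  have /eqP := sl2_mxP h; rewrite det2 => dh.
  have l01 : lift ord0 ord0 = 1 :> 'I_2 by apply: val_inj.
  apply/matrixP => i j; rewrite !mxE !big_ord_recl big_ord0 addr0 !mxE l01.
  have -> : ord0 = 0 :> 'I_2 by [].
  have [->|->] := ord2 i; have [->|->] := ord2 j; rewrite /= ?subr0 ?subrr.
  - by rewrite mulr1n -dh; ring.
  - by rewrite mulr0n; ring.
  - by rewrite mulr0n; ring.
  - by rewrite mulr1n -dh; ring.
have E : sl2_mx (h^-1)%g = B.
  rewrite -[LHS]mulmx1 -hB mulmxA [sl2_mx (h^-1)%g *m _]mulVmx ?mul1mx //.
  exact: sl2_unitmx.
by rewrite E !mxE /= ?subr0 ?subrr.
Qed.

End SL2Inverse.

Section Theta.
Variables (C : numFieldType) (n : nat).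
Notation grT := {mpoly {mpoly C[n + n]}[n.-1 + n]}.
Implicit Types (g : Lgrp C n) (a b : grT).

Lemma thetaD g a b : theta g (a + b) = theta g a + theta g b.
Proof. exact: (raddfD (map_mpoly (comp_mpoly _))). Qed.
Lemma thetaM g a b : theta g (a * b) = theta g a * theta g b.
Proof. exact: (rmorphM (map_mpoly (comp_mpoly _))). Qed.
Lemma thetaC g (x : {mpoly C[n + n]}) : theta g (x%:MP : grT) = (tensor_act g x)%:MP.
Proof. exact: (map_mpolyC _ (comp_mpoly _)). Qed.
Lemma thetaX g (p : bidegree n) : theta g ('X_[p] : grT) = 'X_[p].
Proof. exact: map_mpolyX. Qed.
Lemma theta_coef g a p : (theta g a)@_p = tensor_act g a@_p.
Proof. exact: (mcoeff_map_mpoly (comp_mpoly _)). Qed.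
Lemma thetaZ g (x : {mpoly C[n + n]}) a : theta g (x *: a) = tensor_act g x *: theta g a.
Proof. by rewrite -!mul_mpolyC thetaM thetaC. Qed.

Lemma tensor_actC g (c : C) : tensor_act g c%:MP = c%:MP.
Proof. exact: comp_mpolyC. Qed.
Lemma tensor_actD g (x y : {mpoly C[n + n]}) : tensor_act g (x + y) = tensor_act g x + tensor_act g y.
Proof. exact: comp_mpolyD. Qed.
Lemma tensor_actN g (x : {mpoly C[n + n]}) : tensor_act g (- x) = - tensor_act g x.
Proof. exact: comp_mpolyN. Qed.
Lemma tensor_actM g (x y : {mpoly C[n + n]}) : tensor_act g (x * y) = tensor_act g x * tensor_act g y.
Proof. exact: rmorphM. Qed.

Lemma place_coord (i : 'I_n) (h : SL2 C) (k : 'I_2) : place i (sl2_coord h k) =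
  (h^-1)%g k 0 *: 'X_(lshift n i) + (h^-1)%g k 1 *: 'X_(rshift n i).
Proof.
rewrite /place /sl2_coord !big_ord_recl big_ord0 addr0 comp_mpolyD !comp_mpolyZ !comp_mpolyXU.
by congr (_ *: _ + _ *: _); congr ((h^-1)%g _ _); apply: val_inj.
Qed.

Lemma tensor_act_x g (i : 'I_n) : tensor_act g 'X_(lshift n i) =
  g i 1 1 *: 'X_(lshift n i) - g i 0 1 *: 'X_(rshift n i).
Proof.
rewrite /tensor_act comp_mpolyXU -tnth_nth tnth_mktuple.
rewrite -[lshift n i]/(unsplit (inl i)) unsplitK place_coord.
by have [-> -> _ _] := sl2_invE (g i); rewrite scaleNr.
Qed.

Lemma tensor_act_y g (i : 'I_n) : tensor_act g 'X_(rshift n i) =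
  - (g i 1 0 *: 'X_(lshift n i)) + g i 0 0 *: 'X_(rshift n i).
Proof.
rewrite /tensor_act comp_mpolyXU -tnth_nth tnth_mktuple.
rewrite -[rshift n i]/(unsplit (inr i)) unsplitK place_coord.
by have [_ _ -> ->] := sl2_invE (g i); rewrite scaleNr.
Qed.

End Theta.

Section IsoProof.
Variables (C : numFieldType) (m : nat) (sigma : order_type m.+1).
Notation n := m.+1.
Implicit Types (g : Sp C n) (p q : bidegree n) (f : Sp C n -> C).

Notation K := ((n + n) + n.-1)%N.
Implicit Types (Q : {mpoly C[K]}) (e : 'X_{1..K}).
Notation ku i := (lshift n.-1 (lshift n i)).
Notation kv i := (lshift n.-1 (rshift n i)).
Notation kz i := (rshift (n + n) i).
Notation ev := (evg (@sgen C m sigma)).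
Notation sdeg := (@gen_deg m sigma).
Notation Psi := (@to_tensor C m sigma).
Notation phi0 := (@ref_iso C m sigma).

Lemma Psi_surj (a : graded_ring C n) : A_sigma sigma a -> exists Q, Psi Q = a.
Proof.
move=> aA.
have [Q HQ] : exists Q, Psi Q = \sum_(p <- msupp a) a@_p *: 'X_[p].
  have : {subset msupp a <= msupp a} by [].
  elim: {1 3}(msupp a) => [|p s IH] sa.
    by exists 0; rewrite big_nil /to_tensor mmap0.
  have [|Q QE] := IH; first by move=> q qs; apply: sa; rewrite inE qs orbT.
  have [pL pA] := aA p (sa p (mem_head _ _)).
  have [Q' QE' _] := A_lift pL pA.
  by exists (Q' + Q); rewrite PsiD QE QE' big_cons.
by exists Q; rewrite HQ -mpolyE.
Qed.

(** The substitution of variables induced by right translation on the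
    generators. *)
Definition sl2_sub (h : SL2 C) (k : 'I_K) : {mpoly C[K]} :=
  match fintype.split k with
  | inl k1 => match fintype.split k1 with
    | inl i => (h 0 0)%:MP * 'X_(ku i) + (h 1 0)%:MP * 'X_(kv i)
    | inr i => (h 0 1)%:MP * 'X_(ku i) + (h 1 1)%:MP * 'X_(kv i) end
  | inr i => 'X_(kz i)
  end.

Lemma sl2_subE h : [/\ forall i, sl2_sub h (ku i) = (h 0 0)%:MP * 'X_(ku i) + (h 1 0)%:MP * 'X_(kv i),
  forall i, sl2_sub h (kv i) = (h 0 1)%:MP * 'X_(ku i) + (h 1 1)%:MP * 'X_(kv i) &
  forall i, sl2_sub h (kz i) = 'X_(kz i)].
Proof. exact: (split3 (F := sl2_sub h)). Qed.

Lemma ev_sl2_sub h Q : ev (Q \mPo [tuple sl2_sub h k | k < K]) = rtrans (sl2_emb n h) (ev Q).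
Proof.
apply: funext => g; rewrite /rtrans /evg comp_mpoly_meval; apply: meval_eq => k.
rewrite tnth_mktuple; have [su sv sz] := @sgenE C m sigma; have [gu gv gz] := sl2_subE h.
move: k; apply: split3P => i.
- by rewrite gu mevalD !mevalM !mevalC !mevalXU su sv uu_sl2.
- by rewrite gv mevalD !mevalM !mevalC !mevalXU su sv vv_sl2.
- by rewrite gz mevalXU sz zz_sl2.
Qed.

(** Both sides are ring morphisms, so it suffices to compare generators, where
    [x_i] and [- y_i] transform under the contragredient action as [vv i] and
    [uu i] do under right translation. *)
Lemma Psi_sl2_sub h Q : Psi (Q \mPo [tuple sl2_sub h k | k < K]) = theta (L_diag n h) (Psi Q).
Proof.
have [gu gv gz] := sl2_subE h; have [hu hv hz] := @gen_coordE C m; have [du dv dz] := @sdegE m sigma.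
elim/mpoly_ring_ind: Q => [c|k|a b IHa IHb|a b IHa IHb].
- by rewrite comp_mpolyC PsiC thetaC tensor_actC.
- rewrite comp_mpolyXU -tnth_nth tnth_mktuple PsiX thetaM thetaC thetaX.
  move: k; apply: split3P => i.
  + rewrite gu PsiD !PsiM !PsiC !PsiX hu hv du dv !mulrA -mulrDl; congr (_ * _).
    rewrite -!mpolyCM -mpolyCD tensor_actN tensor_act_y ffunE -!mul_mpolyC.
    by congr (_%:MP); rewrite opprD opprK mulrN addrC.
  + rewrite gv PsiD !PsiM !PsiC !PsiX hu hv du dv !mulrA -mulrDl; congr (_ * _).
    rewrite -!mpolyCM -mpolyCD tensor_act_x ffunE -!mul_mpolyC.
    by congr (_%:MP); rewrite mulrN addrC.
  + by rewrite gz PsiX hz -[1]mpolyC1 tensor_actC.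
- by rewrite comp_mpolyD !PsiD thetaD IHa IHb.
- by rewrite rmorphM !PsiM thetaM IHa IHb.
Qed.

Lemma ref_isoP : graded_SL2_iso sigma phi0.
Proof.
split.
- split.
  + by move=> f /B_sigmaP[Q ->]; rewrite ref_isoE; apply: Psi_A.
  + move=> f f'; rewrite !in_setE => /B_sigmaP[Q ->] /B_sigmaP[Q' ->].
    by rewrite !ref_isoE => /Psi_inj ->.
  + move=> a /Psi_surj[Q <-]; exists (ev Q); last exact: ref_isoE.
    by apply/B_sigmaP; exists Q.
- move=> c f f' /B_sigmaP[Q ->] /B_sigmaP[Q' ->].
  have -> : (fun g => c * ev Q g + ev Q' g) = ev (c%:MP * Q + Q').
    by apply: funext => g; rewrite /evg mevalD mevalM mevalC.
  by rewrite !ref_isoE PsiD PsiM PsiC -mul_mpolyC.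
- have -> : 1 = ev 1 by apply: funext => g; rewrite /evg meval1.
  by rewrite ref_isoE Psi1.
- move=> f f' /B_sigmaP[Q ->] /B_sigmaP[Q' ->].
  have -> : ev Q * ev Q' = ev (Q * Q') by apply: funext => g; rewrite /evg mevalM.
  by rewrite !ref_isoE PsiM.
- by move=> h f /B_sigmaP[Q ->]; rewrite -ev_sl2_sub !ref_isoE Psi_sl2_sub.
- move=> p pL; apply/seteqP; split=> [_ [f fW <-]|_ [a aA <-]].
    have [Q -> Qp] := W_ev pL fW; rewrite ref_isoE (Psi_homog Qp).
    by exists (tensor_val Q) => //; apply: (tensor_val_A Qp).
  have [Q QE Qp] := A_lift pL aA.
  by exists (ev Q); [apply: homog_W|rewrite ref_isoE].
Qed.

End IsoProof.

(** * Uniqueness up to scalars *)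

Section Uniqueness.
Variables (C : numFieldType) (m : nat) (sigma : order_type m.+1).
Notation n := m.+1.
Implicit Types (p q : bidegree n) (f : Sp C n -> C).

Notation K := ((n + n) + n.-1)%N.
Implicit Types (Q : {mpoly C[K]}) (e : 'X_{1..K}).
Notation ku i := (lshift n.-1 (lshift n i)).
Notation kv i := (lshift n.-1 (rshift n i)).
Notation kz i := (rshift (n + n) i).
Notation ev := (evg (@sgen C m sigma)).
Notation sdeg := (@gen_deg m sigma).
Notation Psi := (@to_tensor C m sigma).
Notation phi0 := (@ref_iso C m sigma).

(** The sums of exponents are the numbers [r_i], and the exponent of the variable
    of [zz j] is the gap between [mu_j] and [lambda_(j+1)]. *)
Lemma degm_exponents e e' : degm sdeg e = degm sdeg e' ->
  (forall i, e (ku i) + e (kv i) = e' (ku i) + e' (kv i))%N /\ (forall j, e (kz j) = e' (kz j)).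
Proof.
move=> E; split=> i; first by rewrite -!(r_degm sigma) E.
have := deg_pair sigma e i; have := deg_pair sigma e' i; rewrite E !xvalS.
by case: ifP => _ [-> ->] [H1 H2]; lia.
Qed.

Lemma degm1 k : degm sdeg U_(k)%MM = sdeg k.
Proof.
rewrite /degm (bigD1 k) //= mnm1E eqxx mulm1n big1 ?addm0 // => j jk.
by rewrite mnm1E eq_sym (negPf jk) mulm0n.
Qed.

Lemma homog_z Q j : (forall e, e \in msupp Q -> degm sdeg e = sdeg (kz j)) ->
  exists c, Q = c%:MP * 'X_(kz j).
Proof.
move=> Qp; exists Q@_(U_(kz j))%MM; apply/mpolyP => e; rewrite mcoeffCM mcoeffX.
case: eqP => [<-|eU]; first by rewrite mulr1.
rewrite mulr0; apply: memN_msupp_eq0; apply/negP => /Qp; rewrite -degm1 => /degm_exponents[eu ez].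
apply: eU; apply/esym/mnmP; apply: split3P => i.
- have := eu i; rewrite !mnm1E !eq_shift /=; lia.
- have := eu i; rewrite !mnm1E !eq_shift /=; lia.
- by rewrite ez.
Qed.

Lemma homog_u Q i : (forall e, e \in msupp Q -> degm sdeg e = sdeg (ku i)) ->
  exists a b, Q = a%:MP * 'X_(ku i) + b%:MP * 'X_(kv i).
Proof.
move=> Qp; exists Q@_(U_(ku i))%MM, Q@_(U_(kv i))%MM; apply/mpolyP => e.
rewrite mcoeffD !mcoeffCM !mcoeffX.
have uv : (U_(ku i) == U_(kv i) :> 'X_{1..K})%MM = false.
  apply/eqP => /mnmP/(_ (ku i)); rewrite !mnm1E eqxx !eq_shift. by [].
case: eqP => [<-|eU].
  by rewrite eq_sym uv mulr1 mulr0 addr0.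
case: eqP => [<-|eV]; first by rewrite mulr1 mulr0 add0r.
rewrite !mulr0 addr0; apply: memN_msupp_eq0; apply/negP => /Qp; rewrite -degm1.
move=> /degm_exponents[eu ez].
have ez0 j : e (kz j) = 0%N by rewrite ez mnm1E !eq_shift.
have eu0 j : (e (ku j) + e (kv j) = (j == i))%N.
  by rewrite eu !mnm1E !eq_shift addn0 eq_sym.
have [ei|ei] := eqVneq (e (ku i)) 1%N.
  apply: eU; apply/esym/mnmP; apply: split3P => j.
  - have := eu0 j; rewrite mnm1E !eq_shift eq_sym; case: (i =P j) => [<-|_]; rewrite ?ei //; lia.
  - have := eu0 j; rewrite mnm1E !eq_shift; case: (j =P i) => [->|_]; rewrite ?ei //; lia.
  - by rewrite ez0 mnm1E !eq_shift.
have ei' : e (ku i) = 0%N by have := eu0 i; rewrite eqxx; move: ei; lia.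
apply: eV; apply/esym/mnmP; apply: split3P => j.
- have := eu0 j; rewrite mnm1E !eq_shift; case: (j =P i) => [->|_]; rewrite ?ei' //; lia.
- have := eu0 j; rewrite mnm1E !eq_shift [i == j]eq_sym.
  by case: (j =P i) => [->|_]; rewrite ?ei' // ?eqxx; lia.
- by rewrite ez0 mnm1E !eq_shift.
Qed.

Section Compare.
Variable phi : (Sp C n -> C) -> graded_ring C n.
Hypothesis iso : graded_SL2_iso sigma phi.

Lemma ev_B Q : B_sigma sigma (ev Q).
Proof. by apply/B_sigmaP; exists Q. Qed.

Lemma phi_lin c Q Q' : phi (ev (c%:MP * Q + Q')) = (c%:MP)%:MP * phi (ev Q) + phi (ev Q').
Proof.
have := iso_linear iso c (ev_B Q) (ev_B Q'); rewrite -mul_mpolyC => <-.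
by congr phi; apply: funext => g; rewrite /evg mevalD mevalM mevalC.
Qed.

Lemma phi_mul Q Q' : phi (ev (Q * Q')) = phi (ev Q) * phi (ev Q').
Proof.
rewrite -(iso_mul iso); try exact: ev_B.
by congr phi; apply: funext => g; rewrite /evg mevalM.
Qed.

Lemma phi_0 : phi (ev 0) = 0.
Proof.
have := phi_lin 1 0 0; rewrite mulr0 addr0 !mpolyC1 mul1r.
by move=> /(congr1 (fun x => x - phi (ev 0))); rewrite subrr addrK.
Qed.

Lemma phi_scale c Q : phi (ev (c%:MP * Q)) = (c%:MP)%:MP * phi (ev Q).
Proof. by rewrite -[_ * Q]addr0 phi_lin phi_0 addr0. Qed.

Lemma phi_1 : phi (ev 1) = 1.
Proof. by rewrite -(iso_one iso); congr phi; apply: funext => g; rewrite /evg meval1. Qed.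

Lemma phi_exp Q k : phi (ev (Q ^+ k)) = phi (ev Q) ^+ k.
Proof. by elim: k => [|k IH]; rewrite ?expr0 ?phi_1 // !exprS phi_mul IH. Qed.

Lemma phi_inj Q Q' : phi (ev Q) = phi (ev Q') -> Q = Q'.
Proof.
move=> E; apply: (@ev_inj C m sigma) => g.
have [[_ inj _] _ _ _ _ _] := iso.
by rewrite (inj _ _ _ _ E) // in_setE; apply: ev_B.
Qed.

Lemma phi_gen k : exists2 Q, phi (ev 'X_k) = Psi Q & forall e, e \in msupp Q -> degm sdeg e = sdeg k.
Proof.
have pL : Lambda_sigma C sigma (sdeg k) by rewrite -degm1; apply: Lambda_degm.
have kW : W (sdeg k) (ev 'X_k) by rewrite -degm1; apply: (mono_W (@sgenW C m sigma)).
have : (phi @` W (sdeg k)) (phi (ev 'X_k)) by exists (ev 'X_k).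
rewrite (iso_graded iso pL) => -[a aA <-].
by have [Q <- Qp] := A_lift pL aA; exists Q.
Qed.

Lemma Psi_sl2_sub_phi (h : SL2 C) Q Q' : phi (ev Q) = Psi Q' ->
  phi (ev (Q \mPo [tuple sl2_sub h k | k < K])) = Psi (Q' \mPo [tuple sl2_sub h k | k < K]).
Proof.
by move=> E; rewrite ev_sl2_sub (iso_equivariant iso) ?E ?Psi_sl2_sub //; apply: ev_B.
Qed.

Lemma sl2_subX (h : SL2 C) k : 'X_k \mPo [tuple sl2_sub h k | k < K] = sl2_sub h k.
Proof. by rewrite comp_mpolyXU -tnth_nth tnth_mktuple. Qed.

Lemma sl2_sub_lin (h : SL2 C) (a b : C) k l : (a%:MP * 'X_k + b%:MP * 'X_l) \mPo [tuple sl2_sub h k | k < K] =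
  a%:MP * sl2_sub h k + b%:MP * sl2_sub h l.
Proof. by rewrite comp_mpolyD !rmorphM /= !sl2_subX !comp_mpolyC. Qed.

Lemma coef_uv (a b a' b' : C) i : a%:MP * 'X_(ku i) + b%:MP * 'X_(kv i) =
  a'%:MP * 'X_(ku i) + b'%:MP * 'X_(kv i) :> {mpoly C[K]} -> a = a' /\ b = b'.
Proof.
move=> E; pose v x y (k : 'I_K) : C := if k == ku i then x else if k == kv i then y else 0.
have Ev x y : x * a + y * b = x * a' + y * b'.
  have := congr1 (meval (v x y)) E; rewrite !mevalD !mevalM !mevalC !mevalXU /v !eq_shift !eqxx.
  by rewrite ![x * _]mulrC ![y * _]mulrC.
by split; [have := Ev 1 0|have := Ev 0 1]; rewrite !mul1r !mul0r ?addr0 ?add0r.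
Qed.

Lemma diag_det : \det (\matrix_(i < 2, j < 2)
  (if i == j then (if i == 0 then 2%:R else 2%:R^-1) else 0) : 'M[C]_2) == 1.
Proof. by rewrite det2 !mxE /= mulr0 subr0 mulfV ?pnatr_eq0. Qed.

Lemma shear_det : \det (\matrix_(i < 2, j < 2)
  (if i == j then 1 else if j == 0 then 1 else 0) : 'M[C]_2) == 1.
Proof. by rewrite det2 !mxE /= mul0r subr0 mulr1. Qed.

(** Schur's lemma for the standard representation spanned by [uu i], [vv i]:
    a diagonal matrix with distinct eigenvalues forces a diagonal map and a
    shear makes the two eigenvalues equal. *)
Lemma phi_uv i : exists c : C, [/\ c != 0, phi (ev 'X_(ku i)) = (c%:MP)%:MP * Psi 'X_(ku i) &
  phi (ev 'X_(kv i)) = (c%:MP)%:MP * Psi 'X_(kv i)].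
Proof.
have [Qu Eu /homog_u[a [b Qab]]] := phi_gen (ku i).
have [Qv Ev Hv] := phi_gen (kv i).
have [c [d Qcd]] : exists c d, Qv = c%:MP * 'X_(ku i) + d%:MP * 'X_(kv i).
  apply: homog_u => e /Hv ->; have [du dv dz] := @sdegE m sigma; by rewrite du dv.
pose t : SL2 C := MkSL2 diag_det; pose s : SL2 C := MkSL2 shear_det.
have two0 : 2%:R != 0 :> C by rewrite pnatr_eq0.
have [tu tv _] := sl2_subE m t; have [su sv _] := sl2_subE m s.
have t00 : t 0 0 = 2%:R by rewrite /t /= mxE.
have t01 : t 0 1 = 0 by rewrite /t /= mxE.
have t10 : t 1 0 = 0 by rewrite /t /= mxE.
have t11 : t 1 1 = 2%:R^-1 by rewrite /t /= mxE.
have s00 : s 0 0 = 1 by rewrite /s /= mxE.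
have s01 : s 0 1 = 0 by rewrite /s /= mxE.
have s10 : s 1 0 = 1 by rewrite /s /= mxE.
have s11 : s 1 1 = 1 by rewrite /s /= mxE.
have {}tu j : sl2_sub t (ku j) = (2%:R)%:MP * 'X_(ku j) by rewrite tu t00 t10 mpolyC0 mul0r addr0.
have {}tv j : sl2_sub t (kv j) = (2%:R^-1)%:MP * 'X_(kv j) by rewrite tv t01 t11 mpolyC0 mul0r add0r.
have {}su j : sl2_sub s (ku j) = 'X_(ku j) + 'X_(kv j) by rewrite su s00 s10 mpolyC1 !mul1r.
have {}sv j : sl2_sub s (kv j) = 'X_(kv j) by rewrite sv s01 s11 mpolyC0 mpolyC1 mul0r mul1r add0r.
have half : 2%:R^-1 != 2%:R :> C.
  apply/eqP => E; have /eqP : 2%:R * 2%:R^-1 = 1 :> C by rewrite mulfV.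
  by rewrite E -natrM -[1]/(1%:R) eqr_nat.
have b0 : b = 0.
  have := Psi_sl2_sub_phi t Eu; rewrite sl2_subX tu phi_scale Eu Qab sl2_sub_lin tu tv -(PsiC sigma) -PsiM.
  move=> /Psi_inj; rewrite mulrDr !mulrA -!mpolyCM => /coef_uv[_ /eqP].
  rewrite [b * _]mulrC -subr_eq0 -mulrBl mulf_eq0 subr_eq0 eq_sym (negPf half) /=.
  by move=> /eqP.
have c0 : c = 0.
  have := Psi_sl2_sub_phi t Ev; rewrite sl2_subX tv phi_scale Ev Qcd sl2_sub_lin tu tv -(PsiC sigma) -PsiM.
  move=> /Psi_inj; rewrite mulrDr !mulrA -!mpolyCM => /coef_uv[/eqP + _].
  rewrite [c * _]mulrC -subr_eq0 -mulrBl mulf_eq0 subr_eq0 (negPf half) /=.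
  by move=> /eqP.
have da : d = a.
  have := Psi_sl2_sub_phi s Eu; rewrite sl2_subX su -[X in X + _]mul1r -mpolyC1 phi_lin Eu Ev.
  rewrite !mpolyC1 mul1r -PsiD => /Psi_inj; rewrite Qab Qcd b0 c0 sl2_sub_lin su sv.
  rewrite mpolyC0 !mul0r add0r !addr0 mulrDr => /coef_uv[_ ->].
  by [].
exists a; split.
- apply/eqP => a0; have : 'X_(ku i) = 0 :> {mpoly C[K]}.
    apply: phi_inj; rewrite Eu Qab a0 b0 !mpolyC0 !mul0r addr0 phi_0.
    by rewrite /to_tensor mmap0.
  by move/mpolyP/(_ U_(ku i)%MM)/eqP; rewrite mcoeffX eqxx mcoeff0 oner_eq0.
- by rewrite Eu Qab b0 mpolyC0 mul0r addr0 PsiM PsiC.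
- by rewrite Ev Qcd c0 da mpolyC0 mul0r add0r PsiM PsiC.
Qed.

(** The graded piece of the bidegree of [zz j] is a line. *)
Lemma phi_z j : exists2 c : C, c != 0 & phi (ev 'X_(kz j)) = (c%:MP)%:MP * Psi 'X_(kz j).
Proof.
have [Q E /homog_z[c Qc]] := phi_gen (kz j); exists c; last by rewrite E Qc PsiM PsiC.
apply/eqP => c0; have : 'X_(kz j) = 0 :> {mpoly C[K]}.
  apply: phi_inj; rewrite E Qc c0 mpolyC0 mul0r phi_0.
  by rewrite /to_tensor mmap0.
by move/mpolyP/(_ U_(kz j)%MM)/eqP; rewrite mcoeffX eqxx mcoeff0 oner_eq0.
Qed.

(** The scalars on the generators multiply to a function of the bidegree, since
    the bidegree determines the exponents that enter. *)
Lemma phi_scalar p : Lambda_sigma C sigma p ->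
  exists2 c : C, c != 0 & forall f, W p f -> phi f = c%:MP *: phi0 f.
Proof.
move=> pL; have [e0 pE] := Lambda_ex pL.
have [cu cuP] : exists cu : {ffun 'I_n -> C}, forall i, [/\ cu i != 0,
    phi (ev 'X_(ku i)) = ((cu i)%:MP)%:MP * Psi 'X_(ku i) &
    phi (ev 'X_(kv i)) = ((cu i)%:MP)%:MP * Psi 'X_(kv i)].
  have [F HF] := fin_all_exists phi_uv; exists [ffun i => F i] => i.
  by rewrite ffunE; apply: HF.
have [cz czP] : exists cz : {ffun 'I_n.-1 -> C}, forall j,
    cz j != 0 /\ phi (ev 'X_(kz j)) = ((cz j)%:MP)%:MP * Psi 'X_(kz j).
  have H j : exists c : C, c != 0 /\ phi (ev 'X_(kz j)) = (c%:MP)%:MP * Psi 'X_(kz j).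
    by have [c c0 cE] := phi_z j; exists c.
  have [F HF] := fin_all_exists H; exists [ffun i => F i] => i.
  by rewrite ffunE; apply: HF.
pose c e : C := (\prod_(i < n) cu i ^+ (e (ku i) + e (kv i))) * \prod_(j < n.-1) cz j ^+ e (kz j).
have cE e : degm sdeg e = p -> c e = c e0.
  rewrite pE => /degm_exponents[eu ez]; rewrite /c; congr (_ * _); apply: eq_bigr => i _.
    by rewrite eu.
  by rewrite ez.
have mono e : phi (ev 'X_[e]) = ((c e)%:MP)%:MP * Psi 'X_[e].
  pose ck (k : 'I_K) : C := match fintype.split k with
    | inl k1 => match fintype.split k1 with inl i => cu i | inr i => cu i end
    | inr j => cz j end.
  have [cku ckv ckz] := split3 (F := ck) (fun k => erefl (ck k)).
  have ckE k : phi (ev 'X_k) = ((ck k)%:MP)%:MP * Psi 'X_k.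
    move: k; apply: split3P => i; rewrite ?cku ?ckv ?ckz; first by case: (cuP i).
      by case: (cuP i).
    by case: (czP i).
  have -> : c e = \prod_(k < K) ck k ^+ e k.
    rewrite /c !big_split_ord /=; congr (_ * _).
      by rewrite -big_split /=; apply: eq_bigr => i _; rewrite cku ckv exprD.
    by apply: eq_bigr => i _; rewrite ckz.
  rewrite mpolyXE_id !rmorph_prod /to_tensor rmorph_prod -/(to_tensor _) -big_split /=.
  elim: (index_enum _) => [|k r IH]; first by rewrite !big_nil phi_1.
  rewrite !big_cons phi_mul IH phi_exp ckE exprMn; congr (_ * _).
  by rewrite !rmorphXn.
exists (c e0).
  rewrite mulf_neq0 // prodf_seq_neq0; apply/allP => i _; rewrite expf_neq0 //.
    by case: (cuP i).
  by case: (czP i).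
move=> f fW; have [Q -> Qp] := W_ev pL fW; rewrite ref_isoE -mul_mpolyC.
rewrite [in LHS](mpolyE Q) [in RHS](mpolyE Q) Psi_sum mulr_sumr big_seq [RHS]big_seq.
have : {subset msupp Q <= msupp Q} by [].
rewrite -big_seq -[RHS]big_seq; elim: {1 3 4}(msupp Q) => [|e r IH] sr.
  by rewrite !big_nil phi_0.
rewrite !big_cons.
rewrite -mul_mpolyC phi_lin IH; last by move=> x xr; apply: sr; rewrite inE xr orbT.
congr (_ + _); rewrite mono (cE e); last by apply: Qp; apply: sr; rewrite mem_head.
by rewrite PsiM PsiC mulrCA.
Qed.

End Compare.

End Uniqueness.

(** * The transferred representation *)

Section ThetaAction.
Variables (C : numFieldType) (n : nat).
Notation grT := {mpoly {mpoly C[n + n]}[n.-1 + n]}.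
Implicit Types (g h : Lgrp C n) (a b : grT) (p : bidegree n).

Lemma lgrp_mulE g h (i : 'I_n) : (g * h)%g i = (g i * h i)%g.
Proof. by rewrite ffunE. Qed.

Lemma lgrp_oneE (i : 'I_n) : (1%g : Lgrp C n) i = 1%g.
Proof. by rewrite ffunE. Qed.

Lemma xy_ind (P : {mpoly C[n + n]} -> Prop) : (forall c, P c%:MP) ->
  (forall i, P 'X_(lshift n i)) -> (forall i, P 'X_(rshift n i)) ->
  (forall x y, P x -> P y -> P (x + y)) -> (forall x y, P x -> P y -> P (x * y)) ->
  forall x, P x.
Proof.
move=> Pc Pl Pr PD PM; apply: mpoly_ring_ind => // k.
by rewrite -(splitK k); case: (fintype.split k) => i /=.
Qed.

Lemma tensor_act1 (x : {mpoly C[n + n]}) : tensor_act (1%g : Lgrp C n) x = x.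
Proof.
elim/xy_ind: x => [c|i|i|x y Hx Hy|x y Hx Hy].
- exact: tensor_actC.
- by rewrite tensor_act_x lgrp_oneE /= !mxE /= scale1r scale0r subr0.
- by rewrite tensor_act_y lgrp_oneE /= !mxE /= scale1r scale0r oppr0 add0r.
- by rewrite tensor_actD Hx Hy.
- by rewrite tensor_actM Hx Hy.
Qed.

Lemma tensor_actZ g (c : C) (x : {mpoly C[n + n]}) : tensor_act g (c *: x) = c *: tensor_act g x.
Proof. by rewrite -!mul_mpolyC tensor_actM tensor_actC. Qed.

Lemma sl2_mulE (s t : SL2 C) i j : (s * t)%g i j = s i 0 * t 0 j + s i 1 * t 1 j.
Proof.
rewrite [LHS]mxE !big_ord_recl big_ord0 addr0.
by congr (s _ _ * t _ _ + s _ _ * t _ _); apply: val_inj.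
Qed.

Lemma tensor_actG g h (x : {mpoly C[n + n]}) :
  tensor_act (g * h)%g x = tensor_act g (tensor_act h x).
Proof.
elim/xy_ind: x => [c|i|i|x y Hx Hy|x y Hx Hy].
- by rewrite !tensor_actC.
- rewrite !tensor_act_x lgrp_mulE !sl2_mulE tensor_actD tensor_actN !tensor_actZ.
  rewrite tensor_act_x tensor_act_y; apply/mpolyP => e.
  by rewrite !(mcoeffD, mcoeffN, mcoeffZ); ring.
- rewrite !tensor_act_y lgrp_mulE !sl2_mulE tensor_actD tensor_actN !tensor_actZ.
  rewrite tensor_act_x tensor_act_y; apply/mpolyP => e.
  by rewrite !(mcoeffD, mcoeffN, mcoeffZ); ring.
- by rewrite !tensor_actD Hx Hy.
- by rewrite !tensor_actM Hx Hy.
Qed.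

Lemma theta1 a : theta 1%g a = a.
Proof. by apply/mpolyP => p; rewrite theta_coef tensor_act1. Qed.

Lemma thetaG g h a : theta (g * h)%g a = theta g (theta h a).
Proof. apply/mpolyP => p; transitivity (tensor_act (g * h)%g a@_p); first exact: theta_coef.
rewrite tensor_actG; apply: esym; apply: etrans (theta_coef _ _ _) _.
by congr (tensor_act g _); apply: theta_coef. Qed.

Lemma sl2_act_homog (s : SL2 C) (f : {mpoly C[2]}) d : f \is d.-homog -> sl2_act s f \is d.-homog.
Proof.
move=> /dhomogP fd; rewrite /sl2_act (mpolyE f) raddf_sum /= big_seq.
apply: rpred_sum => e ef; rewrite comp_mpolyZ; apply: rpredZ.
rewrite comp_mpolyX; have <- : mdeg e = d := fd e ef.
rewrite mdegE; apply: (big_ind2 (fun (q : {mpoly C[2]}) k => q \is k.-homog)).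
- exact: dhomog1.
- by move=> q k q' k' Hq Hq'; apply: dhomogM.
move=> k _; rewrite tnth_mktuple -[X in X.-homog]mul1n; apply: dhomogMn.
by apply: rpred_sum => l _; apply: rpredZ; rewrite dhomogX /= mdeg1.
Qed.

Lemma tensor_act_A g p (x : {mpoly C[n + n]}) : A_comp p x -> A_comp p (tensor_act g x).
Proof.
move=> [us [usF ->]]; exists [seq [ffun i => sl2_act (g i) (u i)] | u : {ffun 'I_n -> {mpoly C[2]}} <- us].
split.
  move=> _ /mapP[u us_u ->] i; rewrite ffunE; apply: sl2_act_homog.
  exact: usF.
rewrite big_map; elim: us {usF} => [|u us IH].
  by rewrite !big_nil; apply: comp_mpoly0.
rewrite !big_cons tensor_actD IH tensor_act_pure; congr (_ + _).
by rewrite /pure_tensor; apply: eq_bigr => i _; rewrite ffunE.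
Qed.

Lemma theta_A (sigma : order_type n) g a : A_sigma sigma a -> A_sigma sigma (theta g a).
Proof.
move=> aA p; rewrite mcoeff_msupp theta_coef => H.
have /aA[pL pA] : p \in msupp a.
  by rewrite mcoeff_msupp; apply: contraNneq H => ->; rewrite /tensor_act comp_mpoly0.
by split=> //; apply: tensor_act_A.
Qed.

End ThetaAction.

Section Representation.
Variables (C : numFieldType) (m : nat) (sigma : order_type m.+1).
Notation n := m.+1.
Implicit Types (p q : bidegree n) (f : Sp C n -> C) (g h : Lgrp C n).
Notation ev := (evg (@sgen C m sigma)).

Lemma B_lin c f f' : B_sigma sigma f -> B_sigma sigma f' ->
  B_sigma sigma (fun x => c * f x + f' x).
Proof.
move=> /B_sigmaP[Q ->] /B_sigmaP[Q' ->]; apply/B_sigmaP; exists (c%:MP * Q + Q').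
by apply: funext => x; rewrite /evg mevalD mevalM mevalC.
Qed.

Section OneIso.
Variable phi : (Sp C n -> C) -> graded_ring C n.
Hypothesis iso : graded_SL2_iso sigma phi.

Lemma iso_inj f f' : B_sigma sigma f -> B_sigma sigma f' -> phi f = phi f' -> f = f'.
Proof. by move=> Bf Bf'; have [[_ inj _] _ _ _ _ _] := iso; apply: inj; rewrite in_setE. Qed.

Lemma PhiP g f : B_sigma sigma f ->
  B_sigma sigma (Phi sigma phi g f) /\ phi (Phi sigma phi g f) = theta g (phi f).
Proof.
move=> Bf; have [[hom inj surj] _ _ _ _ _] := iso.
have [f' Bf' E] := surj (theta g (phi f)) (theta_A (g := g) (hom _ Bf)).
by rewrite /Phi -E pinvKV ?in_setE.
Qed.

Lemma Phi_eq g f f' : B_sigma sigma f -> B_sigma sigma f' -> phi f' = theta g (phi f) ->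
  Phi sigma phi g f = f'.
Proof. by move=> Bf Bf' E; have [B' E'] := PhiP g Bf; apply: iso_inj => //; rewrite E' E. Qed.

Lemma Phi_lin g c f f' : B_sigma sigma f -> B_sigma sigma f' ->
  Phi sigma phi g (fun x => c * f x + f' x) =
  (fun x => c * Phi sigma phi g f x + Phi sigma phi g f' x).
Proof.
move=> Bf Bf'; have [B1 E1] := PhiP g Bf; have [B2 E2] := PhiP g Bf'.
apply: Phi_eq; [exact: B_lin|exact: B_lin|].
transitivity (c%:MP *: phi (Phi sigma phi g f) + phi (Phi sigma phi g f')).
  exact: (iso_linear iso).
transitivity (theta g (c%:MP *: phi f + phi f')); last first.
  by congr (theta g _); apply: esym; apply: (iso_linear iso).
apply: esym; apply: etrans (thetaD _ _ _) _; apply: esym.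
congr (_ + _); last exact: E2.
transitivity (c%:MP *: theta g (phi f)); first exact: (congr1 ( *:%R c%:MP) E1).
by apply: esym; apply: etrans (thetaZ _ _ _) _; congr (_ *: _); apply: tensor_actC.
Qed.

Lemma Phi_rep : is_representation (B_sigma sigma) (Phi sigma phi).
Proof.
split.
- by move=> g f /(PhiP g)[].
- by move=> g c f f' Bf Bf'; apply: Phi_lin.
- by move=> f Bf; apply: Phi_eq => //; rewrite theta1.
- move=> g h f Bf; have [B1 E1] := PhiP h Bf; have [B2 E2] := PhiP g B1.
  apply: (Phi_eq Bf B2); transitivity (theta g (theta h (phi f))).
    by apply: etrans E2 _; apply: congr1 E1.
  by apply: esym; apply: thetaG.
Qed.

End OneIso.

Variables (phi phi' : (Sp C n -> C) -> graded_ring C n).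
Hypotheses (iso : graded_SL2_iso sigma phi) (iso' : graded_SL2_iso sigma phi').

Lemma iso_scalar p : Lambda_sigma C sigma p ->
  exists2 c : C, c != 0 & forall f, W p f -> phi f = c%:MP *: phi' f.
Proof.
move=> pL; have [c c0 cP] := phi_scalar iso pL; have [d d0 dP] := phi_scalar iso' pL.
exists (c / d); first by rewrite mulf_neq0 ?invr_eq0.
by move=> f fW; rewrite cP // dP // scalerA -mpolyCM divfK.
Qed.

(** The two isomorphisms differ by a scalar on [W p], and the action of [g] on
    the model preserves the image of [W p]; so the scalar cancels. *)
Lemma Phi_canonical_W g p f : Lambda_sigma C sigma p -> W p f ->
  Phi sigma phi g f = Phi sigma phi' g f.
Proof.
move=> pL fW; have Bf := W_B pL fW; have [c c0 cP] := iso_scalar pL.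
have [B' E'] := PhiP iso' g Bf.
apply: (Phi_eq iso Bf B').
have [f1 f1W f1E] : (phi' @` W p) (theta g (phi' f)).
  have : (phi' @` W p) (phi' f) by exists f.
  rewrite (iso_graded iso' pL) => -[a aA <-].
  by exists (tensor_act g a); [apply: tensor_act_A|rewrite thetaZ thetaX].
have <- : f1 = Phi sigma phi' g f.
  by apply: (iso_inj iso') => //; [apply: W_B f1W|apply: etrans f1E (esym E')].
apply: etrans (cP _ f1W) _; apply: etrans (congr1 ( *:%R c%:MP) f1E) _.
apply: esym; transitivity (theta g (c%:MP *: phi' f)); first exact: congr1 (cP _ fW).
by apply: etrans (thetaZ _ _ _) _; congr (_ *: _); apply: tensor_actC.
Qed.

Lemma Phi_canonical g f : B_sigma sigma f -> Phi sigma phi g f = Phi sigma phi' g f.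
Proof.
move=> [ps [G [GW ->]]].
have B0 : B_sigma sigma (fun _ : Sp C n => 0).
  by apply/B_sigmaP; exists 0; apply: funext => x; rewrite /evg meval0.
have Bsum s : {subset s <= ps} -> B_sigma sigma (\sum_(p <- s) G p).
  move=> sps; exists s, G; split => // p /sps; exact: GW.
have : {subset ps <= ps} by [].
elim: {1 3 4}ps => [|p s IH] sps.
  have -> : \sum_(p <- [::]) G p = (fun x => 0 * 0 + 0) :> (Sp C n -> C).
    by rewrite big_nil; apply: funext => x; rewrite mulr0 addr0.
  have z0 (psi : (Sp C n -> C) -> graded_ring C n) : graded_SL2_iso sigma psi ->
      Phi sigma psi g (fun=> 0) = fun=> 0.
    move=> ipsi; have := Phi_lin ipsi g (-1) B0 B0.
    rewrite (_ : (fun _ => -1 * 0 + 0) = fun=> 0); last by apply: funext => x; rewrite mulr0 addr0.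
    by move=> {1}->; apply: funext => x; rewrite mulN1r addNr.
  by rewrite (_ : (fun _ => _) = fun=> 0) ?z0 //; apply: funext => x; rewrite mulr0 addr0.
have Bs : B_sigma sigma (\sum_(q <- s) G q).
  by apply: Bsum => q qs; apply: sps; rewrite inE qs orbT.
have [pL pW] := GW p (sps p (mem_head _ _)); have Bp := W_B pL pW.
have -> : \sum_(q <- p :: s) G q = fun x => 1 * G p x + (\sum_(q <- s) G q) x.
  by rewrite big_cons; apply: funext => x; rewrite mul1r.
have IHs := IH (fun q qs => sps q (mem_behead (s := p :: s) qs)).
apply: etrans (Phi_lin iso g 1 Bp Bs) _; apply: esym.
apply: etrans (Phi_lin iso' g 1 Bp Bs) _.
by apply: funext => x; rewrite -IHs -(Phi_canonical_W g pL pW).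
Qed.

End Representation.

Theorem proposition3p7 (R : realType) (n : nat) (n_gt1 : (1 < n)%N)
    (sigma : order_type n) :
  ((exists phi : (Sp R[i] n -> R[i]) -> graded_ring R[i] n,
      graded_SL2_iso sigma phi) /\
   (forall phi phi' : (Sp R[i] n -> R[i]) -> graded_ring R[i] n,
      graded_SL2_iso sigma phi -> graded_SL2_iso sigma phi' ->
      forall p : bidegree n, Lambda_sigma R[i] sigma p ->
      exists2 c : R[i], c != 0 &
        forall f, W p f -> phi f = c%:MP *: phi' f)) /\
  ((forall phi : (Sp R[i] n -> R[i]) -> graded_ring R[i] n,
      graded_SL2_iso sigma phi ->
      is_representation (B_sigma sigma) (Phi sigma phi)) /\
   (forall phi phi' : (Sp R[i] n -> R[i]) -> graded_ring R[i] n,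
      graded_SL2_iso sigma phi -> graded_SL2_iso sigma phi' ->
      forall (g : Lgrp R[i] n) (f : Sp R[i] n -> R[i]),
      B_sigma sigma f -> Phi sigma phi g f = Phi sigma phi' g f)).
Proof.
case: n n_gt1 sigma => [//|m] _ sigma; split; split.
- by exists (ref_iso (C := R[i]) sigma); apply: ref_isoP.
- by move=> phi phi' iso iso' p pL; apply: (iso_scalar iso iso' pL).
- by move=> phi iso; apply: (Phi_rep iso).
- by move=> phi phi' iso iso' g f Bf; apply: (Phi_canonical iso iso').
Qed.
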